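(* Let $e=\min\{i\ge 2 : \ell \mid \frac{q^i-1}{q-1}\}$ and $d=\nu_\ell\big(\frac{q^e-1}{q-1}\big)$. (a) If $d=1$, then the series $L=L(0)\supseteq L(1)\supseteq L(2)\supseteq\cdots$ (with the $0$ module and all repetitions removed) is the socle series of $L$. (b) Let $P\in\mathcal P$. Then $\mathrm{soc}(L/L(P)^\sharp)=L(P)/L(P)^\sharp$, except for the possibility that $(L'(Q)+L(P)^\sharp)/L(P)^\sharp$ be also irreducible, where $Q=[a,0,\dots,0]$ for an integer $a$ with $\ell\le a-1<\lfloor n/e\rfloor$ and $d(a-1)<\phi(P)<da$. (That is: either the equality holds, or there is such an $a$ for which $(L'(Q)+L(P)^\sharp)/L(P)^\sharp$ is irreducible.) In particular, $\mathrm{soc}(L/L(P)^\sharp)=L(P)/L(P)^\sharp$ if $\phi(P)\ge d\lfloor n/e\rfloor$.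
   Context: Let $n\ge 2$ and $G=\mathrm{GL}_n(q)$, the general linear group over the finite field $F_q$ of characteristic $p$. Let $\ell\ne p$ be a prime, and let $R$ be a local principal ideal domain of characteristic $0$ with maximal ideal $\ell R$, containing a primitive $p$-th root of unity; $R^*$ is its unit group and $K=R/\ell R$. Modules are left modules. $\nu_\ell$ denotes the $\ell$-adic valuation of integers. $B$ is the group of upper triangular matrices in $G$ and $U$ the group of upper unitriangular matrices; $S_n$ is viewed as the subgroup of permutation matrices of $G$; $\widehat{S}=\sum_{s\in S}s\in RG$ for $S\subseteq G$. Put $\varepsilon=\sum_{\sigma\in S_n}\mathrm{sg}(\sigma)\,\sigma\widehat{B}\in RG$. The Steinberg lattice is the left ideal $I=RG\cdot\varepsilon$, and $L=I/\ell I$, a $KG$-module. Let $f:I\times I\to R$ be the restriction to $I$ of the $R$-bilinear form on $RG$ given by $(g,h)\mapsto\delta_{g,h}$ for $g,h\in G$, scaled by $1/|B|$ (it takes values in $R$). For $c\ge 0$ put $I(c)=\{x\in I : f(x,I)\subseteq \ell^cR\}$ and $L(c)=(I(c)+\ell I)/\ell I$. $\mathcal P$ is the set of standard parabolic subgroups (subgroups of $G$ containing $B$). For $P\in\mathcal P$ put $\phi(P)=\nu_\ell([P:B])$ and, with $c=\nu_\ell([G:P])$, $L(P)=L(c)$ and $L(P)^\sharp=L(c+1)$. For a group homomorphism $\lambda:U\to R^*$, let $P(\lambda)\in\mathcal P$ be the subgroup generated by $B$ and the transpositions $(i,i+1)$, $1\le i<n$, such that $\lambda$ is non-trivial on $X_{i,i+1}=\{I_n+aE^{i,i+1}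 : a\in F_q\}$. Put $F_\lambda=\sum_{u\in U}\lambda(u)u\varepsilon+\ell I\in L$. For $P\in\mathcal P$, $L'(P)=KG\cdot F_\lambda$ for any $\lambda$ with $P(\lambda)=P$ (such $\lambda$ exist and $L'(P)$ does not depend on the choice). For $0\le a\le\lfloor n/e\rfloor$, $[a,0,\dots,0]\in\mathcal P$ denotes the block upper triangular subgroup whose diagonal blocks have, in order, sizes $1$ ($n-ea$ times) and then $e$ ($a$ times). The first term of the socle series of $L$ is $\mathrm{soc}(L)$. *)

(* Defs.v *)
From HB Require Import structures.
From mathcomp Require Import all_boot all_order all_fingroup all_algebra.
From mathcomp Require Import ring_quotient.
From mathcomp Require Import boolp classical_sets.

Set Implicit Arguments.
Unset Strict Implicit.
Unset Printing Implicit Defensive.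

Import GRing.Theory.

Local Open Scope classical_set_scope.
Local Open Scope ring_scope.

(** * The group algebra [RG] *)

(* An alias of [{ffun G -> R^o}], so that the product below does not clash with
   the pointwise product of finite functions. *)
Definition galg (R : comNzRingType) (gT : finGroupType) : Type :=
  {ffun gT -> R^o}.

Section GroupAlgebra.
Variables (R : comNzRingType) (gT : finGroupType).
Implicit Types x y z : galg R gT.

HB.instance Definition _ := GRing.Lmodule.on (galg R gT).

Definition galg_of (g : gT) : galg R gT := [ffun h => (h == g)%:R].

Definition galg_mul x y : galg R gT :=
  [ffun g => \sum_(h : gT) x h * y (h^-1 * g)%g].

Fact galg_mulA : associative galg_mul.
Proof.
move=> x y z; apply/ffunP => g; rewrite !ffunE.
under eq_bigr do rewrite ffunE mulr_sumr.
under [RHS]eq_bigr do rewrite ffunE mulr_suml.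
rewrite [RHS]exchange_big /=; apply: eq_bigr => h _.
rewrite [RHS](reindex_inj (mulgI h)) /=; apply: eq_bigr => k _.
by rewrite mulKg invMg mulgA mulrA.
Qed.

Fact galg_mul1 : left_id (galg_of 1%g) galg_mul.
Proof.
move=> x; apply/ffunP => g; rewrite ffunE (bigD1 1%g) //= big1 ?addr0.
  by rewrite ffunE eqxx mul1r invg1 mul1g.
by move=> h /negbTE h1; rewrite ffunE h1 mul0r.
Qed.

Fact galg_mulg1 : right_id (galg_of 1%g) galg_mul.
Proof.
move=> x; apply/ffunP => g; rewrite ffunE (bigD1 g) //= big1 ?addr0.
  by rewrite ffunE mulVg eqxx mulr1.
move=> h hg; rewrite ffunE -eq_mulVg1.
by rewrite (negbTE hg) mulr0.
Qed.

Fact galg_mulDl : left_distributive galg_mul +%R.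
Proof.
move=> x y z; apply/ffunP => g; rewrite !ffunE -big_split /=.
by apply: eq_bigr => h _; rewrite ffunE mulrDl.
Qed.

Fact galg_mulDr : right_distributive galg_mul +%R.
Proof.
move=> x y z; apply/ffunP => g; rewrite !ffunE -big_split /=.
by apply: eq_bigr => h _; rewrite ffunE mulrDr.
Qed.

Fact galg_1neq0 : galg_of 1%g != 0.
Proof.
by apply/eqP => /ffunP/(_ 1%g)/eqP; rewrite !ffunE eqxx oner_eq0.
Qed.

HB.instance Definition _ := GRing.Zmodule_isNzRing.Build (galg R gT)
  galg_mulA galg_mul1 galg_mulg1 galg_mulDl galg_mulDr galg_1neq0.

Fact galg_scaleAl (a : R) x y : a *: (x * y) = a *: x * y.
Proof.
apply/ffunP => g; rewrite !ffunE scaler_sumr.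
by apply: eq_bigr => h _; rewrite ffunE -scalerAl.
Qed.

HB.instance Definition _ :=
  GRing.Lmodule_isLalgebra.Build R (galg R gT) galg_scaleAl.

End GroupAlgebra.

Arguments galg_of R {gT} g.

(** * Submodules, quotients and socles *)

Section Submodules.
Variables (A : nzRingType) (V : lmodType A).

Record submodule := Submodule {
  subm_set :> set V;
  subm_closed : GRing.submod_closed [in subm_set]
}.

Lemma submP (S : set V) :
  S 0 -> (forall a u v, S u -> S v -> S (a *: u + v)) ->
  GRing.submod_closed [in S].
Proof.
move=> S0 SL; split; first by rewrite inE.
by move=> a u v; rewrite !inE; apply: SL.
Qed.

Lemma subm0 (S : submodule) : subm_set S 0.
Proof. by case: S => S [/=]; rewrite inE. Qed.

Lemma submL (S : submodule) a u v :
  subm_set S u -> subm_set S v -> subm_set S (a *: u + v).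
Proof. by case: S => S [_ /(_ a u v) /=]; rewrite !inE. Qed.

Lemma submZ (S : submodule) a u : subm_set S u -> subm_set S (a *: u).
Proof. by move=> Su; rewrite -[_ *: _]addr0; apply: submL => //; apply: subm0. Qed.

Fact zero_closed : GRing.submod_closed [in [set 0 : V]].
Proof. by apply: submP => //= a u v -> ->; rewrite scaler0 addr0. Qed.

Definition zero_subm := Submodule zero_closed.

Fact cyclic_closed (v : V) :
  GRing.submod_closed [in [set u | exists a : A, u = a *: v]].
Proof.
apply: submP; first by exists 0; rewrite scale0r.
by move=> a _ _ [b ->] [c ->]; exists (a * b + c); rewrite scalerDl scalerA.
Qed.

Definition cyclic_subm (v : V) := Submodule (cyclic_closed v).

Fact mult_closed (l : nat) :
  GRing.submod_closed [in [set u | exists v : V, u = v *+ l]].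
Proof.
apply: submP; first by exists 0; rewrite mul0rn.
move=> a _ _ [u ->] [v ->]; exists (a *: u + v).
by rewrite mulrnDl scalerMnr.
Qed.

Definition mult_subm (l : nat) := Submodule (mult_closed l).

Fact add_closed (M N : submodule) :
  GRing.submod_closed
    [in [set w | exists u v, [/\ subm_set M u, subm_set N v & w = u + v]]].
Proof.
apply: submP; first by exists 0, 0; rewrite addr0; split=> //; apply: subm0.
move=> a _ _ [u [v [Mu Nv ->]]] [u' [v' [Mu' Nv' ->]]].
exists (a *: u + u'), (a *: v + v'); split; try exact: submL.
by rewrite scalerDr addrACA.
Qed.

Definition add_subm (M N : submodule) := Submodule (add_closed M N).

Definition irreducible (M : submodule) : Prop :=
  [/\ (M : set V) <> [set 0]
    & forall N : submodule, N `<=` M ->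
        (N : set V) = [set 0] \/ (N : set V) = M].

Definition maximal (M : submodule) : Prop :=
  [/\ (M : set V) <> [set: V]
    & forall N : submodule, M `<=` N ->
        (N : set V) = M \/ (N : set V) = [set: V]].

Fact socle_closed :
  GRing.submod_closed [in [set u | exists s : seq V,
    (forall v, v \in s -> exists2 M : submodule, irreducible M & subm_set M v)
    /\ u = \sum_(v <- s) v]].
Proof.
apply: submP; first by exists [::]; rewrite big_nil.
move=> a _ _ [s [Hs ->]] [t [Ht ->]].
exists ([seq a *: v | v <- s] ++ t); split.
  move=> v; rewrite mem_cat => /orP[/mapP[w ws ->]|/Ht//].
  by have [M irrM Mw] := Hs w ws; exists M => //; apply: submZ.
by rewrite big_cat big_map scaler_sumr.
Qed.

(* The sum of all the irreducible submodules of [V]. *)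
Definition socle := Submodule socle_closed.

End Submodules.

Section SubAndQuotient.
Variables (A : nzRingType) (V : lmodType A) (S : submodule V).

Definition subm_pred : {pred V} := [in (S : set V)].

HB.instance Definition _ :=
  GRing.isSubmodClosed.Build A V subm_pred (subm_closed S).

Record subm_type := SubmElt {
  subm_val : V;
  subm_valP : subm_val \in subm_pred
}.

HB.instance Definition _ := [isSub for subm_val].
HB.instance Definition _ := [Choice of subm_type by <:].
HB.instance Definition _ := [SubChoice_isSubLmodule of subm_type by <:].

Lemma subm_valL a (u v : subm_type) :
  subm_val (a *: u + v) = a *: subm_val u + subm_val v.
Proof. by []. Qed.

Lemma subm_valZ a (u : subm_type) : subm_val (a *: u) = a *: subm_val u.
Proof. by []. Qed.

Definition quotmod : Type := Quotient.quot subm_pred.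

HB.instance Definition _ := GRing.Zmodule.on quotmod.

Definition quotmod_pi (v : V) : quotmod := (\pi_(Quotient.quot subm_pred) v)%qT.

Lemma quotmod_piE u v : (quotmod_pi u == quotmod_pi v) = (u - v \in subm_pred).
Proof. by rewrite Quotient.idealrBE. Qed.

Definition quotmod_repr (x : quotmod) : V := generic_quotient.repr x.

Lemma quotmod_reprK : cancel quotmod_repr quotmod_pi.
Proof. by move=> x; rewrite /quotmod_repr /quotmod_pi reprK. Qed.

Fact quotmod_pi_is_zmod_morphism : zmod_morphism quotmod_pi.
Proof. by move=> u v; apply: (raddfB (\pi_(Quotient.quot subm_pred)%qT)). Qed.

HB.instance Definition _ :=
  GRing.isZmodMorphism.Build V quotmod quotmod_pi quotmod_pi_is_zmod_morphism.

Definition quotmod_scale (a : A) (x : quotmod) : quotmod :=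
  quotmod_pi (a *: quotmod_repr x).

Lemma quotmod_pi_scale a v : quotmod_scale a (quotmod_pi v) = quotmod_pi (a *: v).
Proof.
apply/eqP; rewrite quotmod_piE -scalerBr rpredZ //.
by rewrite -quotmod_piE quotmod_reprK.
Qed.

Fact quotmod_scaleA a b x :
  quotmod_scale a (quotmod_scale b x) = quotmod_scale (a * b) x.
Proof. by rewrite -(quotmod_reprK x) !quotmod_pi_scale scalerA. Qed.

Fact quotmod_scale1 : left_id 1 quotmod_scale.
Proof. by move=> x; rewrite -(quotmod_reprK x) quotmod_pi_scale scale1r. Qed.

Fact quotmod_scaleDr : right_distributive quotmod_scale +%R.
Proof.
move=> a x y; rewrite -(quotmod_reprK x) -(quotmod_reprK y).
by rewrite -raddfD !quotmod_pi_scale -raddfD scalerDr.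
Qed.

Fact quotmod_scaleDl x : {morph quotmod_scale^~ x : a b / a + b}.
Proof.
by move=> a b; rewrite -(quotmod_reprK x) !quotmod_pi_scale -raddfD scalerDl.
Qed.

HB.instance Definition _ := GRing.Zmodule_isLmodule.Build A quotmod
  quotmod_scaleA quotmod_scale1 quotmod_scaleDr quotmod_scaleDl.

Fact quotmod_pi_is_scalable : scalable quotmod_pi.
Proof. by move=> a v; rewrite -quotmod_pi_scale. Qed.

HB.instance Definition _ :=
  GRing.isScalable.Build A V quotmod _ quotmod_pi quotmod_pi_is_scalable.

Fact subm_pi_closed (M : submodule V) :
  GRing.submod_closed [in quotmod_pi @` add_subm M S].
Proof.
apply: submP; first by exists 0; [exact: subm0 | rewrite raddf0].
move=> a _ _ [u Mu <-] [v Mv <-]; exists (a *: u + v); first exact: submL.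
by rewrite linearP.
Qed.

(* The submodule [(M + S) / S] of [V / S]. *)
Definition subm_pi (M : submodule V) := Submodule (subm_pi_closed M).

Fact subm_pi_preim_closed (M : submodule quotmod) :
  GRing.submod_closed [in quotmod_pi @^-1` M].
Proof.
apply: submP; first by rewrite /preimage /= raddf0; exact: subm0.
by move=> a u v Mu Mv; rewrite /preimage /= linearP; exact: submL.
Qed.

Definition subm_pi_preim (M : submodule quotmod) :=
  Submodule (subm_pi_preim_closed M).

End SubAndQuotient.

Section SocleSeries.
Variables (A : nzRingType) (V : lmodType A).

(* [soc^0 = 0] and [soc^(i+1) / soc^i = soc (V / soc^i)]. *)
Fixpoint socle_iter (i : nat) : submodule V :=
  if i is j.+1 then subm_pi_preim (socle (quotmod (socle_iter j)))
  else zero_subm V.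

(* [s] lists [soc^1], ..., [soc^m], where [m] is the least index with
   [soc^m = V]. *)
Definition socle_series (s : seq (set V)) : Prop :=
  [/\ s = mkseq (fun i => socle_iter i.+1 : set V) (size s),
      last [set 0] s = [set: V]
    & uniq ([set 0] :: s)].

End SocleSeries.

(** * Local principal ideal domains *)

Definition principal_ideal_domain (R : idomainType) : Prop :=
  forall J : submodule R^o, exists a : R, (J : set R^o) = cyclic_subm (a : R^o).

Definition local_with_maximal_ideal (R : idomainType) (m : submodule R^o) :
    Prop :=
  forall J : submodule R^o, maximal J <-> (J : set R^o) = m.

(** * Subgroups of the general linear group *)

Section GeneralLinear.
Variables (F : finFieldType) (n : nat).
Local Notation G := {'GL_n[F]}.
Local Notation I_n := 'I_n.-1.+1.

Definition borel : {set G} :=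
  [set g : G | [forall i : I_n, forall j : I_n,
     (j < i)%N ==> (val g i j == 0)]]%SET.

Definition unitri : {set G} :=
  [set g in borel | [forall i : I_n, val g i i == 1]]%SET.

Definition perm_GL (s : {perm I_n}) : G := FinRing.unit _ (unitmx_perm F s).

Definition root_subgroup (i j : I_n) : {set G} :=
  [set g : G | [exists a : F, val g == 1%:M + a *: delta_mx i j]]%SET.

(* The index of the diagonal block containing position [i], for diagonal
   blocks of sizes [1] ([n - e * a] times) and then [e] ([a] times). *)
Definition block_index (e a i : nat) : nat :=
  if (i < n - e * a)%N then i
  else ((n - e * a) + (i - (n - e * a)) %/ e)%N.

(* [[a, 0, ..., 0]]. *)
Definition block_parabolic (e a : nat) : {set G} :=
  [set g : G | [forall i : I_n, forall j : I_n,
     (block_index e a j < block_index e a i)%N ==> (val g i j == 0)]]%SET.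

Section Characters.
Variable R : idomainType.

(* Group homomorphisms [U -> R^*], extended arbitrarily to [G]. *)
Definition unitri_char (lam : G -> R) : Prop :=
  (forall u, u \in unitri -> lam u \is a GRing.unit) /\
  {in unitri &, forall u v, lam (u * v)%g = lam u * lam v}.

(* [P(lam)]. *)
Definition char_parabolic (lam : G -> R) : {set G} :=
  <<borel :|: [set g : G | [exists i : I_n, exists j : I_n,
     [&& j == i.+1 :> nat,
         [exists x in root_subgroup i j, (lam x != 1)%R]
       & g == perm_GL (tperm i j)]]]%SET>>%g.

End Characters.
End GeneralLinear.

(** * The Steinberg lattice and its reduction *)

Section Steinberg.
Variables (F : finFieldType) (n : nat) (R : idomainType) (l : nat).
Local Notation G := {'GL_n[F]}.
Local Notation RG := (galg R G).
Local Notation B := (borel F n).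

Definition galg_hat (S : {set G}) : RG := \sum_(s in S) galg_of R s.

Definition steinberg_elt : RG :=
  \sum_(s : {perm 'I_n.-1.+1})
    (-1) ^+ odd_perm s *: (galg_of R (perm_GL F s) * galg_hat B).

Definition steinberg : submodule RG^o := cyclic_subm (steinberg_elt : RG^o).

Local Notation I := (subm_type steinberg).

Lemma steinberg_elt_in : (steinberg_elt : RG^o) \in subm_pred steinberg.
Proof. by rewrite inE; exists 1; rewrite scale1r. Qed.

Definition steinberg_gen : I := SubmElt steinberg_elt_in.

(* The values lie in [R] on [I], but [|B|] need not be invertible in [R]: the
   scaled form is defined with values in the field of fractions. *)
Definition galg_form (x y : RG) : {fraction R} :=
  #|B|%:R^-1 * tofrac (\sum_(g : G) (x g : R) * (y g : R)).

(* The adjunction anti-automorphism of [galg_form], inverting group elements. *)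
Definition galg_star (x : RG) : RG := [ffun g => x g^-1%g].

Lemma galg_formP (a x y z : RG) :
  galg_form (a * x + y) z = galg_form x (galg_star a * z) + galg_form y z.
Proof.
rewrite /galg_form -mulrDr -rmorphD /=; congr (_ * tofrac _).
under eq_bigr do rewrite !ffunE mulrDl.
rewrite big_split /=; congr (_ + _).
under eq_bigr do rewrite mulr_suml.
under [RHS]eq_bigr do rewrite !ffunE mulr_sumr.
rewrite exchange_big /= [RHS]exchange_big /=.
rewrite [RHS](reindex_inj invg_inj) /=; apply: eq_bigr => h _.
rewrite (reindex_inj (mulgI h)) /=; apply: eq_bigr => k _.
by rewrite ffunE invgK mulKg mulrCA mulrA.
Qed.

Fact steinberg_filt_closed (c : nat) :
  GRing.submod_closed [in [set x : I | forall y : I, exists r : R,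
    galg_form (subm_val x) (subm_val y) = tofrac (l%:R ^+ c * r)]].
Proof.
apply: submP => [y|a u v Hu Hv y].
  exists 0; rewrite mulr0 /galg_form big1 => [|g _].
    by rewrite !rmorph0 mulr0.
  by rewrite ffunE mul0r.
have [r Hr] := Hu (galg_star a *: y); have [t Ht] := Hv y.
rewrite subm_valL; exists (r + t).
have -> : tofrac (l%:R ^+ c * (r + t)) =
          tofrac (l%:R ^+ c * r) + tofrac (l%:R ^+ c * t) :> {fraction R}.
  by rewrite mulrDr rmorphD.
by rewrite -Hr -Ht subm_valZ -galg_formP.
Qed.

(* [I(c)], as a submodule of [I]. *)
Definition steinberg_filt (c : nat) : submodule I :=
  Submodule (steinberg_filt_closed c).

(* [L = I / l I]. The prime [l] kills [L], on which [RG] therefore acts through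
   [KG = RG / l RG]: the [KG]-submodules of [L] are its [RG]-submodules, and
   [KG . x = RG . x]. *)
Definition Lmod : lmodType RG := quotmod (mult_subm I l).

Definition L_filt (c : nat) : submodule Lmod :=
  subm_pi (mult_subm I l) (steinberg_filt c).

(* [L(P)] and [L(P)^#]. *)
Definition L_par (P : {set G}) : submodule Lmod := L_filt (logn l #|'GL_n[F] : P|%g).

Definition L_par_sharp (P : {set G}) : submodule Lmod :=
  L_filt (logn l #|'GL_n[F] : P|%g).+1.

Definition F_elt (lam : G -> R) : Lmod :=
  quotmod_pi (mult_subm I l)
    ((\sum_(u in unitri F n) lam u *: galg_of R u) *: steinberg_gen).

(* [L'(P(lam))], which depends on [lam] only through [P(lam)]. *)
Definition L_prime (lam : G -> R) : submodule Lmod := cyclic_subm (F_elt lam).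

End Steinberg.

(* Main.v *)
Require Import Defs.
From mathcomp Require Import boolp classical_sets.
From mathcomp Require Import all_boot all_order all_fingroup all_algebra.
From mathcomp Require Import pgroup finfield.
From mathcomp Require Import zify ring.

(** Let eps generate the lattice I and, for a linear character lambda of U, let
    E_lambda be the sum of the lambda(u) u in RG.

    The Steinberg lattice contains every linear character of U exactly once:
    E_lambda I is the line spanned by E_lambda eps [char_sum_line]. Therefore
    E_lambda maps each vector of L to a multiple of F_lambda. On the other hand,
    as q is a unit in R, the elements E_lambda generate RG as a two-sided ideal,
    even if lambda is only taken among the characters [linchar D]
    [char_sums_generate]. Hence a vector outside a submodule M of L has some
    F_lambda outside M among its multiples [separation], and all questions on
    submodules of L become questions on the vectors F_lambda.

    The characters in question are indexed by the compositions b of n, which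
    list the block sizes of the parabolic subgroup of lambda. Let phi(b) be the
    l-adic valuation of the product of the q-factorials of the parts of b, and
    Phi = phi(n). Four facts about the vectors F_b are used.
    - The product of E_b eps with y in I is N_b r, where r is the scalar with
      which the inverse character sees y, and where the norm N_b is [n]_q!
      divided by the q-factorials of the parts [dec_sum_block]. Hence F_b lies
      in L(c) if and only if c + phi(b) <= Phi [L_filtP].
    - A permutation matrix that moves blocks maps F_b to F_b', up to a unit and
      up to projection to the line of b', if b' arises from b by permuting
      parts, or by splitting a part x + y into y, x [move_char_sum]. So F_b' is
      in RG F_b for all refinements b' of b.
    - If phi(b) = phi(b') and F_b' lies in RG F_b + L(c + 1) for c = Phi - phi(b),
      then F_b lies in RG F_b'. This follows from the adjointness of the form,
      as f does not vanish modulo l ^ (c + 1) on these vectors [filt_sym].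
    - The valuation of [r]_q! is d (r / e) plus that of (r / e)!, so that parts
      can be split in such a way that phi drops by at most one at each step,
      until all parts are 1 or e [canon_chain].

    The first and the third fact show that L(c)/L(c + 1) is a sum of irreducible
    modules, generated by the F_b with phi(b) = Phi - c. The second and the last
    one exclude further irreducible submodules of L/L(c + 1), unless Phi - c
    lies strictly between d (a - 1) and d a, where a is the number of parts e in
    a composition into parts 1 and e; and then the submodule is generated by the
    corresponding vector [socle_filt]. For d = 1 there is nothing in between. If
    c is the valuation of [G:P], then Phi - c is that of [P:B], a product of
    q-factorials, which can lie strictly between two consecutive multiples of d
    only if one of the factorials (r / e)! contributes; this gives l <= a - 1
    [exceptional_bound]. *)

Set Implicit Arguments.
Unset Strict Implicit.
Unset Printing Implicit Defensive.

Import GRing.Theory.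

(** * q-integers and their valuations *)

Definition qint (q r : nat) : nat := \sum_(i < r) q ^ i.
Definition qfact (q r : nat) : nat := \prod_(i < r) qint q i.+1.

Lemma qint0 q : qint q 0 = 0.
Proof. by rewrite /qint big_ord0. Qed.

Lemma qintS q r : qint q r.+1 = qint q r + q ^ r.
Proof. by rewrite /qint big_ord_recr. Qed.

Lemma qintD q a b : qint q (a + b) = qint q a + q ^ a * qint q b.
Proof.
rewrite /qint big_split_ord /= big_distrr /=; congr (_ + _).
by apply: eq_bigr => i _; rewrite expnD.
Qed.

Lemma qintM q a b : qint q (a * b) = qint q a * qint (q ^ a) b.
Proof.
elim: b => [|b IH]; first by rewrite muln0 !qint0 muln0.
by rewrite mulnS addnC qintD IH qintS mulnDr -expnM [q ^ _ * _]mulnC.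
Qed.

Lemma qint_gt0 q r : 0 < r -> 0 < qint q r.
Proof. by case: r => // r _; rewrite /qint big_ord_recl. Qed.

Lemma qintE q r : 1 < q -> (q ^ r - 1) %/ (q - 1) = qint q r.
Proof.
move=> q1; rewrite !subn1 predn_exp mulnC mulnK //.
by rewrite -ltnS (ltn_predK q1).
Qed.

Lemma qfact_gt0 q r : 0 < qfact q r.
Proof. by apply: prodn_gt0 => i; apply: qint_gt0. Qed.

Lemma qfactS q r : qfact q r.+1 = qfact q r * qint q r.+1.
Proof. by rewrite /qfact big_ord_recr. Qed.

Section LTE.
Variable l : nat.
Hypothesis l_prime : prime l.

Lemma qint_expand y k :
  exists t, qint (1 + l * y) k = k + l * y * 'C(k, 2) + l ^ 2 * t.
Proof.
have expE j : exists t, (1 + l * y) ^ j = 1 + l * y * j + l ^ 2 * t.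
  elim: j => [|j [t IH]]; first by exists 0; rewrite !muln0.
  by exists (t + y * (y * j) + l * y * t); rewrite expnS IH; nia.
elim: k => [|k [t IH]]; first by exists 0; rewrite qint0 !muln0.
have [s sE] := expE k; exists (t + s); rewrite qintS IH sE binS bin1; nia.
Qed.

(** The hypothesis of lifting the exponent. For l = 2 being odd does not
    suffice: 1 + 3 has valuation 2. *)
Definition lte_base x := (x = 1 %[mod l]) /\ (l = 2 -> x = 1 %[mod 4]).

Lemma lte_baseX x k : lte_base x -> lte_base (x ^ k).
Proof.
by move=> [x1 x4]; split=> [|/x4 xE]; rewrite -modnXm ?x1 ?xE modnXm exp1n.
Qed.

Lemma lte_base_gt0 x : lte_base x -> 0 < x.
Proof.
by case: x => // -[]; rewrite mod0n modn_small // prime_gt1.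
Qed.

(** Write x = 1 + l y. The expansion of the sum is l up to a multiple of l ^
    2: an odd l divides 'C(l, 2), and for l = 2 the sum 1 + x is 2 modulo 4. *)
Lemma logn_qint_base x : lte_base x -> logn l (qint x l) = 1.
Proof.
move=> xb; have x0 := lte_base_gt0 xb; case: (xb) => /eqP + x4.
rewrite eqn_mod_dvd // => /dvdnP[y yE].
have log1 t : logn l (l + l ^ 2 * t) = 1.
  have -> : l + l ^ 2 * t = l * (1 + l * t) by nia.
  rewrite lognM ?(prime_gt0 l_prime) //.
  rewrite logn_prime // eqxx logn_coprime //.
  by rewrite prime_coprime // addnC dvdn_addr ?dvdn_mulr // dvdn1; case: eqP l_prime => // ->.
case: (eqVneq l 2) => [l2|l2].
  have /eqP := x4 l2; rewrite eqn_mod_dvd // => /dvdnP[u uE].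
  have -> : qint x l = l + l ^ 2 * u; last exact: log1.
  by rewrite l2 !qintS qint0 expn0 expn1; lia.
have [t tE] := qint_expand y l.
have : l %| 'C(l, 2).
  by apply: prime_dvd_bin => //; have := prime_gt1 l_prime; lia.
case/dvdnP=> w wE.
have -> : x = 1 + l * y by rewrite mulnC -yE subnKC.
by rewrite tE wE; apply: etrans (log1 (y * w + t)); congr (logn l _); ring.
Qed.

(** Lifting the exponent: the factors l of k are split off one at a time, and
    for k prime to l the sum is k modulo l. *)
Lemma logn_qint_lte x k : lte_base x -> logn l (qint x k) = logn l k.
Proof.
elim/ltn_ind: k x => k IH x xb.
case: (posnP k) => [->|k0]; first by rewrite qint0.
case: (boolP (l %| k)) => [/dvdnP[k' kE]|ndv].
  have lk' : k' < k by rewrite kE ltn_Pmulr ?prime_gt1 //; case: k' kE k0 => //; lia.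
  have k'0 : 0 < k' by lia.
  rewrite kE mulnC qintM lognM ?qint_gt0 ?(prime_gt0 l_prime) //.
  rewrite logn_qint_base //.
  rewrite IH //; last exact: lte_baseX.
  by rewrite lognM ?(prime_gt0 l_prime) // (logn_prime l l_prime) eqxx.
have := xb; case=> /eqP; rewrite eqn_mod_dvd; last exact: lte_base_gt0 xb.
move=> /dvdnP[y yE] _; have x0 := lte_base_gt0 xb.
have [t tE] := qint_expand y k.
rewrite !logn_coprime // prime_coprime //.
have -> : x = 1 + l * y by rewrite mulnC -yE subnKC.
rewrite tE -addnA dvdn_addl //.
by apply: dvdn_add; rewrite ?(expnS l 1) -!mulnA dvdn_mulr.
Qed.

End LTE.

Section Valuation.
Variables (q l e : nat).
Hypotheses (q_gt1 : 1 < q) (l_prime : prime l) (l_q : ~~ (l %| q)).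
Hypotheses (e_gt1 : 1 < e) (l_e : l %| qint q e).
Hypothesis e_min : forall i, 1 < i -> l %| qint q i -> e <= i.
Local Notation d := (logn l (qint q e)).

Lemma d_gt0 : 0 < d.
Proof. by rewrite logn_gt0 mem_primes l_prime l_e qint_gt0 // ltnW. Qed.

(** For l = 2 the minimality of e forces e = 2, and odd squares are 1 modulo
    4. *)
Lemma lte_base_exp : lte_base l (q ^ e).
Proof.
have q0 : 0 < q ^ e by rewrite expn_gt0 ltnW.
have qe1 : l %| q ^ e - 1 by rewrite subn1 predn_exp dvdn_mull.
split; first by apply/eqP; rewrite eqn_mod_dvd.
move=> l2; have qo : odd q by move: l_q; rewrite l2 dvdn2 negbK.
have e2 : e = 2.
  apply/eqP; rewrite eqn_leq e_gt1 andbT; apply: e_min => //.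
  by rewrite l2 !qintS qint0 expn0 expn1 dvdn2; lia.
apply/eqP; rewrite eqn_mod_dvd // e2.
have -> : q ^ 2 - 1 = (2 * (q./2)) * (2 * (q./2 + 1)) by lia.
by rewrite mulnACA dvdn_mulr.
Qed.

(** Modulo l the sum for r is that for the remainder of r by e, and by
    minimality of e the latter is nonzero modulo l unless the remainder is 0. *)
Lemma dvd_qint r : 0 < r -> (l %| qint q r) = (e %| r).
Proof.
move=> r0; rewrite {1}(divn_eq r e) addnC qintD.
rewrite dvdn_addl; last by rewrite dvdn_mull // mulnC qintM dvdn_mulr.
have lt_e : r %% e < e by rewrite ltn_mod; lia.
rewrite /dvdn -/(dvdn l (qint q (r %% e))).
case: (r %% e) lt_e => [|[|s]] lts; first by rewrite qint0 dvdn0.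
  by rewrite /qint big_ord1 dvdn1; case: eqP l_prime => // ->.
by apply/negP => h; have := @e_min s.+2 isT h; lia.
Qed.

Lemma logn_qint r : 0 < r ->
  logn l (qint q r) = if e %| r then d + logn l (r %/ e) else 0.
Proof.
move=> r0; case: ifP => [/dvdnP[k kE]|ndv].
  have e0 : 0 < e by lia.
  have k0 : 0 < k by case: k kE r0 => //; lia.
  rewrite kE mulnK // mulnC qintM lognM ?qint_gt0 //.
  by rewrite (logn_qint_lte l_prime _ lte_base_exp).
by apply: logn_coprime; rewrite // prime_coprime // dvd_qint // ndv.
Qed.

(** Only the factors at multiples of e count, and the one at e k contributes d
    plus the valuation of k. *)
Lemma logn_qfact r :
  logn l (qfact q r) = d * (r %/ e) + logn l (r %/ e)`!.
Proof.
have e0 : 0 < e by lia.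
elim: r => [|r IH]; first by rewrite /qfact big_ord0 div0n muln0 fact0 !logn1.
rewrite qfactS lognM ?qfact_gt0 ?qint_gt0 // IH (@logn_qint r.+1) // divnS //.
case: (e %| r.+1); last by rewrite add0n addn0.
by rewrite add1n factS lognM ?fact_gt0 //; lia.
Qed.

End Valuation.

(** * Splitting factorials *)

Section FactorialSplit.
Variable l : nat.
Hypothesis l_prime : prime l.

Lemma logn_subr a j k : l ^ j %| a -> 0 < k < l ^ j -> k < a ->
  logn l (a - k) = logn l k.
Proof.
move=> /dvdnP[a' aE] /andP[k0 klt] ka.
have [c lc kE] := pfactor_coprime l_prime k0; set t := logn l k in kE *.
have c0 : 0 < c by case: c kE {lc} => //; lia.
have tj : t < j.
  rewrite -(ltn_exp2l _ _ (prime_gt1 l_prime)); apply: leq_ltn_trans klt.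
  by rewrite kE leq_pmull.
have aE' : a = (a' * l ^ (j - t)) * l ^ t by rewrite -mulnA -expnD subnK // ltnW.
rewrite {1}kE aE' -mulnBl lognM ?expn_gt0 ?(prime_gt0 l_prime) //; last first.
  by rewrite subn_gt0 -(ltn_pmul2r (m := l ^ t)) ?expn_gt0 ?(prime_gt0 l_prime) // -kE -aE'.
rewrite pfactorK // logn_coprime // prime_coprime //.
have ll : l %| a' * l ^ (j - t) by rewrite dvdn_mull // dvdn_exp // subn_gt0.
have cle : c <= a' * l ^ (j - t).
  rewrite ltnW // -(ltn_pmul2r (m := l ^ t)) ?expn_gt0 ?(prime_gt0 l_prime) //.
  by rewrite -kE -aE'.
by rewrite (dvdn_subr cle ll) -prime_coprime.
Qed.

(** The quotient of consecutive binomial coefficients is (a - k.+1) / k.+1,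
    whose numerator and denominator have the same valuation for k.+1 < l ^ j. *)
Lemma bin_pred_ndvd a j k : l ^ j %| a -> 0 < a -> k < l ^ j ->
  ~~ (l %| 'C(a.-1, k)).
Proof.
move=> la a0; elim: k => [|k IH] klt.
  by rewrite bin0 dvdn1; case: eqP l_prime => // ->.
have lja : l ^ j <= a by apply: dvdn_leq.
have C0 i : i < l ^ j -> 0 < 'C(a.-1, i) by move=> ilt; rewrite bin_gt0; lia.
have /(congr1 (logn l)) := mul_bin_left a.-1 k.
have -> : a.-1 - k = a - k.+1 by lia.
have IHk := IH (ltnW klt).
case: (eqVneq k.+1 a) => [kE|ka]; first by rewrite -kE in lja *; lia.
rewrite !lognM ?C0 ?subn_gt0 //; try lia.
rewrite (@logn_subr a j) //; last by lia.
rewrite (@logn_coprime l 'C(a.-1, k)) ?prime_coprime // addn0.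
move=> /eqP; rewrite -{2}[logn l k.+1]addn0 eqn_add2l => /eqP log0.
apply/negP => dv; have : 0 < logn l 'C(a.-1, k.+1).
  by rewrite logn_gt0 mem_primes l_prime dv C0.
by rewrite log0.
Qed.

Lemma logn_bin_exp a j : 0 < a -> l ^ j %| a ->
  logn l 'C(a, l ^ j) = logn l a - j.
Proof.
move=> a0 la; have lj0 : 0 < l ^ j by rewrite expn_gt0 prime_gt0.
have lja : l ^ j <= a by apply: dvdn_leq.
have /(congr1 (logn l)) := mul_bin_diag a (l ^ j).-1.
rewrite (ltn_predK lj0) !lognM ?bin_gt0 //; last by lia.
rewrite pfactorK // (@logn_coprime l 'C(a.-1, _)); last first.
  by rewrite prime_coprime // (@bin_pred_ndvd a j) //; lia.
by move=> h; lia.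
Qed.

(** One part is the exact power of l dividing a or, if a is itself a power of
    l, the l-th part of a. In the first case the binomial coefficient is prime
    to l, in the second it has valuation 1. *)
Lemma fact_split a : 1 < a -> exists2 b, 0 < b < a &
  logn l b`! + logn l (a - b)`! <= logn l a`! <=
  (logn l b`! + logn l (a - b)`!).+1.
Proof.
move=> a1; have a0 : 0 < a by lia.
have splitE b : b <= a ->
    logn l a`! = logn l 'C(a, b) + (logn l b`! + logn l (a - b)`!).
  move=> ba; rewrite -(bin_fact ba) !lognM ?muln_gt0 ?fact_gt0 ?bin_gt0 //.
pose v := logn l a; have lva : l ^ v %| a by rewrite pfactor_dvdnn.
case: (eqVneq a (l ^ v)) => [aE|aneq].
  have v0 : 0 < v by rewrite lt0n; apply: contraTneq a1 => v0; rewrite aE v0.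
  have lva' : l ^ v.-1 %| a by rewrite (dvdn_trans _ lva) // dvdn_exp2l // leq_pred.
  have ba : l ^ v.-1 < a by rewrite [X in _ < X]aE ltn_exp2l ?prime_gt1 //; lia.
  exists (l ^ v.-1); first by rewrite ba expn_gt0 prime_gt0.
  by rewrite (splitE _ (ltnW ba)) logn_bin_exp // -/v; lia.
have ba : l ^ v < a by have := dvdn_leq a0 lva; lia.
exists (l ^ v); first by rewrite ba expn_gt0 prime_gt0.
by rewrite (splitE _ (ltnW ba)) logn_bin_exp // -/v; lia.
Qed.

End FactorialSplit.

(** * Refining compositions *)

(** By [logn_qfact], the valuation of the product of the q-factorials of the
    block sizes, that is, of the index of B in the parabolic subgroup with
    these blocks. *)
Definition blocks_val (d l e : nat) (b : seq nat) : nat :=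
  \sum_(x <- b) (d * (x %/ e) + logn l (x %/ e)`!).

(** The largest number of blocks of size e into which the given blocks can be
    cut. *)
Definition blocks_e (e : nat) (b : seq nat) : nat := \sum_(x <- b) x %/ e.

(** The block sizes of the parabolic subgroup [[a, 0, ..., 0]]. *)
Definition e_blocks (n e a : nat) : seq nat := nseq (n - e * a) 1 ++ nseq a e.

Definition composition (n : nat) (b : seq nat) := all (ltn 0) b && (sumn b == n).

Lemma perm_composition n b c : perm_eq b c -> composition n b = composition n c.
Proof.
by move=> bc; rewrite /composition (perm_all _ bc) (perm_sumn bc).
Qed.

Section Chain.
Variables (e n : nat) (reach : seq nat -> seq nat -> Prop).
Hypothesis e_gt1 : 1 < e.
Local Notation wt := (blocks_e e).
Local Notation good := (composition n).

Lemma blocks_canon b : good b -> all (fun x => (x == 1) || (x == e)) b ->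
  perm_eq b (e_blocks n e (wt b)).
Proof.
move=> gb /allP b1e; have e0 : 0 < e by lia.
have bE : perm_eq b (nseq (count_mem 1 b) 1 ++ nseq (count_mem e b) e).
  apply/allP => x _ /=; rewrite count_cat !count_nseq /=.
  case: (eqVneq 1 x) => [<-|x1]; first by rewrite (gtn_eqF e_gt1) mul1n mul0n addn0.
  case: (eqVneq e x) => [<-|xe]; first by rewrite mul0n mul1n.
  rewrite !mul0n addn0; apply/eqP/count_memPn/negP => /b1e /orP[]/eqP xE.
    by rewrite xE eqxx in x1.
  by rewrite xE eqxx in xe.
have wE : wt b = count_mem e b.
  rewrite /blocks_e (perm_big _ bE) big_cat /= !big_nseq divn_small // divnn e0.
  by rewrite !iter_addn_0 mul0n mul1n.
have nE : n = count_mem 1 b + e * wt b.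
  have /andP[_ /eqP {1}<-] := gb.
  by rewrite (perm_sumn bE) sumn_cat !sumn_nseq wE; lia.
by rewrite /e_blocks nE addnK wE.
Qed.

Lemma blocks_val_canon d l a : blocks_val d l e (e_blocks n e a) = d * a.
Proof.
rewrite /blocks_val /e_blocks big_cat /= !big_nseq divnn divn_small //.
have -> : 0 < e by lia.
by rewrite fact0 !muln1 logn1 !muln0 !addn0 !iter_addn_0 mul0n.
Qed.

Lemma composition_canon a : e * a <= n -> good (e_blocks n e a).
Proof.
move=> ean; rewrite /composition /e_blocks all_cat !all_nseq /= orbT /=.
rewrite sumn_cat !sumn_nseq; apply/andP; split; first by case: (a) => //=; lia.
by apply/eqP; lia.
Qed.

Hypothesis reach_trans : forall b c b',
  reach b c -> reach c b' -> reach b b'.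
Hypothesis reach_perm : forall b b', good b ->
  perm_eq b b' -> reach b b'.
Hypothesis reach_split : forall x y b, good (x + y :: b) ->
  0 < x -> 0 < y -> reach (x + y :: b) (y :: x :: b).

Lemma reach_refl b : good b -> reach b b.
Proof. by move=> gb; apply: reach_perm. Qed.

Lemma reach_ones x c : 0 < x -> good (x :: c) -> reach (x :: c) (nseq x 1 ++ c).
Proof.
elim: x c => // x IH c _ gxc; case: x IH gxc => [|x] IH gxc; first exact: reach_refl.
have gc : good (x.+1 :: 1 :: c).
  by move: gxc; rewrite /composition /= addnCA !addnA add1n.
have := @reach_split 1 x.+1 c; rewrite add1n => /(_ gxc isT isT) h.
apply: reach_trans h _; apply: reach_trans (IH (1 :: c) isT gc) _.
apply: reach_perm; last first.
  by apply/seq.permP => p; rewrite /= !count_cat /= ?count_nseq; nia.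
move: gc; rewrite /composition all_cat /= all_nseq orbT /= sumn_cat sumn_nseq /=.
by rewrite mul1n.
Qed.

Lemma reach_canon_pred a : e * a.+1 <= n ->
  reach (e_blocks n e a.+1) (e_blocks n e a).
Proof.
move=> ean; have gA := composition_canon ean.
have gA' : good (e_blocks n e a) by apply: composition_canon; lia.
have p1 : perm_eq (e_blocks n e a.+1) (e :: (nseq (n - e * a.+1) 1 ++ nseq a e)).
  by apply/seq.permP => p; rewrite /= !count_cat /= ?count_nseq; nia.
apply: reach_trans (reach_perm gA p1) _.
have e0 : 0 < e by lia.
have g1 : good (e :: (nseq (n - e * a.+1) 1 ++ nseq a e)).
  by rewrite -(perm_composition n p1).
apply: reach_trans (reach_ones e0 g1) _.
have eqE : nseq e 1 ++ nseq (n - e * a.+1) 1 ++ nseq a e = e_blocks n e a.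
  by rewrite catA -nseqD /e_blocks; congr (nseq _ _ ++ _); lia.
by rewrite eqE; apply: reach_refl.
Qed.

Variables d l : nat.
Hypothesis l_prime : prime l.
Local Notation phi := (blocks_val d l e).

(** If e divides x then x / e is split as in [fact_split]; otherwise a block
    of size 1 can be cut off without changing the quotient by e. *)
Lemma refine_step b (x : nat) : good b -> x \in b -> x != 1 -> x != e ->
  exists b', [/\ reach b b', good b', size b' = (size b).+1,
    wt b' = wt b & phi b' <= phi b <= (phi b').+1].
Proof.
move=> gb xb x1 xe; have pb := perm_to_rem xb.
have gx : good (x :: rem x b) by rewrite -(perm_composition n pb).
have x0 : 0 < x by case/andP: gx => /andP[].
have split y z : x = y + z -> 0 < y -> 0 < z -> y %/ e + z %/ e = x %/ e ->
    logn l (y %/ e)`! + logn l (z %/ e)`! <= logn l (x %/ e)`! <=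
      (logn l (y %/ e)`! + logn l (z %/ e)`!).+1 ->
    exists b', [/\ reach b b', good b', size b' = (size b).+1,
      wt b' = wt b & phi b' <= phi b <= (phi b').+1].
  move=> xE y0 z0 aE lE; exists (z :: y :: rem x b); split.
  - by apply: reach_trans (reach_perm gb pb) _; rewrite {1}xE; apply: reach_split; rewrite -?xE.
  - move: gx; rewrite /composition /= y0 z0 xE => /andP[/andP[_ ->] /eqP <-].
    by rewrite addnCA addnA eqxx.
  - by rewrite (perm_size pb).
  - by rewrite /blocks_e (perm_big _ pb) !big_cons /=; lia.
  - by rewrite /blocks_val (perm_big _ pb) !big_cons /=; nia.
have e0 : 0 < e by lia.
case: (posnP (x %% e)) => [xe0|xe0].
  have xE : x = x %/ e * e by rewrite {1}(divn_eq x e) xe0 addn0.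
  have a1 : 1 < x %/ e by case: (x %/ e) xE => [|[|//]]; lia.
  have [a /andP[a0 alt] aP] := fact_split l_prime a1.
  apply: (split (a * e) ((x %/ e - a) * e)); rewrite ?mulnK //.
  - by rewrite -mulnDl subnKC // ltnW.
  - by rewrite muln_gt0 a0.
  - by rewrite muln_gt0 subn_gt0 alt.
  - by rewrite subnKC // ltnW.
have dE : (x - 1) %/ e = x %/ e.
  have -> : x - 1 = x %/ e * e + (x %% e - 1).
    by rewrite {1}(divn_eq x e) addnBA.
  have lt_e := leq_ltn_trans (leq_subr 1 _) (ltn_pmod x e0).
  by rewrite divnMDl // (divn_small lt_e) addn0.
apply: (split 1 (x - 1)); rewrite ?dE ?(divn_small e_gt1) ?fact0 ?logn1 ?add0n ?leqnn ?leqnSn //.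
all: lia.
Qed.

(** The refinements of [refine_step] end at blocks 1 and e only. Each of them
    lowers phi by at most one, so that no value is skipped on the way down. *)
Lemma canon_chain b : good b -> reach b (e_blocks n e (wt b)) /\
  (forall v, d * wt b <= v <= phi b ->
    exists b', [/\ good b', reach b b' & phi b' = v]).
Proof.
have [k] := ubnP (n - size b); elim: k b => // k IH b; rewrite ltnS => kb gb.
have size_le c : good c -> size c <= n.
  case/andP => /allP c0 /eqP <-; rewrite sumnE -sum1_size.
  by rewrite big_seq [X in _ <= X]big_seq; apply: leq_sum => x /c0.
case: (boolP (all (fun x => (x == 1) || (x == e)) b)) => [b1e|].
  have pb := blocks_canon gb b1e; split; first exact: reach_perm.
  have pE : phi b = d * wt b by rewrite /blocks_val (perm_big _ pb); apply: blocks_val_canon.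
  by move=> v; rewrite pE => vE; exists b; split=> //; [exact: reach_refl|lia].
case/allPn => x xb /norP[x1 xe].
have [c [bc gc sc wc pc]] := refine_step gb xb x1 xe.
have scn := size_le _ gc.
have [|rc vc] := IH c _ gc; first by lia.
split; first by apply: reach_trans bc _; rewrite -wc.
move=> v /andP[v1 v2]; case: (leqP v (phi c)) => vp.
  have [|b' [gb' cb' <-]] := vc v; first by rewrite wc; apply/andP.
  by exists b'; split=> //; apply: reach_trans bc cb'.
by exists b; split=> //; [exact: reach_refl|lia].
Qed.

End Chain.

(** * Block boundaries *)

(** The set of partial sums of [b]: the places where a block ends, and 0. *)
Fixpoint bdry (b : seq nat) (k : nat) : bool :=
  if b is x :: b' then (k == 0) || (x <= k) && bdry b' (k - x) else k == 0.

Lemma bdry0 b : bdry b 0.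
Proof. by case: b. Qed.

Lemma bdry_cat b c k : bdry (b ++ c) (sumn b + k) = bdry c k.
Proof.
elim: b => [|x b IH] //=; rewrite -addnA leq_addr addKn IH.
case: (posnP k) => [->|k0]; first by rewrite bdry0 orbT.
by rewrite -leqn0 leqNgt !addn_gt0 k0 !orbT.
Qed.

Lemma bdry_sum b : bdry b (sumn b).
Proof. by have := bdry_cat b [::] 0; rewrite cats0 addn0. Qed.

Lemma bdry_catl b c k : k <= sumn b -> bdry (b ++ c) k = bdry b k.
Proof.
elim: b k => [|x b IH] k /= kb.
  by move: kb; rewrite leqn0 => /eqP ->; rewrite bdry0.
by case: (leqP x k) => //= xk; rewrite IH //; lia.
Qed.

Lemma bdry_rcons b x k : k < sumn b + x -> bdry (rcons b x) k = bdry b k && (k <= sumn b).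
Proof.
rewrite -cats1 => kx; case: (leqP k (sumn b)) => kb.
  by rewrite bdry_catl // andbT.
have {1}-> : k = sumn b + (k - sumn b) by lia.
by rewrite bdry_cat andbF /=; apply/negbTE; lia.
Qed.

Lemma composition_of_bdry (D : pred nat) n : exists2 b, composition n b &
  forall k, 0 < k < n -> bdry b k = D k.
Proof.
rewrite /composition; elim: n D => [|n IH] D.
  by exists [::] => // k; lia.
have [b /andP[b0 /eqP bn] bD] := IH (fun k => D k.+1).
case: b => [|x b] /= in b0 bn bD.
  by exists [:: 1]; rewrite -?bn // => k; lia.
case/andP: b0 => x0 b0; case D1: (D 1).
  exists [:: 1, x & b]; first by rewrite /= x0 b0 add1n bn eqxx.
  by move=> [|[|k]] // kn; rewrite ?D1 // -(bD k.+1).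
exists (x.+1 :: b); first by rewrite /= b0 addSn bn eqxx.
move=> [|[|k]] // kn; last by rewrite -(bD k.+1) //= ltnS subSS.
by rewrite D1 /= ltnS; case: x x0 {bn bD}.
Qed.

(** * Permutations counted by inversions *)

Definition inv_count n (s : 'S_n) : nat :=
  \sum_(i < n) \sum_(j < n) ((i < j) && (s j < s i)).
Definition ninv_count n (s : 'S_n) : nat :=
  \sum_(i < n) \sum_(j < n) ((i < j) && (s i < s j)).

(** Decreasing inside every block, where [D] is the set of block boundaries. *)
Definition dec_in (D : pred nat) n (s : 'S_n) : bool :=
  [forall i : 'I_n, forall j : 'I_n, (j == i.+1 :> nat) ==> ~~ D j ==> (s j < s i)].

(** Mapping every block to itself, that is, lying in the Young subgroup with
    block boundaries [D]. *)
Definition pres_in (D : pred nat) n (s : 'S_n) : bool :=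
  [forall i : 'I_n, forall k : 'I_n, D k ==> ((s i < k) == (i < k))].

Lemma dec_inP (D : pred nat) n (s : 'S_n) :
  reflect (forall i j : 'I_n, j = i.+1 :> nat -> ~~ D j -> s j < s i) (dec_in D s).
Proof.
apply: (iffP forallP) => [h i j ji Dj|h i].
  by have /forallP/(_ j) := h i; rewrite ji eqxx /= -ji Dj.
by apply/forallP => j; apply/implyP => /eqP ji; apply/implyP => /(h _ _ ji).
Qed.

Lemma pres_inP (D : pred nat) n (s : 'S_n) :
  reflect (forall i k : 'I_n, D k -> (s i < k) = (i < k)) (pres_in D s).
Proof.
apply: (iffP forallP) => [h i k Dk|h i].
  by have /forallP/(_ k) := h i; rewrite Dk /= => /eqP.
by apply/forallP => k; apply/implyP => Dk; rewrite h.
Qed.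

Lemma sum_perm_lift n (f : 'S_n.+1 -> nat) :
  \sum_(s : 'S_n.+1) f s =
  \sum_(p : 'I_n.+1) \sum_(t : 'S_n) f (lift_perm p ord_max t).
Proof.
rewrite pair_bigA /=.
pose h (u : 'I_n.+1 * 'S_n) := lift_perm u.1 ord_max u.2.
have h_inj : injective h.
  move=> [p t] [p' t'] /= E; rewrite /h /= in E.
  have pE : p = p'.
    by apply: (@perm_inj _ (lift_perm p ord_max t)); rewrite {2}E !lift_perm_id.
  rewrite pE in E *; congr (_, _); apply/permP => k.
  have := congr1 (fun s : 'S_n.+1 => s (lift p' k)) E.
  by rewrite !lift_perm_lift => /lift_inj.
rewrite (reindex h) //; apply: onW_bij; apply: inj_card_bij h_inj _.
by rewrite card_prod card_ord !card_Sn factS.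
Qed.

Lemma ltn_lift n (p : 'I_n.+1) (i j : 'I_n) : (lift p i < lift p j) = (i < j).
Proof. by rewrite /= !ltnNge leq_bump2. Qed.

Lemma lift_max_lt n (i : 'I_n) : lift ord_max i < @ord_max n.
Proof. by rewrite lift_max ltn_ord. Qed.

Lemma sum_ltn_ord n k : k <= n -> \sum_(i < n) (i < k) = k.
Proof.
move=> kn; rewrite -{2}[k]card_ord -sum1_card (big_ord_widen _ (fun=> 1) kn).
by rewrite [RHS]big_mkcond.
Qed.

Lemma sum_ord_lift n (p : 'I_n.+1) (f : 'I_n.+1 -> nat) :
  \sum_(i < n.+1) f i = f p + \sum_(i < n) f (lift p i).
Proof. exact: bigD1_ord. Qed.

Lemma ninv_lift n (p : 'I_n.+1) (t : 'S_n) :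
  ninv_count (lift_perm p ord_max t) = p + ninv_count t.
Proof.
rewrite /ninv_count (sum_ord_lift p) big1 ?add0n => [|j _]; last first.
  by rewrite lift_perm_id [X in _ && X]ltnNge leq_ord andbF.
rewrite (eq_bigr (fun i : 'I_n => (i < p) + \sum_(j < n) ((i < j) && (t i < t j)))).
  by rewrite big_split /= sum_ltn_ord // -ltnS.
move=> i _; rewrite (sum_ord_lift p); congr (_ + _).
  rewrite lift_perm_id lift_perm_lift [X in _ && X]lift_max_lt andbT /= /bump.
  by congr nat_of_bool; case: leqP => /=; lia.
by apply: eq_bigr => j _; rewrite !lift_perm_lift !ltn_lift.
Qed.

Lemma inv_lift n (p : 'I_n.+1) (t : 'S_n) :
  inv_count (lift_perm p ord_max t) = (n - p) + inv_count t.
Proof.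
rewrite /inv_count (sum_ord_lift p) (sum_ord_lift p) [X in X + _ + _](_ : _ = 0) ?ltnn // add0n.
congr (_ + _).
  rewrite -[in RHS](@sum_ltn_ord n (n - p)) ?leq_subr //.
  rewrite (reindex_inj rev_ord_inj); apply: eq_bigr => j _.
  rewrite lift_perm_id lift_perm_lift [X in _ && X]lift_max_lt andbT /= /bump.
  by congr nat_of_bool; have := ltn_ord j; case: leqP => /=; lia.
apply: eq_bigr => i _; rewrite (sum_ord_lift p).
rewrite lift_perm_id lift_perm_lift [X in _ && X]ltnNge (ltnW (lift_max_lt _)) andbF add0n.
by apply: eq_bigr => j _; rewrite !lift_perm_lift !ltn_lift.
Qed.

(** Inside a block the values decrease, so the largest value of the
    permutation stands at the start of a block. *)
Lemma dec_lift (D : pred nat) n (p : 'I_n.+1) (t : 'S_n) : D 0 ->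
  dec_in D (lift_perm p ord_max t) =
  D p && dec_in (fun k => if k <= p then D k else D k.+1) t.
Proof.
move=> D0; apply/dec_inP/andP => [h|[Dp /dec_inP h] i j ji Dj].
  have Dp : D p.
    apply: contraT => nDp; case: (posnP p) => [p0|p0]; first by rewrite p0 D0 in nDp.
    have pn : p.-1 < n.+1 by have := ltn_ord p; lia.
    have := h (Ordinal pn) p _ nDp; rewrite lift_perm_id /= prednK // => /(_ erefl).
    by rewrite ltnNge (leq_ord (lift_perm p _ t _)).
  split=> //; apply/dec_inP => i j ji Dj.
  have := h (lift p i) (lift p j); rewrite !lift_perm_lift !lift_max; apply.
    rewrite /= /bump ji; case: (ltngtP i.+1 p) => //= ip; try lia.
    by move: Dj; rewrite ji ip leqnn Dp.
  move: Dj; rewrite /= /bump; case: (ltngtP j p) => //= jp.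
  by rewrite jp Dp.
case: (unliftP p j) => [j' jE|jE]; last by rewrite jE Dp in Dj.
case: (unliftP p i) => [i' iE|iE]; last first.
  by rewrite jE iE lift_perm_lift lift_perm_id lift_max ltn_ord.
rewrite jE iE !lift_perm_lift !lift_max; move: ji Dj; rewrite jE iE /= /bump => ji Dj.
apply: h; first by move: ji Dp; do 2 case: leqP => /=; lia.
move: Dj; case: (leqP p j') => /= [pj|pj]; case: leqP => // jp; try lia.
Qed.

(** The block sizes after the place [p] has been deleted. *)
Fixpoint decr (b : seq nat) (p : nat) : seq nat :=
  if b is x :: b' then if p < x then x.-1 :: b' else x :: decr b' (p - x)
  else [::].

Fixpoint block_size (b : seq nat) (p : nat) : nat :=
  if b is x :: b' then if p < x then x else block_size b' (p - x) else 0.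

Lemma bdry_decr b p k : p < sumn b -> bdry b p ->
  bdry (decr b p) k = if k <= p then bdry b k else bdry b k.+1.
Proof.
elim: b p k => [|x b IH] p k //= pb.
case: (ltnP p x) => px.
  rewrite orbF => /eqP -> /=; case: k => [|k] //=.
  by case: x px {pb} => //= x _; rewrite ltnS subSS.
case/orP=> [/eqP p0|/= bp].
  have x0 : x = 0 by lia.
  by rewrite x0 p0 /= !subn0 IH ?bdry0 //; [case: k|lia].
rewrite /= IH //; last by lia.
case: k => [|k] //=; case: (leqP x k.+1) => xk /=; last first.
  by case: (leqP k.+1 p) => kp //; lia.
rewrite leq_sub2rE // (leqW xk) /=; case: ifP => // _.
by rewrite (subSn xk).
Qed.

Lemma sumn_decr b p : p < sumn b -> sumn (decr b p) = (sumn b).-1.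
Proof.
elim: b p => [|x b IH] p //= pb; case: (ltnP p x) => px /=; first by lia.
by rewrite IH; lia.
Qed.

Lemma qfact_decr q b p : p < sumn b -> bdry b p ->
  (\prod_(x <- decr b p) qfact q x) * qint q (block_size b p) =
  \prod_(x <- b) qfact q x.
Proof.
elim: b p => [|x b IH] p //= pb.
case: (ltnP p x) => px.
  move=> _; case: x px {pb} => // x _; rewrite !big_cons /= qfactS; lia.
move=> bp; rewrite !big_cons -mulnA IH //; first by lia.
by case/orP: bp => [/eqP ->|/andP[]//]; rewrite bdry0.
Qed.

Lemma sum_block_size q b :
  \sum_(p < sumn b | bdry b p) q ^ p * qint q (block_size b p) = qint q (sumn b).
Proof.
elim: b => [|x b IH]; first by rewrite big_ord0 qint0.
rewrite big_mkcond big_split_ord /= qintD; congr (_ + _).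
  case: x => [|x]; first by rewrite big_ord0 qint0.
  rewrite big_ord_recl /= expn0 mul1n big1 ?addn0 // => i _.
  by rewrite ltnNge ltn_ord.
rewrite -IH [RHS]big_distrr [RHS]big_mkcond /=; apply: eq_bigr => p _.
rewrite leq_addr addKn /= ltnNge leq_addr /= expnD -mulnA.
case: (posnP (x + p)) => // xp; have -> : nat_of_ord p = 0 by lia.
by rewrite bdry0.
Qed.

Definition dec_sum (q : nat) (D : pred nat) (n : nat) : nat :=
  \sum_(s : 'S_n | dec_in D s) q ^ ninv_count s.

Lemma eq_dec_in (D D' : pred nat) n : {in gtn n, D =1 D'} ->
  @dec_in D n =1 @dec_in D' n.
Proof.
move=> DD s; apply/dec_inP/dec_inP => h i j ji Dj; apply: h => //.
  by rewrite DD // inE ltn_ord.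
by rewrite -DD // inE ltn_ord.
Qed.

(** Induction on the size. The largest value stands at the start p of a block;
    deleting it leaves the same sum with that block shortened and a factor q ^
    p, and these contributions add up by [sum_block_size]. *)
Lemma dec_sum_block q b :
  dec_sum q (bdry b) (sumn b) * (\prod_(x <- b) qfact q x) = qfact q (sumn b).
Proof.
move nE : (sumn b) => n; elim: n b nE => [|n IH] b bn.
  have -> : dec_sum q (bdry b) 0 = 1.
    rewrite /dec_sum (eq_bigl xpredT) => [|s]; last first.
      by apply: (introT (dec_inP _ _)) => i; have := ltn_ord i; rewrite ltn0.
    rewrite (eq_bigr (fun=> 1)) => [|s _]; last by rewrite /ninv_count big_ord0.
    by rewrite sum1_card card_Sn.
  rewrite mul1n /qfact big_ord0 big_seq big1 // => x xb.
  suff -> : x = 0 by rewrite big_ord0.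
  by have := perm_sumn (perm_to_rem xb); rewrite /= bn; lia.
rewrite /dec_sum big_mkcond sum_perm_lift /= big_distrl /=.
have qE : qint q n.+1 =
    \sum_(p < n.+1 | bdry b p) q ^ p * qint q (block_size b p).
  by rewrite -bn sum_block_size.
rewrite qfactS qE [RHS]big_distrr [RHS]big_mkcond /=.
apply: eq_bigr => p _; have pb : p < sumn b by rewrite bn.
rewrite (eq_bigr (fun t : 'S_n => if bdry b p then
    q ^ p * (if dec_in (bdry (decr b p)) t then q ^ ninv_count t else 0) else 0)).
  case: ifP => [bp|_]; last by rewrite big1.
  rewrite -big_distrr -big_mkcond /=.
  have dn : sumn (decr b p) = n by rewrite sumn_decr // bn.
  by rewrite -(IH _ dn) -(qfact_decr q pb bp) /dec_sum; ring.
move=> t _; rewrite (dec_lift _ _ (bdry0 b)); case bp: (bdry b p) => //=.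
rewrite (@eq_dec_in _ (bdry (decr b p))) => [|k _]; last by rewrite /= bdry_decr.
by case: ifP => _; rewrite ?muln0 // ninv_lift expnD.
Qed.

Definition pres_sum (q : nat) (D : pred nat) (n : nat) : nat :=
  \sum_(s : 'S_n | pres_in D s) q ^ inv_count s.

Lemma eq_pres_in (D D' : pred nat) n : {in gtn n, D =1 D'} ->
  @pres_in D n =1 @pres_in D' n.
Proof.
move=> DD s; apply/pres_inP/pres_inP => h i j Dj; apply: h.
  by rewrite DD // inE ltn_ord.
by rewrite -DD // inE ltn_ord.
Qed.

Lemma pres_lift b x (p : 'I_(sumn b + x).+1) (t : 'S_(sumn b + x)) :
  pres_in (bdry (rcons b x.+1)) (lift_perm p ord_max t) =
  (sumn b <= p) && pres_in (bdry (rcons b x)) t.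
Proof.
have bB (k : nat) : k < (sumn b + x).+1 ->
    bdry (rcons b x.+1) k = bdry b k && (k <= sumn b).
  by move=> kn; rewrite bdry_rcons // addnS.
have lift_lt i k : k <= sumn b -> sumn b <= p -> (lift p i < k) = (i < k).
  by move=> kb bp; rewrite /= /bump; case: leqP => /=; lia.
apply/pres_inP/andP => [h|[bp /pres_inP h] i k].
  have bp : sumn b <= p.
    have bn : sumn b < (sumn b + x).+1 by rewrite ltnS leq_addr.
    have := h p (Ordinal bn); rewrite bB //= bdry_sum leqnn lift_perm_id /=.
    move=> /(_ isT); rewrite [X in X = _]ltnNge leq_addr /= => /esym/negbT.
    by rewrite -leqNgt.
  split=> //; apply/pres_inP => i k; rewrite bdry_rcons ?ltn_ord // => bk.
  have := h (lift p i) (widen_ord (leqnSn _) k); rewrite /= bB ?ltnS ?(ltnW (ltn_ord k)) //.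
  move=> /(_ bk); rewrite lift_perm_lift lift_max.
  by rewrite [lift p i < _]lift_lt //; case/andP: bk.
rewrite bB ?ltn_ord // => /andP[bk kb].
case: (unliftP p i) => [i' ->|->].
  rewrite lift_perm_lift lift_max lift_lt //.
  case: (leqP (sumn b + x) k) => kn.
    by rewrite !(leq_trans (ltn_ord _) kn).
  have := h i' (Ordinal kn); apply; rewrite /= bdry_rcons // bk //.
by rewrite lift_perm_id /= !ltnNge (leq_trans kb bp) (leq_trans kb (leq_addr _ _)).
Qed.

(** Induction on the size of the last block, which contains the place of the
    largest value; the possible places contribute the powers q ^ i for i up to
    that size. *)
Lemma pres_sum_block q b :
  pres_sum q (bdry b) (sumn b) = \prod_(x <- b) qfact q x.
Proof.
elim/last_ind: b => [|b x IH].
  rewrite big_nil /pres_sum (eq_bigl xpredT) => [|s]; last first.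
    by apply: (introT (pres_inP _ _)) => i; have := ltn_ord i; rewrite ltn0.
  rewrite (eq_bigr (fun=> 1)) => [|s _]; last by rewrite /inv_count big_ord0.
  by rewrite sum1_card card_Sn.
rewrite -cats1 big_cat big_seq1 cats1 -IH /=.
rewrite sumn_rcons; elim: x => [|x IHx].
  rewrite addn0 /qfact big_ord0 muln1 /pres_sum.
  apply: eq_bigl => s; apply: eq_pres_in => k; rewrite inE => kb.
  by rewrite bdry_rcons ?addn0 // (ltnW kb) andbT.
rewrite qfactS mulnA -IHx addnS /pres_sum big_mkcond sum_perm_lift /=.
rewrite (eq_bigr (fun p : 'I_(sumn b + x).+1 => if sumn b <= p then
   q ^ (sumn b + x - p) * pres_sum q (bdry (rcons b x)) (sumn b + x) else 0)).
  rewrite -big_mkcond -big_distrl mulnC /=; congr (_ * _).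
  rewrite (reindex_inj rev_ord_inj) /= /qint.
  rewrite (big_ord_widen (sumn b + x).+1 (fun i => q ^ i)) ?ltnS ?leq_addl //.
  apply: eq_big => [i|i _]; last by congr (q ^ _); have := ltn_ord i; lia.
  by have := ltn_ord i; lia.
move=> p _; rewrite (eq_bigr (fun t : 'S_(sumn b + x) => if sumn b <= p then
    q ^ (sumn b + x - p) *
    (if pres_in (bdry (rcons b x)) t then q ^ inv_count t else 0) else 0)).
  by case: ifP => _; [rewrite -big_distrr -big_mkcond|rewrite big1].
move=> t _; rewrite pres_lift; case: (sumn b <= p) => //=.
by case: ifP => _; rewrite ?muln0 // inv_lift expnD.
Qed.

Lemma inv_sum q n : \sum_(s : 'S_n) q ^ inv_count s = qfact q n.
Proof.
have := pres_sum_block q [:: n]; rewrite /= addn0 big_seq1 => <-.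
apply: eq_bigl => s; apply/esym; apply: (introT (pres_inP _ _)) => i k /=.
by rewrite leqNgt ltn_ord /= orbF => /eqP ->.
Qed.

(** * Exchanging two adjacent blocks *)

Section BlockSwap.
Variables (b1 b2 : seq nat) (x y : nat).
Hypotheses (x_gt0 : 0 < x) (y_gt0 : 0 < y).
Local Notation s0 := (sumn b1).

(** The boundaries of [b1], two blocks of total size x + y, and [b2], where
    [E] prescribes the boundaries strictly inside the middle part. *)
Definition mid_bdry (E : pred nat) k :=
  if k <= s0 then bdry b1 k else
  if k < s0 + (x + y) then E k else bdry b2 (k - (s0 + (x + y))).

(** From places in the new order of the two blocks to places in the old one. *)
Definition block_swap k :=
  if k < s0 then k else if k < s0 + y then k + x
  else if k < s0 + y + x then k - y else k.

Lemma bdry_pair a c k : a + c = x + y -> 0 < a -> 0 < c ->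
  bdry (b1 ++ a :: c :: b2) k = mid_bdry (pred1 (s0 + a)) k.
Proof.
move=> E a0 c0; rewrite /mid_bdry -E; case: (leqP k s0) => k0; first exact: bdry_catl.
have {1}-> : k = s0 + (k - s0) by lia.
rewrite bdry_cat /=; case: (ltnP k (s0 + (a + c))) => k1 /=; last first.
  have -> : (k - (s0 + (a + c))) = k - s0 - a - c by lia.
  case: (leqP a (k - s0)) => h1; case: (leqP c (k - s0 - a)) => h2 /=; lia.
case: (leqP c (k - s0 - a)) => h2 /=; last by lia.
by lia.
Qed.

Lemma bdry_merged k : bdry (b1 ++ x + y :: b2) k = mid_bdry pred0 k.
Proof.
rewrite /mid_bdry; case: (leqP k s0) => k0; first exact: bdry_catl.
have {1}-> : k = s0 + (k - s0) by lia.
rewrite bdry_cat /=; case: (ltnP k (s0 + (x + y))) => k1 /=.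
  by case: (leqP (x + y) (k - s0)) => h /=; lia.
have -> : (k - (s0 + (x + y))) = k - s0 - (x + y) by lia.
by case: (leqP (x + y) (k - s0)) => h /=; lia.
Qed.

(* If c is false, the old composition has one block of size x + y. *)
Variable c : bool.
Local Notation D := (mid_bdry (fun k => (k == s0 + x) && c)).
Local Notation D' := (mid_bdry (pred1 (s0 + y))).

Lemma block_swapE k : block_swap k = k /\ (k < s0 \/ s0 + y + x <= k) \/
  block_swap k = k + x /\ s0 <= k < s0 + y \/
  block_swap k = k - y /\ s0 + y <= k < s0 + y + x.
Proof.
rewrite /block_swap; case: (ltnP k s0) => k1; first by left; split; [|left].
case: (ltnP k (s0 + y)) => k2; first by right; left.
by case: (ltnP k (s0 + y + x)) => k3; [right; right|left; split; [|right]].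
Qed.

Lemma mid_bdry_s0 E : mid_bdry E s0.
Proof. by rewrite /mid_bdry leqnn bdry_sum. Qed.

Lemma mid_bdry_end E : mid_bdry E (s0 + (x + y)).
Proof. by rewrite /mid_bdry ltnn subnn bdry0; case: leqP => //; lia. Qed.

Lemma mid_bdry_in E k : s0 < k < s0 + (x + y) -> mid_bdry E k = E k.
Proof. by case/andP=> k0 k1; rewrite /mid_bdry leqNgt k0 k1. Qed.

Lemma mid_bdry_out E E' k : ~~ (s0 < k < s0 + (x + y)) -> mid_bdry E k = mid_bdry E' k.
Proof. by rewrite /mid_bdry; case: (leqP k s0) => // k0; case: (ltnP k (s0 + (x + y))). Qed.

(** Inside a new block the map is a translation, and no old boundary is met. *)
Lemma block_swap_moveA i : ~~ D' i.+1 ->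
  block_swap i.+1 = (block_swap i).+1 /\ ~~ D (block_swap i.+1).
Proof.
move=> Di.
have n1 : i.+1 <> s0 by move=> E; rewrite E mid_bdry_s0 in Di.
have n2 : i.+1 <> s0 + (x + y) by move=> E; rewrite E mid_bdry_end in Di.
have n3 : i.+1 <> s0 + y.
  by move=> E; rewrite mid_bdry_in /= ?E ?eqxx // in Di; lia.
have := block_swapE i; have := block_swapE i.+1; split; first by lia.
rewrite /block_swap.
case: ltnP => i1; first by rewrite (mid_bdry_out _ (pred1 (s0 + y))) //; lia.
case: ltnP => i2; first by rewrite mid_bdry_in; lia.
case: ltnP => i3; first by rewrite mid_bdry_in; lia.
by rewrite (mid_bdry_out _ (pred1 (s0 + y))) //; lia.
Qed.

(** Neighbours inside an old block come from neighbours inside a new block,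
    except at the place where one block of size x + y is cut into two; there
    the order of the two places is reversed. *)
Lemma block_swap_moveB i j : block_swap j = (block_swap i).+1 -> ~~ D (block_swap j) ->
  j < i \/ j = i.+1 /\ ~~ D' j.
Proof.
move=> E Dj.
have n1 : block_swap j <> s0 by move=> E'; rewrite E' mid_bdry_s0 in Dj.
have n2 : block_swap j <> s0 + (x + y) by move=> E'; rewrite E' mid_bdry_end in Dj.
case: (ltnP j i) => ji; [by left|right].
have jE : j = i.+1.
  by have := block_swapE i; have := block_swapE j; lia.
split=> //; move: E n1 n2 Dj; rewrite /block_swap.
case: (ltnP j s0) => j1.
  by move=> _ _ _; rewrite (mid_bdry_out _ (pred1 (s0 + y))) //; lia.
case: (ltnP j (s0 + y)) => j2.
  case: (ltnP i s0) => i1; first by lia.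
  by move=> _ _ _ _; rewrite mid_bdry_in /=; lia.
case: (ltnP j (s0 + y + x)) => j3.
  case: (ltnP i s0) => i1; first by lia.
  case: (ltnP i (s0 + y)) => i2; first by lia.
  by move=> _ _ _ _; rewrite mid_bdry_in /=; lia.
case: (ltnP i s0) => i1; first by lia.
case: (ltnP i (s0 + y)) => i2; first by lia.
by move=> _ _ _; rewrite (mid_bdry_out _ (pred1 (s0 + y))) //; lia.
Qed.

Lemma block_swap_lt n k : s0 + (x + y) <= n -> k < n -> block_swap k < n.
Proof. by have := block_swapE k; lia. Qed.

Lemma block_swap_inj : injective block_swap.
Proof.
by move=> i j; have := block_swapE i; have := block_swapE j; lia.
Qed.

End BlockSwap.

Local Open Scope ring_scope.

(** * Simple reflections *)

Section SimpleReflections.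
Variable m : nat.
Implicit Types (i j r c : 'I_m.+1) (k : 'I_m) (s t : {perm 'I_m.+1}).

Definition lo k : 'I_m.+1 := widen_ord (leqnSn m) k.
Definition hi k : 'I_m.+1 := lift ord0 k.
Definition sref k : {perm 'I_m.+1} := tperm (lo k) (hi k).

Lemma val_lo k : lo k = k :> nat. Proof. by []. Qed.
Lemma val_hi k : hi k = k.+1 :> nat. Proof. exact: lift0. Qed.
Lemma lt_lo_hi k : (lo k < hi k)%N. Proof. by rewrite val_hi. Qed.
Lemma lo_neq_hi k : lo k != hi k.
Proof. by rewrite neq_ltn lt_lo_hi. Qed.

Lemma lo_hiP i j : j = i.+1 :> nat -> exists2 k, i = lo k & j = hi k.
Proof.
move=> ji; have im : (i < m)%N by rewrite -ltnS -ji ltn_ord.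
by exists (Ordinal im); apply/val_inj; rewrite //= val_hi.
Qed.

Lemma sref_flip k r c : (r < c)%N -> (sref k c < sref k r)%N ->
  r = lo k /\ c = hi k.
Proof.
rewrite /sref => rc; have vh := val_hi k; have vl := val_lo k.
have neqE (x y : 'I_m.+1) : x <> y -> nat_of_ord x <> nat_of_ord y.
  by move=> xy /val_inj.
case: tpermP => [cE|cE|/neqE c1 /neqE c2]; case: tpermP => [rE|rE|/neqE r1 /neqE r2];
  move=> ?; subst; try by lia.
all: by split=> //; apply/val_inj => /=; lia.
Qed.

Lemma perm_ge_id s : (forall i, (i <= s i)%N) -> s = 1%g.
Proof.
move=> si; have E : (\sum_(i < m.+1) s i = \sum_(i < m.+1) i)%N.
  by rewrite [RHS](reindex_inj (@perm_inj _ s)).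
have [_ /esym] := leqif_sum (fun i (_ : true) => leqif_eq (si i)).
rewrite E eqxx => /forallP h; apply/permP => i; rewrite perm1.
by apply/val_inj/esym/eqP; have := h i.
Qed.

(** Exchanging the two values at a descent increases the sum of the products i
    * s i, and a permutation without descents is the identity. *)
Lemma perm_desc_ind (Q : {perm 'I_m.+1} -> Prop) : Q 1%g ->
  (forall s k, (s (hi k) < s (lo k))%N -> Q (sref k * s)%g -> Q s) ->
  forall s, Q s.
Proof.
move=> Q1 Qd s; pose mu (t : {perm 'I_m.+1}) := (\sum_(i < m.+1) i * t i)%N.
have mu_max t : (mu t <= \sum_(i < m.+1) i * m)%N.
  by apply: leq_sum => i _; rewrite leq_mul2l leq_ord orbT.
have [N] := ubnP ((\sum_(i < m.+1) i * m) - mu s); elim: N s => // N IH s sN.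
case: (pickP (fun k => (s (hi k) < s (lo k))%N)) => [k sk|nodesc]; last first.
  suff -> : s = 1%g by [].
  apply: perm_ge_id => -[i im]; elim: i im => //= i IHi im.
  have im' : (i < m)%N by [].
  have := nodesc (Ordinal im'); rewrite ltnNge => /negbFE.
  have -> : lo (Ordinal im') = Ordinal (ltnW im) by apply: val_inj.
  have -> : hi (Ordinal im') = Ordinal im by apply: val_inj; apply: (val_hi (Ordinal im')).
  rewrite leq_eqVlt => /orP[/eqP/val_inj/perm_inj/(congr1 val) /= h|]; first by lia.
  by apply: leq_ltn_trans; apply: IHi.
apply: (Qd _ k) => //; apply: IH.
have muE (t : {perm 'I_m.+1}) : mu t = (lo k * t (lo k) + (hi k * t (hi k) +
    \sum_(i < m.+1 | (i != lo k) && (i != hi k)) i * t i))%N.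
  by rewrite /mu (bigD1 (lo k)) //= (bigD1 (hi k)) //= eq_sym lo_neq_hi.
have muE' : (\sum_(i < m.+1 | (i != lo k) && (i != hi k)) i * (sref k * s)%g i =
    \sum_(i < m.+1 | (i != lo k) && (i != hi k)) i * s i)%N.
  apply: eq_bigr => i /andP[i1 i2]; rewrite permM /sref tpermD 1?eq_sym //.
have lt_mu : (mu s < mu (sref k * s)%g)%N.
  rewrite !muE muE' !permM /sref tpermL tpermR val_hi val_lo; nia.
by have := mu_max (sref k * s)%g; lia.
Qed.

End SimpleReflections.

(** * Subgroups of the general linear group given by vanishing entries *)

Section Matrices.
Variables (F : finFieldType) (m : nat).
Local Notation G := {'GL_m.+1[F]}.
Local Notation I := 'I_m.+1.
Implicit Types (g h u v : G) (i j r c : I) (k : 'I_m) (s t : {perm I}).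

Definition ent (g : G) (i j : I) : F := (val g : 'M[F]_m.+1) i j.
Definition pm (s : {perm I}) : G := @perm_GL F m.+1 s.

Lemma entP g h : (forall i j, ent g i j = ent h i j) -> g = h.
Proof. by move=> gh; apply/val_inj/matrixP => i j; apply: gh. Qed.

Lemma entM g h i j : ent (g * h)%g i j = \sum_r ent g i r * ent h r j.
Proof. by rewrite /ent FinRing.val_unitM mxE. Qed.

Lemma ent1 i j : ent 1%g i j = (i == j)%:R.
Proof. by rewrite /ent FinRing.val_unit1 mxE. Qed.

Lemma ent_pm s i j : ent (pm s) i j = (s i == j)%:R.
Proof. by rewrite /ent /= mxE mxE. Qed.

Lemma ent_pmL s g i j : ent (pm s * g)%g i j = ent g (s i) j.
Proof.
rewrite entM (bigD1 (s i)) //= ent_pm eqxx mul1r big1 ?addr0 // => r rs.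
by rewrite ent_pm eq_sym (negbTE rs) mul0r.
Qed.

Lemma ent_pmR s g i j : ent (g * pm s)%g i j = ent g i (s^-1%g j).
Proof.
rewrite entM (bigD1 (s^-1%g j)) //= ent_pm permKV eqxx mulr1 big1 ?addr0 // => r rs.
by rewrite ent_pm (can2_eq (permK s) (permKV s)) (negbTE rs) mulr0.
Qed.

Lemma pmM s t : (pm s * pm t = pm (s * t))%g.
Proof. by apply: entP => i j; rewrite ent_pmL !ent_pm permM. Qed.

Lemma pm1 : pm 1 = 1%g.
Proof. by apply: entP => i j; rewrite ent_pm ent1 perm1. Qed.

Lemma pmV s : ((pm s)^-1 = pm s^-1)%g.
Proof. by apply: (mulgI (pm s)); rewrite mulgV pmM mulgV pm1. Qed.

Lemma ent_conj s g i j : ent (pm s * g * pm s^-1)%g i j = ent g (s i) (s j).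
Proof. by rewrite ent_pmR invgK ent_pmL. Qed.

(** The default value is taken only if the matrix is singular, which needs i =
    j. *)
Definition elm i j (a : F) : G :=
  insubd (1%g : G) (1%:M + a *: delta_mx i j : 'M[F]_m.+1).

Lemma ent_elm i j a r c : i != j ->
  ent (elm i j a) r c = (r == c)%:R + a * ((r == i) && (c == j))%:R.
Proof.
move=> ij; rewrite /ent /elm val_insubd.
have -> : (1%:M + a *: delta_mx i j : 'M[F]_m.+1) \is a GRing.unit.
  have: (1%:M + a *: delta_mx i j : 'M[F]_m.+1) *m (1%:M - a *: delta_mx i j) = 1%:M.
    rewrite mulmxDl !mul1mx mulmxBr mulmx1 -scalemxAl -scalemxAr mul_delta_mx_0 1?eq_sym //.
    by rewrite !scaler0 subr0 subrK.
  by move/mulmx1_unit => [].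
by rewrite !mxE.
Qed.

Lemma ent_elmL i j a g r c : i != j ->
  ent (elm i j a * g)%g r c = ent g r c + (r == i)%:R * (a * ent g j c).
Proof.
move=> ij; rewrite entM.
under eq_bigr => l _ do rewrite ent_elm // mulrDl.
rewrite big_split /=; congr (_ + _).
  rewrite (bigD1 r) //= eqxx mul1r big1 ?addr0 // => l lr.
  by rewrite eq_sym (negbTE lr) mul0r.
rewrite (bigD1 j) //= eqxx andbT big1 ?addr0 => [|l lj]; first by ring.
by rewrite (negbTE lj) andbF mulr0 mul0r.
Qed.

Lemma ent_elmR i j a g r c : i != j ->
  ent (g * elm i j a)%g r c = ent g r c + (c == j)%:R * (ent g r i * a).
Proof.
move=> ij; rewrite entM.
under eq_bigr => l _ do rewrite ent_elm // mulrDr.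
rewrite big_split /=; congr (_ + _).
  rewrite (bigD1 c) //= eqxx mulr1 big1 ?addr0 // => l lr.
  by rewrite (negbTE lr) mulr0.
rewrite (bigD1 i) //= eqxx /= big1 ?addr0 => [|l li]; first by ring.
by rewrite (negbTE li) !mulr0.
Qed.

Definition xs k a := elm (lo k) (hi k) a.
Definition ys k a := elm (hi k) (lo k) a.

Lemma ent_xsR k a g r c :
  ent (g * xs k a)%g r c = ent g r c + (c == hi k)%:R * (ent g r (lo k) * a).
Proof. by rewrite ent_elmR ?lo_neq_hi. Qed.

Lemma ent_xs k a r c :
  ent (xs k a) r c = (r == c)%:R + a * ((r == lo k) && (c == hi k))%:R.
Proof. by rewrite ent_elm ?lo_neq_hi. Qed.

Lemma xsM k a b : (xs k a * xs k b = xs k (a + b))%g.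
Proof.
apply: entP => r c; rewrite ent_xsR !ent_xs.
rewrite (negbTE (lo_neq_hi k)) andbF mulr0 addr0 -mulnb natrM.
by ring.
Qed.

Lemma xs0 k : xs k 0 = 1%g.
Proof. by apply: entP => r c; rewrite ent_xs ent1 mul0r addr0. Qed.

Lemma gl_groupM (P : {group G}) g h : g \in P -> h \in P -> (g * h)%g \in P.
Proof. exact: groupM. Qed.

Lemma gl_groupV (P : {group G}) g : g \in P -> (g^-1)%g \in P.
Proof. by move=> gP; rewrite groupV. Qed.

Lemma gl_groupMl (P : {group G}) g h : g \in P -> ((g * h)%g \in P) = (h \in P).
Proof.
move=> gP; apply/idP/idP => hP; last exact: gl_groupM.
by rewrite -(mulKg g h) gl_groupM // gl_groupV.
Qed.

Lemma gl_groupMr (P : {group G}) g h : h \in P -> ((g * h)%g \in P) = (g \in P).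
Proof.
move=> hP; apply/idP/idP => gP; last exact: gl_groupM.
by rewrite -(mulgK h g) gl_groupM // gl_groupV.
Qed.

Local Notation B := (borel F m.+1).
Local Notation U := (unitri F m.+1).

Lemma borelP g : reflect (forall i j, (j < i)%N -> ent g i j = 0) (g \in B).
Proof.
rewrite inE; apply: (iffP forallP) => [h i j ji|h i].
  by have /forallP/(_ j) := h i; rewrite ji => /eqP.
by apply/forallP => j; apply/implyP => ji; apply/eqP; apply: h.
Qed.

Definition lowtri : {set G} :=
  [set g : G | [forall i : I, forall j : I, (i < j)%N ==> (ent g i j == 0)]].

Lemma lowtriP g : reflect (forall i j, (i < j)%N -> ent g i j = 0) (g \in lowtri).
Proof.
rewrite inE; apply: (iffP forallP) => [h i j ji|h i].
  by have /forallP/(_ j) := h i; rewrite ji => /eqP.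
by apply/forallP => j; apply/implyP => ji; apply/eqP; apply: h.
Qed.

(** If [T] is transitive this is the subgroup of U generated by the root
    subgroups of the places (i, j) with [T i j]. *)
Definition pat (T : rel I) : {set G} :=
  [set g : G | [forall i : I, forall j : I,
     ~~ ((i < j)%N && T i j) ==> (ent g i j == (i == j)%:R)]].

Lemma patP (T : rel I) g :
  reflect (forall i j, ~~ ((i < j)%N && T i j) -> ent g i j = (i == j)%:R)
          (g \in pat T).
Proof.
rewrite inE; apply: (iffP forallP) => [h i j ji|h i].
  by have /forallP/(_ j) := h i; rewrite ji => /eqP.
by apply/forallP => j; apply/implyP => ji; apply/eqP; apply: h.
Qed.

Lemma group_set_closed (A : {set G}) : 1%g \in A ->
  (forall g h, g \in A -> h \in A -> (g * h)%g \in A) -> group_set A.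
Proof. by move=> A1 AM; apply/group_setP; split=> // g h; apply: AM. Qed.

Lemma block_group_set (T : rel I) (A : {set G}) :
  (forall i, T i i) -> (forall i j r, T i j -> T j r -> T i r) ->
  (forall g, reflect (forall i j, ~~ T i j -> ent g i j = 0) (g \in A)) ->
  group_set A.
Proof.
move=> T1 Ttr AP; apply: group_set_closed => [|g h /AP gP /AP hP].
  by apply/AP => i j nT; rewrite ent1; case: eqP nT => // ->; rewrite T1.
apply/AP => i j nT; rewrite entM big1 // => r _.
case Tir: (T i r); last by rewrite gP ?Tir ?mul0r.
case Trj: (T r j); last by rewrite hP ?Trj ?mulr0.
by rewrite (Ttr _ _ _ Tir Trj) in nT.
Qed.

Lemma borel_group_set : group_set B.
Proof.
apply: (@block_group_set (fun i j => i <= j)%N) => // [i j r|g].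
  exact: leq_trans.
by apply: (iffP (borelP g)) => h i j; [rewrite -ltnNge|rewrite ltnNge]; apply: h.
Qed.
Canonical borel_group := Group borel_group_set.

Lemma lowtri_group_set : group_set lowtri.
Proof.
apply: (@block_group_set (fun i j => j <= i)%N) => // [i j r ji rj|g].
  exact: leq_trans rj ji.
by apply: (iffP (lowtriP g)) => h i j; [rewrite -ltnNge|rewrite ltnNge]; apply: h.
Qed.
Canonical lowtri_group := Group lowtri_group_set.

Lemma pat_group_set (T : rel I) :
  (forall i j r, T i j -> T j r -> T i r) -> group_set (pat T).
Proof.
move=> Ttr; apply: group_set_closed => [|g h /patP gP /patP hP].
  by apply/patP => i j _; rewrite ent1.
apply/patP => i j nT; rewrite entM.
transitivity (\sum_r (i == r)%:R * (r == j)%:R : F).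
  apply: eq_bigr => r _; case Tir: ((i < r)%N && T i r); last first.
    rewrite gP ?Tir //; case: eqP => [<-|_]; last by rewrite !mul0r.
    by rewrite hP.
  have ir : (i == r) = false by case/andP: Tir => ir _; rewrite -val_eqE (ltn_eqF ir).
  rewrite ir mul0r; case Trj: ((r < j)%N && T r j).
    case/andP: Tir => i1 i2; case/andP: Trj => r1 r2.
    by rewrite (Ttr _ _ _ i2 r2) (ltn_trans i1 r1) in nT.
  rewrite hP ?Trj //; case: eqP => [rj|_]; last by rewrite mulr0.
  by rewrite -rj Tir in nT.
rewrite (bigD1 i) //= eqxx mul1r big1 ?addr0 // => r ri.
by rewrite eq_sym (negbTE ri) mul0r.
Qed.

Lemma unitri_pat : U = pat (fun _ _ => true).
Proof.
apply/setP => g; rewrite inE; apply/andP/patP => [[/borelP gB /forallP g1] i j|h].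
  rewrite andbT -leqNgt leq_eqVlt => /orP[/eqP/val_inj ->|ji].
    by rewrite eqxx; apply/eqP; exact: (g1 i).
  by rewrite gB // -val_eqE (gtn_eqF ji).
split; first by apply/borelP => i j ji; rewrite h -?val_eqE ?(gtn_eqF ji) // andbT -leqNgt ltnW.
by apply/forallP => i; apply/eqP; rewrite -[LHS]/(ent g i i) h ?eqxx // ltnn.
Qed.

Lemma unitri_group_set : group_set U.
Proof. by rewrite unitri_pat; apply: pat_group_set. Qed.
Canonical unitri_group := Group unitri_group_set.

Lemma unitriP u : reflect (forall i j, (j <= i)%N -> ent u i j = (i == j)%:R) (u \in U).
Proof.
rewrite unitri_pat; apply: (iffP (patP _ _)) => h i j.
  by move=> ji; apply: h; rewrite andbT -leqNgt.
by rewrite andbT -leqNgt; apply: h.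
Qed.

Lemma unitri_sub_borel : U \subset B.
Proof. by apply/subsetP => g; rewrite inE => /andP[]. Qed.

Lemma pat_sub_unitri T : pat T \subset U.
Proof.
apply/subsetP => g /patP h; apply/unitriP => i j ji; apply: h.
by rewrite ltnNge ji.
Qed.

Lemma borel_diag g i : g \in B -> ent g i i != 0.
Proof.
move=> /borelP gB; have : \det (val g : 'M[F]_m.+1) != 0.
  by rewrite -unitfE; have := valP g; rewrite /= unitmxE.
rewrite -det_tr det_trig; last first.
  by apply/is_trig_mxP => r c rc; rewrite mxE; apply: gB.
by move=> /prodf_neq0/(_ i isT); rewrite mxE.
Qed.

Lemma xs_pat (T : rel I) k a : T (lo k) (hi k) -> xs k a \in pat T.
Proof.
move=> Tk; apply/patP => i j nT; rewrite ent_xs.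
case: (boolP ((i == lo k) && (j == hi k))) nT => [/andP[/eqP -> /eqP ->]|_ _];
  first by rewrite lt_lo_hi Tk.
by rewrite mulr0 addr0.
Qed.

Lemma xs_unitri k a : xs k a \in U.
Proof. by rewrite unitri_pat xs_pat. Qed.

End Matrices.

(** * The Bruhat decomposition *)

Section Bruhat.
Variables (F : finFieldType) (m : nat).
Local Notation G := {'GL_m.+1[F]}.
Local Notation I := 'I_m.+1.
Local Notation B := (borel F m.+1).
Local Notation U := (unitri F m.+1).
Local Notation pm := (pm F).
Local Notation xs := (@xs F m).
Local Notation ys := (@ys F m).
Implicit Types (g h u v : G) (i j r c : I) (k : 'I_m) (s t : {perm I}).

Lemma sref_invol k : (sref k * sref k = 1)%g.
Proof. by rewrite /sref tperm2. Qed.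

Lemma pm_srefK k : (pm (sref k) * pm (sref k) = 1)%g.
Proof. by rewrite pmM sref_invol pm1. Qed.

Lemma ent_srefJ k g r c :
  ent (pm (sref k) * g * pm (sref k))%g r c = ent g (sref k r) (sref k c).
Proof. by have := ent_conj (sref k) g r c; rewrite /sref tpermV. Qed.

(** The upper triangular part of the standard Levi subgroup whose only block
    of size 2 stands at k and k + 1, with arbitrary diagonal. *)
Definition levi_unip k g := forall r c, r != c -> (r, c) != (lo k, hi k) -> ent g r c = 0.

Lemma borel_conj k s g : levi_unip k g -> (s (lo k) < s (hi k))%N ->
  ((pm s)^-1 * g * pm s)%g \in B.
Proof.
move=> gk sk; rewrite pmV -{2}[s]invgK; apply/borelP => i j ji; rewrite ent_conj.
apply: gk; first by apply: contraTneq ji => /perm_inj ->; rewrite ltnn.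
apply: contraTneq ji => -[E1 E2]; rewrite -leqNgt ltnW //.
by move: sk; rewrite -E1 -E2 !permKV.
Qed.

Lemma xs_levi k a : levi_unip k (xs k a).
Proof.
move=> r c rc rck; rewrite ent_xs (negbTE rc) add0r.
by rewrite xpair_eqE in rck; rewrite (negbTE rck) mulr0.
Qed.

(** In rank one, [[1, 0], [a, 1]] is the product of [[1, 1/a], [0, 1]], the
    reflection and an upper triangular matrix. *)
Lemma ys_levi k a : a != 0 ->
  levi_unip k (pm (sref k) * (xs k (- a^-1)%R * ys k a))%g.
Proof.
move=> a0 r c rc rck; have hl : hi k != lo k by rewrite eq_sym lo_neq_hi.
rewrite ent_pmL ent_elmL ?lo_neq_hi // !ent_elm //.
rewrite xpair_eqE in rck.
rewrite /sref; case: tpermP => [rE|rE|/eqP r1 /eqP r2].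
- rewrite rE eqxx /= in rck; rewrite rE in rc.
  by rewrite (negbTE hl) eqxx eq_sym (negbTE rck) [c == _]eq_sym (negbTE rc) /=; ring.
- rewrite rE in rc; rewrite !eqxx [lo k == hi k]eq_sym (negbTE hl) (negbTE rc) /=.
  by rewrite [lo k == c]eq_sym; case: (c == lo k) => /=; field.
- by rewrite (negbTE rc) (negbTE r1) (negbTE r2) /=; ring.
Qed.

Lemma levi_borel k g : levi_unip k g -> g \in B.
Proof.
move=> gk; apply/borelP => i j ji; apply: gk.
  by rewrite -val_eqE /= gtn_eqF.
by apply: contraTneq ji => -[-> ->]; rewrite -leqNgt ltnW // lt_lo_hi.
Qed.

Lemma unitri_srefJ k u : u \in U -> ent u (lo k) (hi k) = 0 ->
  (pm (sref k) * u * pm (sref k))%g \in U.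
Proof.
move=> /unitriP uU u0; apply/unitriP => i j ji; rewrite ent_srefJ.
case: (leqP (sref k j) (sref k i)) => h; first by rewrite uU // (inj_eq perm_inj).
case: (ltnP j i) => [lt|le].
  have [-> ->] := sref_flip lt h; rewrite /sref tpermL tpermR u0.
  by rewrite eq_sym (negbTE (lo_neq_hi k)).
have ij : i = j by apply/val_inj/eqP; rewrite eqn_leq le ji.
by rewrite ij uU // !eqxx.
Qed.

Definition bruhat g := exists u s b, [/\ u \in U, b \in B & g = (u * pm s * b)%g].

(** The root subgroup at k is split off from the factor in U; the rest is
    normalised by the reflection. If the reflection shortens the permutation,
    then the root subgroup becomes a lower triangular one, which [ys_levi]
    rewrites. *)
Lemma bruhat_sref k g : bruhat g -> bruhat (pm (sref k) * g)%g.
Proof.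
case=> u [s [b [uU bB ->]]].
set a := ent u (lo k) (hi k); set u' := (u * xs k (- a))%g.
have u'U : u' \in U by rewrite gl_groupM ?xs_unitri.
have u'0 : ent u' (lo k) (hi k) = 0.
  rewrite ent_xsR -/a (unitriP _ uU (lo k) (lo k) (leqnn _)) !eqxx.
  by rewrite !mul1r subrr.
set w := (pm (sref k) * u' * pm (sref k))%g.
have wU : w \in U by apply: unitri_srefJ.
have E : (pm (sref k) * (u * pm s * b) =
          w * (pm (sref k) * xs k a * pm s * b))%g.
  rewrite /w /u' !mulgA -(mulgA _ (pm (sref k)) (pm (sref k))) pm_srefK mulg1.
  by rewrite -(mulgA _ (xs k (- a))) xsM addNr xs0 mulg1.
rewrite E; case: (ltnP (s (lo k)) (s (hi k))) => sk.
  exists w, (sref k * s)%g, ((pm s)^-1 * xs k a * pm s * b)%g; split=> //.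
    by rewrite gl_groupM // (borel_conj (@xs_levi k a)).
  by rewrite -pmM !mulgA mulgK.
have sk' : ((sref k * s)%g (lo k) < (sref k * s)%g (hi k))%N.
  rewrite !permM /sref tpermL tpermR ltn_neqAle sk andbT.
  by apply: contraTneq (lt_lo_hi k) => /val_inj/perm_inj ->; rewrite ltnn.
have E2 : (pm (sref k) * xs k a * pm s = ys k a * pm (sref k * s))%g.
  rewrite -pmM mulgA; congr (_ * pm s)%g; rewrite -[LHS]mulg1 -(pm_srefK k) !mulgA.
  congr (_ * _)%g; apply: entP => r c; rewrite ent_srefJ ent_xs ent_elm.
    rewrite (inj_eq perm_inj) /sref; congr (_ + a * (_ && _)%:R).
      by rewrite (canF_eq (tpermK _ _)) tpermL.
    by rewrite (canF_eq (tpermK _ _)) tpermR.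
  by rewrite eq_sym lo_neq_hi.
rewrite E2; case: (eqVneq a 0) => [a0|a0].
  exists w, (sref k * s)%g, b; split=> //.
  suff -> : ys k a = 1%g by rewrite mul1g !mulgA.
  by apply: entP => r c; rewrite ent_elm ?[hi k == _]eq_sym ?lo_neq_hi // a0 mul0r addr0 ent1.
set g0 := (pm (sref k) * (xs k (- a^-1)%R * ys k a))%g.
have g0k : levi_unip k g0 by apply: ys_levi.
have yE : ys k a = (xs k (a^-1)%R * pm (sref k) * g0)%g.
  rewrite /g0 !mulgA -(mulgA _ (pm (sref k)) (pm (sref k))) pm_srefK mulg1.
  by rewrite xsM subrr xs0 mul1g.
exists (w * xs k (a^-1)%R)%g, s, ((pm (sref k * s))^-1 * g0 * pm (sref k * s) * b)%g.
split; first by rewrite gl_groupM ?xs_unitri.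
  by rewrite gl_groupM // (borel_conj g0k).
have sE : pm s = (pm (sref k) * pm (sref k * s))%g.
  by rewrite pmM mulgA sref_invol mul1g.
by rewrite yE sE !mulgA mulgK.
Qed.

Lemma bruhat_pm s g : bruhat g -> bruhat (pm s * g)%g.
Proof.
move=> gC; elim/perm_desc_ind: s => [|s k _ IH]; first by rewrite pm1 mul1g.
by have := bruhat_sref k IH; rewrite -pmM !mulgA pm_srefK mul1g.
Qed.

Lemma bruhat_unitri u g : u \in U -> bruhat g -> bruhat (u * g)%g.
Proof.
move=> uU [v [s [b [vU bB ->]]]]; exists (u * v)%g, s, b; split=> //.
  exact: gl_groupM.
by rewrite !mulgA.
Qed.

Definition w0 : {perm I} := perm (@rev_ord_inj m.+1).

Lemma w0E i : w0 i = rev_ord i. Proof. by rewrite permE. Qed.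

Lemma w0V : (w0^-1 = w0)%g.
Proof.
apply/permP => i; apply: (@perm_inj _ w0); rewrite permKV !w0E.
by rewrite rev_ordK.
Qed.

Lemma w0_invol : (w0 * w0 = 1)%g.
Proof. by rewrite -{1}w0V mulVg. Qed.

Lemma ltn_w0 i j : (w0 i < w0 j)%N = (j < i)%N.
Proof. by rewrite !w0E /=; have := ltn_ord i; have := ltn_ord j; lia. Qed.

(** The LUP decomposition has a lower unitriangular factor, and that is
    conjugate to an element of U by the longest permutation. So g is built up
    from B by left multiplications with permutations and with an element of U. *)
Lemma bruhatP g : bruhat g.
Proof.
have := @cormen_lup_correct F m (val g); have := cormen_lup_perm (val g).
have := cormen_lup_detL (val g); have := @cormen_lup_lower F m (val g).
have := @cormen_lup_upper F m (val g).
case: (cormen_lup _) => [[P L] V] /= Vup Llow Ldet /is_perm_mxP[s ->] E.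
have Lu : L \is a GRing.unit by rewrite /= unitmxE Ldet unitr1.
pose Lg : G := FinRing.unit _ Lu.
pose Vg : G := (Lg^-1 * (pm s * g))%g.
have gE : (g = pm s^-1 * (Lg * Vg))%g by rewrite /Vg mulKVg -pmV mulKg.
have LVE : (Lg * Vg = pm s * g)%g by rewrite /Vg mulKVg.
have valV : (val Vg : 'M[F]_m.+1) = V.
  by apply: (mulrI Lu); rewrite -E; apply: (congr1 val LVE).
have VB : Vg \in B.
  by apply/borelP => i j ji; rewrite /ent valV Vup.
have LB : (pm w0 * Lg * pm w0)%g \in U.
  have E2 : (pm w0 * Lg * pm w0 = pm w0 * Lg * pm w0^-1)%g by rewrite w0V.
  apply/unitriP => i j ji; rewrite E2 ent_conj /ent /= Llow.
    by rewrite (inj_eq perm_inj).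
  by rewrite !w0E /=; have := ltn_ord i; lia.
have LE : (Lg = pm w0 * ((pm w0 * Lg * pm w0) * pm w0))%g.
  rewrite !mulgA pmM w0_invol pm1 mul1g -mulgA pmM w0_invol pm1 mulg1 //.
rewrite gE LE; move: LB; set X := (pm w0 * Lg * pm w0)%g => XU.
rewrite -[(pm w0 * _ * Vg)%g]mulgA -[(X * pm w0 * Vg)%g]mulgA.
apply: bruhat_pm; apply: bruhat_pm; apply: bruhat_unitri => //.
apply: bruhat_pm; exists 1%g, 1%g, Vg; split=> //.
by rewrite pm1 !mul1g.
Qed.

(** The diagonal entries of an element of B are nonzero. Here this means that
    t * s^-1 moves no index down, which makes it the identity. *)
Lemma bruhat_disjoint s t u : u \in U -> ((pm t)^-1 * u * pm s)%g \in B -> s = t.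
Proof.
move=> /unitriP uU hB; have le i : (i <= (t * s^-1)%g i)%N.
  have := borel_diag (t i) hB; rewrite ent_pmR pmV ent_pmL permK permM.
  apply: contraR; rewrite -ltnNge => h.
  by rewrite uU ?(ltnW h) // -val_eqE (gtn_eqF h).
by apply/eqP; rewrite eq_sym eq_mulgV1 (perm_ge_id le).
Qed.

End Bruhat.

(** * Factoring the unitriangular group *)

Lemma sum_mulg (gT : finGroupType) (V : nmodType) (H K : {group gT}) (f : gT -> V) :
  (H :&: K)%g = 1%g ->
  \sum_(x in (H * K)%g) f x = \sum_(h in H) \sum_(k in K) f (h * k)%g.
Proof.
move=> HK1; rewrite pair_big /= (_ : (H * K)%g = [set u.1 * u.2 | u in setX H K]%g).
  rewrite big_imset /=; first by apply: eq_bigl => u; rewrite inE.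
  move=> [h k] [h' k']; rewrite !in_setX /= => /andP[hH kK] /andP[hH' kK'] E.
  have E2 : (h'^-1 * h = k' * k^-1)%g.
    by rewrite -[in LHS](mulgK k h) E !mulgA mulVg mul1g.
  have : (h'^-1 * h)%g \in (H :&: K)%g.
    by rewrite inE {2}E2 !groupM ?groupV.
  rewrite HK1 => /set1P hh; rewrite hh in E2.
  have hE : h = h' by rewrite -[h](mulKVg h') hh mulg1.
  by rewrite hE in E *; rewrite (mulgI _ _ _ E).
apply/setP => x; apply/mulsgP/imsetP => [[h k hH kK ->]|[[h k] /setXP[hH kK] ->]].
  by exists (h, k); rewrite ?in_setX ?hH.
by exists h k.
Qed.

Section Counting.
Variables (F : finFieldType) (m : nat).
Local Notation G := {'GL_m.+1[F]}.
Local Notation I := 'I_m.+1.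
Local Notation U := (unitri F m.+1).
Local Notation pm := (pm F).
Local Notation xs := (@xs F m).
Local Notation q := #|F|.
Implicit Types (g h u v : G) (i j r c : I) (k : 'I_m) (s t : {perm I}).

Lemma card_pat (T : rel I) :
  #|pat F T| = (q ^ (\sum_(i < m.+1) \sum_(j < m.+1) ((i < j) && T i j)))%N.
Proof.
pose D (p : I * I) := (p.1 < p.2)%N && T p.1 p.2.
pose fm (f : {ffun {p | D p} -> F}) : 'M[F]_m.+1 :=
  \matrix_(i, j) if insub (i, j) is Some w then f w else (i == j)%:R.
have fm_unit f : fm f \is a GRing.unit.
  rewrite /= unitmxE -det_tr det_trig.
    rewrite big1 ?unitr1 // => i _; rewrite !mxE; case: insubP => [w|_]; last by rewrite eqxx.
    by rewrite /D /= ltnn.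
  apply/is_trig_mxP => i j ij; rewrite !mxE; case: insubP => [w|_].
    by rewrite /D /= ltnNge ltnW.
  by rewrite -val_eqE /= gtn_eqF.
pose fg f : G := FinRing.unit _ (fm_unit f).
have fg_inj : injective fg.
  move=> f1 f2 E; apply/ffunP => w.
  have := congr1 (fun g => ent g (val w).1 (val w).2) E.
  rewrite /ent /= !mxE -surjective_pairing.
  by rewrite valK.
have <- : #|[set fg f | f in setT]| = #|pat F T|.
  apply: eq_card => g; apply/imsetP/patP => [[f _ ->] i j nD|gT].
    rewrite /ent /= mxE; case: insubP => [w|//].
    by rewrite /D /= (negbTE nD).
  exists [ffun w : {p | D p} => ent g (val w).1 (val w).2] => //.
  apply: entP => i j; rewrite {2}/ent /= mxE; case: insubP => [w _ wE|nD].
    by rewrite ffunE wE.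
  exact: gT.
rewrite card_imset // cardsT card_ffun card_sig; congr (_ ^ _)%N.
by rewrite -sum1_card big_mkcond pair_bigA /=.
Qed.

Definition invr s : rel I := fun i j => (s j < s i)%N.
Definition ninvr s : rel I := fun i j => (s i < s j)%N.

Lemma invr_trans s i j r : invr s i j -> invr s j r -> invr s i r.
Proof. by rewrite /invr => ji rj; apply: ltn_trans rj ji. Qed.
Lemma ninvr_trans s i j r : ninvr s i j -> ninvr s j r -> ninvr s i r.
Proof. exact: ltn_trans. Qed.

(** The root subgroups of the places that [s] inverts generate [invU s], the
    others generate [ninvU s]. *)
Definition invU s : {set G} := pat F (invr s).
Definition ninvU s : {set G} := pat F (ninvr s).
Canonical invU_group s := @Group _ (invU s) (pat_group_set F (@invr_trans s)).
Canonical ninvU_group s := @Group _ (ninvU s) (pat_group_set F (@ninvr_trans s)).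

Lemma xs_invU k s a : (s (hi k) < s (lo k))%N -> xs k a \in invU s.
Proof. by move=> sk; apply: xs_pat. Qed.

Lemma card_invU s : #|invU s| = (q ^ inv_count s)%N.
Proof. exact: card_pat. Qed.
Lemma card_ninvU s : #|ninvU s| = (q ^ ninv_count s)%N.
Proof. exact: card_pat. Qed.

Lemma card_unitri s : #|U| = (q ^ inv_count s * q ^ ninv_count s)%N.
Proof.
rewrite unitri_pat card_pat -expnD; congr (_ ^ _)%N.
rewrite /inv_count /ninv_count -big_split /=; apply: eq_bigr => i _.
rewrite -big_split; apply: eq_bigr => j _ /=; rewrite andbT.
case: (ltngtP (s i) (s j)) => sij; rewrite ?andbT ?andbF ?addn0 //.
by rewrite (perm_inj (val_inj sij)) ltnn.
Qed.

Lemma inv_ninv_TI s : (ninvU s :&: invU s = 1)%g.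
Proof.
apply/trivgP/subsetP => g /setIP[/patP g1 /patP g2]; apply/set1P/entP => i j.
rewrite ent1; case: (ltnP (s i) (s j)) => sij.
  by apply: g2; rewrite /invr [(s j < s i)%N]ltnNge (ltnW sij) andbF.
by apply: g1; rewrite /ninvr [(s i < s j)%N]ltnNge sij andbF.
Qed.

Lemma unitri_factor s : (ninvU s * invU s = U)%g.
Proof.
apply/eqP; rewrite eqEcard mul_subG ?pat_sub_unitri //=.
have := mul_cardG (ninvU_group s) (invU_group s).
by rewrite /= inv_ninv_TI cards1 muln1 => <-; rewrite (card_unitri s) card_invU card_ninvU mulnC.
Qed.

Lemma sum_unitri_factor (V : nmodType) s (f : G -> V) :
  \sum_(u in U) f u =
  \sum_(h in ninvU s) \sum_(x in invU s) f (h * x)%g.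
Proof. by rewrite -(unitri_factor s) sum_mulg //; apply: inv_ninv_TI. Qed.

(** If k is a descent of s, then s inverts the place at k and the images under
    the reflection of the places inverted by sref k * s. *)
Lemma sum_invr_desc (V : nmodType) k s (f : G -> V) : (s (hi k) < s (lo k))%N ->
  \sum_(x in invU s) f x =
  \sum_(x in invU (sref k * s)%g) \sum_a
     f (pm (sref k) * x * pm (sref k) * xs k a)%g.
Proof.
move=> sk; rewrite pair_big /=.
pose h (w : G * F) := (pm (sref k) * w.1 * pm (sref k) * xs k w.2)%g.
pose h' (x : G) : G * F :=
  ((pm (sref k) * (x * xs k (- ent x (lo k) (hi k))) * pm (sref k))%g,
   ent x (lo k) (hi k)).
have srefJ x : (pm (sref k) * (pm (sref k) * x * pm (sref k)) * pm (sref k) = x)%g.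
  by rewrite !mulgA pm_srefK mul1g -mulgA pm_srefK mulg1.
have hh' x : h (h' x) = x.
  by rewrite /h /h' /= srefJ -mulgA xsM addNr xs0 mulg1.
have h'h w : w.1 \in invU (sref k * s)%g -> h' (h w) = w.
  case: w => x a /= /patP xP; have aE : ent (h (x, a)) (lo k) (hi k) = a.
    rewrite ent_xsR !ent_srefJ /sref !tpermL tpermR eqxx.
    rewrite !xP ?ltnn // ?eqxx 1?eq_sym ?(negbTE (lo_neq_hi k)) //.
      by rewrite !mul1r add0r.
    by rewrite ltnNge ltnW ?lt_lo_hi.
  rewrite /h' aE; congr (_, _).
  by rewrite /h /= -[(_ * xs k a * _)%g]mulgA xsM subrr xs0 mulg1 srefJ.
have hU w : w.1 \in invU (sref k * s)%g -> h w \in invU s.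
  case: w => x a /= /patP xP; rewrite gl_groupM ?xs_invU //.
  apply/patP => i j nij; rewrite ent_srefJ xP ?(inj_eq perm_inj) //.
  apply: contra nij => /andP[sij]; rewrite /invr !permM !tpermK => sji.
  rewrite sji andbT ltnNge leq_eqVlt; apply/norP; split.
    by apply: contraTneq sji => /val_inj ->; rewrite ltnn.
  apply/negP => ji; have [jE iE] := sref_flip ji sij.
  by move: sji sk; rewrite iE jE; lia.
have h'U x : x \in invU s -> (h' x).1 \in invU (sref k * s)%g.
  move=> xP /=; set y := (x * _)%g.
  have yP : y \in invU s by rewrite gl_groupM ?xs_invU.
  have y0 : ent y (lo k) (hi k) = 0.
    rewrite ent_xsR eqxx (patP _ _ xP (lo k) (lo k)) ?ltnn //.
    by rewrite eqxx !mul1r subrr.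
  apply/patP => i j nij; rewrite ent_srefJ.
  case: (boolP ((sref k i == lo k) && (sref k j == hi k))) => [/andP[/eqP iE /eqP jE]|ne].
    rewrite iE jE y0; case: eqP => // ij; rewrite ij jE in iE.
    by have := lo_neq_hi k; rewrite iE eqxx.
  move/patP: yP => ->; first by rewrite (inj_eq perm_inj).
  apply: contra nij => /andP[sij sji]; rewrite /invr in sji *; rewrite !permM sji andbT.
  rewrite ltnNge leq_eqVlt; apply/norP; split.
    by apply: contraTneq sij => /val_inj ->; rewrite ltnn.
  apply/negP => ji; have [jE iE] := sref_flip ji sij.
  by rewrite iE jE /sref tpermL tpermR !eqxx in ne.
rewrite (reindex_onto h h') => [|x _]; last exact: hh'.
apply: eq_bigl => w; rewrite andbT; apply/andP/idP => [[hw /eqP wE]|wP].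
  by rewrite -wE h'U.
by rewrite hU // h'h.
Qed.

End Counting.

(** * Parabolic subgroups *)

Lemma mulg_shift (gT : groupType) (u p b v t c : gT) :
  (u * p * b = v * t * c)%g -> (t^-1 * (v^-1 * u) * p = c * b^-1)%g.
Proof.
move=> E; apply: (mulIg b); rewrite mulgKV; apply: (mulgI (v * t)%g).
by rewrite -E !mulgA mulgK mulgV mul1g.
Qed.

Section Parabolics.
Variables (F : finFieldType) (m : nat).
Local Notation G := {'GL_m.+1[F]}.
Local Notation I := 'I_m.+1.
Local Notation B := (borel F m.+1).
Local Notation U := (unitri F m.+1).
Local Notation pm := (pm F).
Local Notation xs := (@xs F m).
Local Notation ys := (@ys F m).
Local Notation q := #|F|.
Implicit Types (g h u v : G) (i j r c : I) (k : 'I_m) (s t : {perm I}).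
Implicit Types (P Q : {group G}).

(** A double coset of B: the diagonal matrices are normalised by permutations,
    so that U suffices on the left. *)
Definition bcell s : {set G} := (U :* pm s * B)%g.

Lemma bcellP s g :
  reflect (exists u b, [/\ u \in U, b \in B & g = (u * pm s * b)%g]) (g \in bcell s).
Proof.
apply: (iffP mulsgP) => [[x b /rcosetP[u uU ->] bB ->]|[u [b [uU bB ->]]]].
  by exists u, b.
by exists (u * pm s)%g b => //; apply/rcosetP; exists u.
Qed.

Lemma ninvU_conj s u : u \in U -> (((pm s)^-1 * u * pm s)%g \in B) = (u \in ninvU F s).
Proof.
move=> /unitriP gU; rewrite pmV -{2}[s]invgK; apply/borelP/patP => [gB i j nij|gP i j ji].
  case: (leqP j i) => ij; first exact: gU.
  rewrite ij /= -leqNgt leq_eqVlt in nij; case/orP: nij => [/eqP/val_inj/perm_inj ji|nij].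
    by rewrite ji ltnn in ij.
  have := gB _ _ nij; rewrite ent_conj !permK => ->.
  by rewrite -val_eqE /= (ltn_eqF ij).
rewrite ent_conj gP; last by rewrite /ninvr !permKV [(i < j)%N]ltnNge (ltnW ji) andbF.
by rewrite (inj_eq perm_inj) -val_eqE /= (gtn_eqF ji).
Qed.

Lemma card_bcell s : #|bcell s| = (q ^ inv_count s * #|B|)%N.
Proof.
have q0 : (0 < q)%N by apply/card_gt0P; exists 0.
have E : #|(U * (B :^ (pm s)^-1))%g| = #|bcell s|.
  by rewrite conjsgE invgK !mulgA card_rcoset.
have := mul_cardG (unitri_group F m) (conjG_group (borel_group F m) (pm s)^-1).
rewrite /= E cardJg (card_unitri F s).
have -> : U :&: (B :^ (pm s)^-1)%g = ninvU F s.
  apply/setP => g; rewrite inE mem_conjg invgK /conjg mulgA.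
  case: (boolP (g \in U)) => gU; first by rewrite (ninvU_conj s gU).
  by apply/esym/negbTE; apply: contra gU; apply/subsetP/pat_sub_unitri.
rewrite card_ninvU => /eqP; rewrite mulnAC eqn_pmul2r ?expn_gt0 ?q0 //.
by move/eqP.
Qed.

Lemma bcell_inj s t g : g \in bcell s -> g \in bcell t -> s = t.
Proof.
case/bcellP=> u [b [uU bB ->]] /bcellP[v [c [vU cB E]]].
have uv : (v^-1 * u)%g \in U by apply: gl_groupM => //; apply: gl_groupV.
by apply: (bruhat_disjoint uv); rewrite (mulg_shift E); apply: gl_groupM => //; apply: gl_groupV.
Qed.

Lemma bcell_parabolic P s g : B \subset P -> g \in bcell s -> (g \in P) = (pm s \in P).
Proof.
move=> BP /bcellP[u [b [uU bB ->]]].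
have uP : u \in P by rewrite (subsetP BP) // (subsetP (unitri_sub_borel F m)).
have bP : b \in P by rewrite (subsetP BP).
by rewrite (gl_groupMr _ bP) (gl_groupMl _ uP).
Qed.

Lemma card_parabolic P : B \subset P ->
  #|P| = (\sum_(s | pm s \in P) q ^ inv_count s * #|B|)%N.
Proof.
move=> BP; rewrite -sum1_card.
transitivity (\sum_(g in P) \sum_s (g \in bcell s : nat))%N.
  apply: eq_bigr => g _; have [u [s [b [uU bB gE]]]] := bruhatP g.
  have gs : g \in bcell s by apply/bcellP; exists u, b.
  rewrite (bigD1 s) //= gs big1 // => t ts; apply/eqP; rewrite eqb0.
  by apply: contra ts => gt; rewrite (bcell_inj gt gs).
rewrite exchange_big [RHS]big_mkcond /=; apply: eq_bigr => s _.
rewrite -card_bcell -sum1_card big_mkcond [in RHS]big_mkcond /=.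
case: ifP => sP; last first.
  rewrite big1 // => g _; case: ifP => // gP; apply/eqP; rewrite eqb0.
  by apply/negP => gs; rewrite (bcell_parabolic BP gs) sP in gP.
apply: eq_bigr => g _; case: (boolP (g \in bcell s)) => gs.
  by rewrite (bcell_parabolic BP gs) sP.
by case: ifP.
Qed.

Lemma index_parabolic P : B \subset P ->
  #|P : B|%g = (\sum_(s | pm s \in P) q ^ inv_count s)%N.
Proof.
move=> BP; have := Lagrange (G := P) (H := borel_group F m) BP.
rewrite (card_parabolic BP) -big_distrl mulnC /= => /eqP.
by rewrite eqn_pmul2r ?cardG_gt0 // => /eqP.
Qed.

Lemma index_borel : #|'GL_m.+1[F] : B|%g = qfact q m.+1.
Proof.
rewrite (@index_parabolic (GLgroup_group m.+1 F)) ?subsetT //.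
by rewrite -inv_sum; apply: eq_bigl => s; rewrite inE.
Qed.

(** A descent makes the lower elementary matrix at k conjugate under [pm s] to
    an element of U. So it lies in P, and the rank one identity [ys_levi]
    gives the reflection. *)
Lemma sref_parabolic P k s : B \subset P -> pm s \in P ->
  (s (hi k) < s (lo k))%N -> pm (sref k) \in P.
Proof.
move=> BP sP sk; have UP : U \subset P := subset_trans (unitri_sub_borel F m) BP.
have hl : hi k != lo k by rewrite eq_sym lo_neq_hi.
have yP : ys k 1 \in P.
  have -> : ys k 1 = (pm s * elm (s (hi k)) (s (lo k)) (1%R : F) * pm s^-1)%g.
    apply: entP => r c; rewrite ent_conj !ent_elm ?(inj_eq perm_inj) //.
  rewrite -pmV; apply: gl_groupM (gl_groupV sP); apply: (gl_groupM sP); apply: (subsetP UP).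
  apply/unitriP => i j ji; rewrite ent_elm ?(inj_eq perm_inj) //.
  case: (boolP ((i == s (hi k)) && (j == s (lo k)))) => [/andP[/eqP iE /eqP jE]|_].
    by move: ji; rewrite iE jE; lia.
  by rewrite mulr0 addr0.
have tP : (pm (sref k) * (xs k (- 1^-1)%R * ys k 1%R))%g \in P.
  have y1 := @ys_levi F m k 1 (oner_neq0 _).
  by apply: (subsetP BP); apply: levi_borel y1.
have xP : (xs k (- 1^-1)%R * ys k 1%R)%g \in P.
  by apply: gl_groupM yP; apply: (subsetP UP); apply: xs_unitri.
by rewrite -(gl_groupMr _ xP).
Qed.

(** A standard parabolic subgroup is the union of the Bruhat cells of its
    permutations, and such a permutation is a product of simple reflections in
    the subgroup, by [sref_parabolic] along descents. *)
Lemma parabolic_sub P Q : B \subset P -> B \subset Q ->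
  (forall k, pm (sref k) \in P -> pm (sref k) \in Q) -> P \subset Q.
Proof.
move=> BP BQ PQ; apply/subsetP => g; have [u [s [b [uU bB gE]]]] := bruhatP g.
have gs : g \in bcell s by apply/bcellP; exists u, b.
rewrite (bcell_parabolic BP gs) (bcell_parabolic BQ gs) {gE gs}.
elim/perm_desc_ind: s => [|s k sk IH] sP; first by rewrite pm1 group1.
have kP := sref_parabolic BP sP sk.
have -> : pm s = (pm (sref k) * pm (sref k * s))%g.
  by rewrite pmM mulgA sref_invol mul1g.
by rewrite gl_groupM ?PQ // IH // -pmM gl_groupM.
Qed.

Lemma sref_lt k i (d : nat) : d != k.+1 -> (sref k i < d)%N = (i < d)%N.
Proof.
move=> dk; rewrite /sref; have := val_hi k; have := val_lo k.
by case: tpermP => [->|->|//]; lia.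
Qed.

Lemma perm_parabolic P (b : seq nat) : B \subset P ->
  (forall k, bdry b k.+1 = (pm (sref k) \notin P)) ->
  forall s, (pm s \in P) = pres_in (bdry b) s.
Proof.
move=> BP bP s; apply/idP/idP.
  elim/perm_desc_ind: s => [_|s k sk IH sP].
    by apply/pres_inP => i c _; rewrite perm1.
  have kP := sref_parabolic BP sP sk.
  have /IH/pres_inP h : pm (sref k * s) \in P by rewrite -pmM gl_groupM.
  apply/pres_inP => i c bc; have := h (sref k i) c bc.
  rewrite permM /sref tpermK => ->; apply: sref_lt.
  by apply: contraTneq bc => ->; rewrite bP kP.
elim/perm_desc_ind: s => [|s k sk IH] sP; first by rewrite pm1 group1.
have nb : ~~ bdry b k.+1.
  apply/negP => bk; have kn : (k.+1 < m.+1)%N by rewrite ltnS.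
  move/pres_inP: sP => /(_ _ (Ordinal kn) bk) /= h.
  have := h (lo k); have := h (hi k); rewrite val_hi ltnn val_lo ltnSn; lia.
have kP : pm (sref k) \in P by move: nb; rewrite bP negbK.
have -> : pm s = (pm (sref k) * pm (sref k * s))%g.
  by rewrite pmM mulgA sref_invol mul1g.
rewrite gl_groupM // IH //; apply/pres_inP => i c bc; rewrite permM.
move/pres_inP: sP => ->//; apply: sref_lt.
by apply: contraNneq nb => <-.
Qed.

(** Counting the elements of the Bruhat cells gives the generating function of
    inversions on a Young subgroup. *)
Lemma parabolic_composition P : B \subset P ->
  exists2 b, composition m.+1 b & #|P : B|%g = (\prod_(x <- b) qfact q x)%N.
Proof.
move=> BP; pose D (c : nat) :=
  ~~ [exists k : 'I_m, (k.+1 == c) && (pm (sref k) \in P)].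
have [b bc bD] := composition_of_bdry D m.+1; exists b => //.
have bP k : bdry b k.+1 = (pm (sref k) \notin P).
  rewrite bD; last by have := ltn_ord k; lia.
  congr (~~ _); apply/existsP/idP => [[k' /andP[/eqP[/val_inj ->]]]|kP] //.
  by exists k; rewrite eqxx.
rewrite index_parabolic // -pres_sum_block; case/andP: bc => _ /eqP ->.
by apply: eq_bigl => s; rewrite (perm_parabolic BP bP).
Qed.

Lemma bdry_nseq (x y c : nat) :
  (0 < x)%N -> bdry (nseq y x) c = ((x %| c) && (c <= y * x))%N.
Proof.
move=> x0; elim: y c => [|y IH] c /=.
  by rewrite mul0n leqn0; case: eqP => [->|]; rewrite ?dvdn0 ?andbF.
rewrite IH; case: (posnP c) => [->|c0]; first by rewrite dvdn0.
case: (leqP x c) => xc /=.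
  by rewrite (dvdn_subl xc (dvdnn x)) leq_subLR mulSn.
by rewrite gtnNdvd.
Qed.

Variables (e a : nat).
Hypotheses (e_gt1 : (1 < e)%N) (ean : (e * a <= m.+1)%N).
Local Notation bi := (block_index m.+1 e a).

Lemma bdry_e_blocks (c : nat) : (0 < c < m.+1)%N ->
  bdry (e_blocks m.+1 e a) c = (bi c.-1 != bi c).
Proof.
move=> /andP[c0 cm]; rewrite /e_blocks /block_index; set w := (m.+1 - e * a)%N.
have e0 : (0 < e)%N by lia.
case: (leqP c w) => cw.
  rewrite bdry_catl ?sumn_nseq ?mul1n // bdry_nseq // dvd1n muln1 cw.
  have c1 : (c.-1 < w)%N by lia.
  rewrite c1; case: (ltnP c w) => cw'; first by lia.
  have cE : c = w by lia.
  by rewrite cE subnn div0n addn0; lia.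
have -> : (c.-1 < w)%N = false by lia.
have -> : (c < w)%N = false by lia.
have {1}-> : c = (sumn (nseq w 1) + (c - w))%N by rewrite sumn_nseq mul1n; lia.
rewrite bdry_cat bdry_nseq //.
have -> : (c - w <= a * e)%N by rewrite /w in cw *; lia.
rewrite andbT eqn_add2l; have -> : (c.-1 - w = (c - w).-1)%N by lia.
have : (0 < c - w)%N by lia.
case: (c - w)%N => // f _ /=; rewrite divnS //.
by case: (e %| f.+1)%N; rewrite ?add0n ?eqxx // add1n; lia.
Qed.

Lemma block_index_mono (i j : nat) : (i <= j)%N -> (bi i <= bi j)%N.
Proof.
rewrite /block_index => ij; set w := (m.+1 - e * a)%N.
case: (ltnP i w) => iw; case: (ltnP j w) => jw //; last first.
- by rewrite leq_add2l leq_div2r // leq_sub2r.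
- by have := leq_ltn_trans ij jw; rewrite ltnNge iw.
by apply: leq_trans (leq_addr _ _); apply: ltnW.
Qed.

Lemma block_parabolicP g :
  reflect (forall i j : I, ~~ (bi i <= bi j)%N -> ent g i j = 0)
          (g \in block_parabolic F m.+1 e a).
Proof.
rewrite inE; apply: (iffP forallP) => [h i j|h i].
  by rewrite -ltnNge => ji; have /forallP/(_ j) := h i; rewrite ji => /eqP.
by apply/forallP => j; apply/implyP => ji; apply/eqP; apply: h; rewrite -ltnNge.
Qed.

Lemma block_parabolic_group_set : group_set (block_parabolic F m.+1 e a).
Proof.
apply: (@block_group_set F m (fun i j => bi i <= bi j)%N) => // [i j r|g].
  exact: leq_trans.
exact: block_parabolicP.
Qed.

Lemma borel_sub_block_parabolic : B \subset block_parabolic F m.+1 e a.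
Proof.
apply/subsetP => g /borelP gB; apply/block_parabolicP => i j nij; apply: gB.
by rewrite ltnNge; apply: contra nij => /block_index_mono.
Qed.

Lemma sref_block_parabolic k :
  (pm (sref k) \in block_parabolic F m.+1 e a) = ~~ bdry (e_blocks m.+1 e a) k.+1.
Proof.
rewrite bdry_e_blocks ?ltnS ?ltn_ord // negbK /=.
apply/block_parabolicP/eqP => [h|E i j nij].
  apply/eqP; rewrite eqn_leq block_index_mono //=; apply: contraT => nle.
  have := h (hi k) (lo k); rewrite val_hi val_lo ent_pm /sref tpermR eqxx => /(_ nle)/eqP.
  by rewrite oner_eq0.
rewrite ent_pm; case: eqP nij => // <-; rewrite /sref -ltnNge.
have vh := val_hi k; have vl := val_lo k.
by case: tpermP => [->|->|_ _]; rewrite ?vh ?vl ?E ltnn.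
Qed.

Lemma block_parabolic_gen (S : {set G}) :
  (forall g, g \in S -> exists2 k : 'I_m, ~~ bdry (e_blocks m.+1 e a) k.+1 & g = pm (sref k)) ->
  (forall k : 'I_m, ~~ bdry (e_blocks m.+1 e a) k.+1 -> pm (sref k) \in S) ->
  (<<B :|: S>>)%g = block_parabolic F m.+1 e a.
Proof.
move=> S1 S2; pose P := Group block_parabolic_group_set.
apply/eqP; rewrite eqEsubset; apply/andP; split.
  rewrite (gen_subG _ P) subUset borel_sub_block_parabolic.
  by apply/subsetP => g /S1[k nk ->]; rewrite /= sref_block_parabolic.
apply: (@parabolic_sub P (<<B :|: S>>)%G) => [||k].
- exact: borel_sub_block_parabolic.
- by rewrite /= sub_gen ?subsetUl.
by rewrite /= sref_block_parabolic => /S2 kS; rewrite mem_gen // inE kS orbT.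
Qed.

End Parabolics.

(** * Functions on the group *)

Lemma sum_natr_pred1 (T : finType) (R : pzRingType) (P : pred T) (t0 : T) (f : T -> R) :
  P t0 -> (forall t, P t -> t != t0 -> f t = 0) -> \sum_(t | P t) f t = f t0.
Proof. by move=> Pt0 f0; rewrite (bigD1 t0) //= big1 ?addr0 // => t /andP[]; apply: f0. Qed.

Section SteinbergFunctions.
Variables (F : finFieldType) (m : nat) (R : idomainType).
Local Notation G := {'GL_m.+1[F]}.
Local Notation I := 'I_m.+1.
Local Notation RG := (galg R G).
Local Notation B := (borel F m.+1).
Local Notation Bm := (lowtri F m).
Local Notation pm := (pm F).
Local Notation xs := (@xs F m).
Local Notation w0 := (w0 m).
Local Notation eps := (steinberg_elt F m.+1 R).
Implicit Types (g h u v : G) (i j r c : I) (k : 'I_m) (s t : {perm I}) (x y : RG).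

Lemma galgM x y g : (x * y) g = \sum_h x h * y (h^-1 * g)%g.
Proof. by rewrite ffunE. Qed.

Lemma galg_ofE (h g : G) : galg_of R h g = (g == h)%:R.
Proof. by rewrite ffunE. Qed.

Lemma galg_ofM h y g : (galg_of R h * y) g = y (h^-1 * g)%g.
Proof.
rewrite galgM (sum_natr_pred1 (t0 := h)) // => [|t _ th]; rewrite galg_ofE.
  by rewrite eqxx mul1r.
by rewrite (negbTE th) mul0r.
Qed.

Lemma galg_of_mul g h : galg_of R g * galg_of R h = galg_of R (g * h)%g.
Proof.
by apply/ffunP => t; rewrite galg_ofM !galg_ofE -(inj_eq (mulgI g)) mulKVg.
Qed.

Lemma galg_sumE (T : finType) (P : pred T) (f : T -> RG) g :
  (\sum_(t | P t) f t) g = \sum_(t | P t) f t g.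
Proof. by rewrite sum_ffunE. Qed.

Lemma galg_hatE (A : {set G}) g : galg_hat R A g = (g \in A)%:R.
Proof.
rewrite /galg_hat galg_sumE; case: (boolP (g \in A)) => gA.
  rewrite (sum_natr_pred1 (t0 := g)) // => [|t _ tg]; rewrite galg_ofE ?eqxx //.
  by rewrite eq_sym (negbTE tg).
rewrite big1 // => t tA; rewrite galg_ofE; case: eqP => // gt.
by rewrite gt tA in gA.
Qed.

Definition sg s : R := (-1) ^+ odd_perm s.

Lemma sgM s t : sg (s * t)%g = sg s * sg t.
Proof. by rewrite /sg odd_permM signr_addb. Qed.

Lemma sg_sq s : sg s * sg s = 1.
Proof. by rewrite /sg -signr_addb addbb. Qed.

Lemma sg_sref k : sg (sref k) = -1.
Proof. by rewrite /sg odd_tperm lo_neq_hi. Qed.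

Lemma epsE g : eps g = \sum_s sg s * (((pm s)^-1 * g)%g \in B)%:R.
Proof.
rewrite /steinberg_elt galg_sumE; apply: eq_bigr => s _.
by rewrite ffunE galg_ofM galg_hatE.
Qed.

Lemma w0K i : w0 (w0 i) = i.
Proof. by rewrite -permM w0_invol perm1. Qed.

Lemma pm_w0J g : ((pm w0 * g * pm w0)%g \in B) = (g \in Bm).
Proof.
have E : (pm w0 * g * pm w0 = pm w0 * g * pm w0^-1)%g by rewrite w0V.
apply/borelP/lowtriP => h i j ij.
  by have := h (w0 i) (w0 j); rewrite E ent_conj ltn_w0 !w0K => /(_ ij).
by rewrite E ent_conj h // ltn_w0.
Qed.

Lemma eps_w0E g : eps (g * pm w0)%g =
  sg w0 * \sum_s sg s * (((pm s)^-1 * g)%g \in Bm)%:R.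
Proof.
rewrite epsE mulr_sumr (reindex_inj (mulIg w0)) /=; apply: eq_bigr => s _.
rewrite sgM mulrA [sg w0 * _]mulrC; congr (_ * _%:R).
by rewrite -pmM invMg (pmV F w0) w0V -pm_w0J !mulgA.
Qed.

Lemma lowtri_diag g i : g \in Bm -> ent g i i != 0.
Proof.
rewrite -pm_w0J => /(borel_diag (w0 i)).
by have := ent_conj w0 g (w0 i) (w0 i); rewrite w0V !w0K => ->.
Qed.

(** The properties of the elements of the Steinberg lattice from which
    multiplicity one and the action of permutations follow: right invariance
    under B, and the relations by which the Hecke algebra acts through its
    sign character. Both are translated by the longest permutation, which
    turns B into the lower triangular group. *)
Definition steinberg_like y :=
  (forall g b, b \in Bm -> y (g * b * pm w0)%g = y (g * pm w0)%g) /\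
  (forall g k, \sum_a y (g * xs k a * pm w0)%g = - y (g * pm (sref k) * pm w0)%g).

Lemma st_mul a y : steinberg_like y -> steinberg_like (a * y).
Proof.
move=> [y1 y2]; split=> [g b bB|g k].
  rewrite !galgM; apply: eq_bigr => h _; congr (_ * _).
  by rewrite !mulgA y1.
under eq_bigr do rewrite galgM; rewrite exchange_big galgM -sumrN.
apply: eq_bigr => h _ /=; rewrite -mulr_sumr -mulrN; congr (_ * _).
by rewrite !mulgA -y2; apply: eq_bigr => b _; rewrite !mulgA.
Qed.

Lemma st_scale a y : steinberg_like y -> steinberg_like (a *: y).
Proof.
move=> [y1 y2]; split=> [g b bB|g k]; first by rewrite !ffunE y1.
under eq_bigr do rewrite ffunE; rewrite ffunE -scaler_sumr y2.
exact: mulrN.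
Qed.

Lemma st_sub x y : steinberg_like x -> steinberg_like y -> steinberg_like (x - y).
Proof.
move=> [x1 x2] [y1 y2]; split=> [g b bB|g k]; first by rewrite !ffunE x1 ?y1.
under eq_bigr do rewrite !ffunE.
by rewrite !ffunE big_split /= sumrN x2 y2 opprD.
Qed.

(** The minimal parabolic subgroup at [k] above the lower triangular group. *)
Definition lowpar k g := [forall i : I, forall j : I,
  ((i < j)%N && ((i, j) != (lo k, hi k))) ==> (ent g i j == 0)].

Lemma lowparP k g : reflect (forall i j, (i < j)%N -> (i, j) != (lo k, hi k) -> ent g i j = 0)
  (lowpar k g).
Proof.
apply: (iffP forallP) => [h i j ij ne|h i].
  by have /forallP/(_ j) := h i; rewrite ij ne => /eqP.
apply/forallP => j; apply/implyP => /andP[ij ne]; apply/eqP; exact: h.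
Qed.

(** Let (w, x) be the entries of row k of g in the columns k and k + 1. If w
    <> 0 then exactly one column operation kills x; if w = 0 then x <> 0, no
    column operation kills it, and exchanging the columns does. *)
Lemma lowpar_sum k g :
  (\sum_a ((g * xs k a)%g \in Bm)%:R + ((g * pm (sref k))%g \in Bm)%:R = (lowpar k g)%:R :> R).
Proof.
set x := ent g (lo k) (hi k); set w := ent g (lo k) (lo k).
have lh := lo_neq_hi k.
have xsB a : ((g * xs k a)%g \in Bm) = lowpar k g && (x + w * a == 0).
  apply/lowtriP/andP => [h|[/lowparP h /eqP xw] i j ij].
    split; last by have := h _ _ (lt_lo_hi k); rewrite ent_xsR eqxx mul1r => /eqP.
    apply/lowparP => i j ij ne; have := h i j ij; rewrite ent_xsR.
    case: eqP => [jE|_]; last by rewrite mul0r addr0.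
    have il : (i < lo k)%N.
      rewrite ltn_neqAle; move: ij ne; rewrite jE val_hi ltnS => ->.
      by rewrite xpair_eqE eqxx !andbT -val_eqE.
    by move: (h _ _ il); rewrite ent_xsR (negbTE lh) mul0r addr0 => ->; rewrite mul0r mulr0 addr0.
  rewrite ent_xsR; case: eqP => [jE|/eqP jE]; last first.
    by rewrite mul0r addr0 h // xpair_eqE negb_and jE orbT.
  rewrite mul1r jE; case: (eqVneq i (lo k)) => [->|il]; first exact: xw.
  rewrite !h ?mul0r ?addr0 ?xpair_eqE ?negb_and ?il //; last by rewrite -jE.
  by move: ij il; rewrite jE -val_eqE val_hi ltnS /= => ij il; rewrite ltn_neqAle il.
have srB : ((g * pm (sref k))%g \in Bm) = lowpar k g && (w == 0).
  apply/lowtriP/andP => [h|[/lowparP h /eqP w00] i j ij].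
    split; last by have := h _ _ (lt_lo_hi k); rewrite ent_pmR /sref tpermV tpermR => /eqP.
    apply/lowparP => i j ij ne.
    have := h i (sref k j); rewrite ent_pmR /sref tpermV tpermK; apply.
    case: tpermP => [jE|jE|_ _] //.
      by rewrite jE in ij; apply: ltn_trans ij (lt_lo_hi k).
    move: ij ne; rewrite jE val_hi ltnS xpair_eqE eqxx andbT -val_eqE => ij ne.
    by rewrite ltn_neqAle ne.
  rewrite ent_pmR /sref tpermV; case: tpermP => [jE|jE|/eqP j1 /eqP j2].
  - rewrite h ?xpair_eqE ?eqxx ?andbT //.
      by rewrite jE in ij; apply: ltn_trans ij (lt_lo_hi k).
    by apply: contraTneq ij => ->; rewrite jE ltnn.
  - case: (eqVneq i (lo k)) => [->|il]; first exact: w00.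
    rewrite h ?xpair_eqE ?negb_and ?il //.
    by move: ij il; rewrite jE -val_eqE val_hi ltnS /= => ij il; rewrite ltn_neqAle il.
  by rewrite h ?xpair_eqE // negb_and j2 orbT.
rewrite srB; under eq_bigr do rewrite xsB.
case lg: (lowpar k g) => /=; last by rewrite big1 ?addr0.
have xw : w = 0 -> x != 0.
  move=> w00; have : (g * pm (sref k))%g \in Bm by rewrite srB lg w00 eqxx.
  by move=> /(lowtri_diag (lo k)); rewrite ent_pmR /sref tpermV tpermL.
case: (eqVneq w 0) => [w00|w00].
  rewrite big1 ?add0r // => a _; rewrite w00 mul0r addr0.
  by rewrite (negbTE (xw w00)).
rewrite addr0 (sum_natr_pred1 (t0 := - x / w)) // => [|a _ aw].
  by rewrite mulrC divfK // subrr eqxx.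
have : a != - x / w by [].
rewrite eq_sym -(inj_eq (mulIf w00)) divfK // => ne.
rewrite addrC addr_eq0 mulrC; case: eqP => // h; by rewrite h eqxx in ne.
Qed.
End SteinbergFunctions.

Lemma mulg_involK (gT : groupType) (x b : gT) : (x * x = 1)%g ->
  (x * (x * b * x) * x = b)%g.
Proof. by move=> x2; rewrite !mulgA x2 mul1g -mulgA x2 mulg1. Qed.

Lemma mulg_invol_shift (gT : groupType) (g x b : gT) : (x * x = 1)%g ->
  (g * x * (x * b * x) * x = g * b)%g.
Proof. by move=> x2; rewrite -!mulgA x2 mulg1 [(x * (x * _))%g]mulgA x2 mul1g. Qed.

Definition galg_dot (R : comNzRingType) (gT : finGroupType) (x y : galg R gT) : R :=
  \sum_g (x g : R) * (y g : R).

Lemma galg_dot_adj (R : comNzRingType) (gT : finGroupType) (a x y : galg R gT) :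
  galg_dot (a * x) y = galg_dot x (([ffun g => a g^-1%g] : galg R gT) * y).
Proof.
have mulE (u v : galg R gT) g : (u * v) g = \sum_h u h * v (h^-1 * g)%g by rewrite ffunE.
rewrite /galg_dot; under eq_bigr do rewrite mulE mulr_suml.
under [RHS]eq_bigr do rewrite mulE mulr_sumr.
rewrite exchange_big /= [RHS]exchange_big /=.
rewrite [RHS](reindex_inj invg_inj) /=; apply: eq_bigr => h _.
rewrite (reindex_inj (mulgI h)) /=; apply: eq_bigr => k _.
by rewrite ffunE invgK mulKg mulrCA mulrA.
Qed.

(** * Hecke relations and multiplicity one *)

Section SteinbergLattice.
Variables (F : finFieldType) (m : nat) (R : idomainType).
Hypothesis R_char0 : [pchar R] =i pred0.
Local Notation G := {'GL_m.+1[F]}.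
Local Notation I := 'I_m.+1.
Local Notation RG := (galg R G).
Local Notation B := (borel F m.+1).
Local Notation U := (unitri F m.+1).
Local Notation Bm := (lowtri F m).
Local Notation pm := (pm F).
Local Notation xs := (@xs F m).
Local Notation w0 := (w0 m).
Local Notation eps := (steinberg_elt F m.+1 R).
Local Notation sg := (sg R).
Local Notation fm := galg_dot.
Implicit Types (g h u v : G) (i j r c : I) (k : 'I_m) (s t : {perm I}) (x y : RG).

Lemma pm_w0_invol : (pm w0 * pm w0 = 1)%g.
Proof. by rewrite pmM w0_invol pm1. Qed.

Lemma lowpar_sref k g : lowpar k (pm (sref k) * g)%g = lowpar k g.
Proof.
have imp h : lowpar k h -> lowpar k (pm (sref k) * h)%g.
  move/lowparP => hP; apply/lowparP => i j ij ne; rewrite ent_pmL /sref.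
  case: tpermP => [iE|iE|_ _]; last exact: hP.
    apply: hP; last by rewrite xpair_eqE [hi k == _]eq_sym (negbTE (lo_neq_hi k)).
    rewrite ltn_neqAle val_hi; move: ij ne; rewrite iE val_lo xpair_eqE eqxx /= => -> ne.
    by rewrite andbT; apply: contra ne => /eqP ne; apply/eqP/val_inj; rewrite /= -ne -val_hi.
  apply: hP; first by apply: ltn_trans (lt_lo_hi k) _; rewrite -iE.
  rewrite xpair_eqE eqxx /=; apply: contraTneq ij => ->.
  by rewrite iE ltnn.
apply/idP/idP; last exact: imp.
by move/imp; rewrite mulgA pm_srefK mul1g.
Qed.

Lemma pm_mulsrefV s k : ((pm (s * sref k))^-1 = pm (sref k) * (pm s)^-1)%g.
Proof. by rewrite -pmM invMg (pmV F (sref k)) /sref tpermV. Qed.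

(** By [lowpar_sum] the two sides of the Hecke relation differ by an
    alternating sum of indicator functions of cosets of a minimal parabolic
    subgroup. The terms for s and s * sref k are opposite. *)
Lemma st_eps : steinberg_like eps.
Proof.
split=> [g b bB|g k].
  rewrite !eps_w0E; congr (_ * _); apply: eq_bigr => s _; congr (_ * _%:R).
  by rewrite mulgA (gl_groupMr (P := lowtri_group F m)).
under eq_bigr do rewrite eps_w0E.
rewrite eps_w0E -mulr_sumr -mulrN; congr (_ * _).
rewrite exchange_big /= -sumrN.
pose f s : R := sg s * (lowpar k ((pm s)^-1 * g)%g)%:R.
have -> : \sum_s \sum_a sg s * (((pm s)^-1 * (g * xs k a))%g \in Bm)%:R =
    \sum_s f s + \sum_s - (sg s * (((pm s)^-1 * (g * pm (sref k)))%g \in Bm)%:R) :> R.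
  rewrite -big_split; apply: eq_bigr => s _ /=.
  rewrite -mulr_sumr /f -(lowpar_sum R k) mulrDr !mulgA addrK.
  by congr (_ * _); apply: eq_bigr => a _; rewrite mulgA.
rewrite (_ : \sum_s f s = 0) ?add0r //.
have : \sum_s f s = - \sum_s f s.
  rewrite {1}(reindex_inj (mulIg (sref k))) /= -sumrN; apply: eq_bigr => s _.
  by rewrite /f sgM sg_sref mulrN1 mulNr pm_mulsrefV -mulgA lowpar_sref.
move/eqP; rewrite -addr_eq0 -mulr2n -mulr_natr mulf_eq0 => /orP[/eqP//|].
by move/pcharf0P: R_char0 => ->.
Qed.

Lemma st_borel y g b : steinberg_like y -> b \in B -> y (g * b)%g = y g.
Proof.
move=> [y1 _] bB; have bm : (pm w0 * b * pm w0)%g \in Bm.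
  by rewrite -pm_w0J mulg_involK // pm_w0_invol.
have := y1 (g * pm w0)%g _ bm.
by rewrite mulg_invol_shift ?pm_w0_invol // -mulgA pm_w0_invol mulg1.
Qed.

Lemma xs_conj k a s : (s (lo k) < s (hi k))%N -> ((pm s)^-1 * xs k a * pm s)%g \in U.
Proof.
move=> sk; rewrite pmV -{2}[s]invgK; apply/unitriP => i j ji; rewrite ent_conj ent_xs.
rewrite (inj_eq perm_inj); case: andP => [[/eqP E1 /eqP E2]|_]; last by rewrite mulr0 addr0.
by move: sk; rewrite -E1 -E2 !permKV ltnNge ji.
Qed.

(** The Hecke relation propagates the vanishing from the big cell to all
    cells, along descents. *)
Lemma st_big y : steinberg_like y -> (forall u, u \in U -> y (u * pm w0)%g = 0) -> y = 0.
Proof.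
move=> sty y0.
have all0 s : forall u, u \in U -> y (u * pm s^-1 * pm w0)%g = 0.
  elim/perm_desc_ind: s => [|s k sk IH] u uU.
    by rewrite invg1 pm1 mulg1 y0.
  have [_ /(_ (u * pm s^-1 * pm (sref k))%g k)] := sty.
  rewrite -[(u * _ * _ * pm (sref k))%g]mulgA pm_srefK mulg1 => /eqP.
  rewrite eq_sym eqr_oppLR => /eqP ->.
  rewrite big1 ?oppr0 // => a _.
  have rk : ((sref k * s)%g (lo k) < (sref k * s)%g (hi k))%N.
    by rewrite !permM /sref tpermL tpermR.
  have E : (u * pm s^-1 * pm (sref k) * xs k a =
      u * ((pm (sref k * s))^-1 * xs k a * pm (sref k * s)) * pm (sref k * s)^-1)%g.
    rewrite pmV -(pmV F (sref k * s)) !mulgA mulgK pmV invMg.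
    by rewrite -pmM !mulgA; congr (_ * _ * _)%g; rewrite /sref tpermV.
  by rewrite E IH // gl_groupM // xs_conj.
apply/ffunP => g; rewrite ffunE; have [u [s [b [uU bB ->]]]] := bruhatP g.
rewrite st_borel //.
have -> : (u * pm s = u * pm (w0^-1 * s^-1)^-1 * pm w0)%g.
  by rewrite invMg !invgK -mulgA pmM -mulgA w0_invol mulg1.
exact: all0.
Qed.

Lemma invU1 : invU F (1 : {perm I}) = 1%g.
Proof.
apply/setP => g; apply/idP/set1P => [/patP h|->]; last first.
  by apply/patP => i j _; apply: ent1.
apply: entP => i j; rewrite ent1; apply: h; rewrite /invr !perm1.
by apply/negP => /andP[ij]; rewrite ltnNge (ltnW ij).
Qed.

(** One application of the Hecke relation, and so one sign, for each step of a
    reduced expression of [s]. *)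
Lemma st_key y s : steinberg_like y -> exists b : bool, forall g,
  \sum_(x in invU F s) y (g * x * pm w0)%g = (-1) ^+ b * y (g * pm s * pm w0)%g.
Proof.
move=> sty; elim/perm_desc_ind: s => [|s k sk [b IH]].
  by exists false => g; rewrite invU1 big_set1 mul1r pm1.
exists (~~ b) => g; rewrite (sum_invr_desc _ sk).
under eq_bigr => x _.
  under eq_bigr => a _ do rewrite mulgA.
  have [_ ->] := sty; rewrite -!mulgA [(pm (sref k) * (pm (sref k) * _))%g]mulgA.
  by rewrite pm_srefK mul1g; over.
rewrite sumrN.
under eq_bigr => x _ do rewrite mulgA mulgA.
rewrite IH signrN mulNr; congr (- (_ * y (_ * _)%g)).
by rewrite -mulgA pmM mulgA sref_invol mul1g.
Qed.

Lemma galg_subE x y g : (x - y) g = x g - y g.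
Proof. by rewrite !ffunE. Qed.

Lemma galg_scaleE a x g : (a *: x) g = a * x g.
Proof. by rewrite ffunE. Qed.

Definition char_sum (lam : G -> R) : RG := \sum_(u in U) lam u *: galg_of R u.

Lemma char_sumM lam y g : (char_sum lam * y) g = \sum_(u in U) lam u * y (u^-1 * g)%g.
Proof.
rewrite /char_sum mulr_suml galg_sumE; apply: eq_bigr => u _.
by rewrite -scalerAl ffunE galg_ofM.
Qed.

Lemma char_sumE lam g : char_sum lam g = if g \in U then lam g else 0.
Proof.
rewrite /char_sum galg_sumE; case: ifP => gU.
  rewrite (sum_natr_pred1 (t0 := g)) // => [|u _ ug]; rewrite ffunE galg_ofE.
    by rewrite eqxx; apply: mulr1.
  by rewrite eq_sym (negbTE ug); apply: mulr0.
rewrite big1 // => u uU; rewrite ffunE galg_ofE; case: eqP => [gu|_]; last exact: mulr0.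
by rewrite gu uU in gU.
Qed.

Lemma sum_unitri_mul (f : G -> R) u : u \in U ->
  \sum_(v in U) f (u * v)%g = \sum_(v in U) f v.
Proof.
move=> uU; rewrite [RHS](reindex_inj (mulgI u)) /=.
by apply: eq_bigl => v; rewrite (gl_groupMl (P := unitri_group F m)).
Qed.

Lemma char_sum_shift lam y u g : unitri_char lam -> u \in U ->
  (char_sum lam * y) (u * g)%g = lam u * (char_sum lam * y) g.
Proof.
move=> [_ lamM] uU; rewrite !char_sumM.
rewrite -(sum_unitri_mul (fun v => lam v * y (v^-1 * (u * g))%g) uU) mulr_sumr.
apply: eq_bigr => v vU; rewrite lamM // mulrA; congr (_ * y _).
by rewrite invMg -mulgA mulKg.
Qed.

Lemma unitri_char1 lam : @unitri_char F m.+1 R lam -> lam 1%g = 1.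
Proof.
move=> [lamU lamM]; have U1 := group1 (unitri_group F m).
apply: (mulfI (x := lam 1%g)); last by rewrite mulr1 -lamM ?mulg1.
by have := lamU 1%g U1; apply: contraTneq => ->; rewrite unitr0.
Qed.

Lemma char_sum_scale lam y : unitri_char lam ->
  (forall u g, u \in U -> y (u * g)%g = lam u * y g) ->
  char_sum lam * y = #|U|%:R *: y.
Proof.
move=> lamP yU; apply/ffunP => g; rewrite char_sumM galg_scaleE.
rewrite (eq_bigr (fun=> y g)); first by rewrite sumr_const; apply/esym/mulr_natl.
move=> u uU; have uV : (u^-1)%g \in U by apply: (gl_groupV (P := unitri_group F m)).
have [_ lamM] := lamP.
by rewrite yU // mulrA -lamM // mulgV unitri_char1 // mul1r.
Qed.

Lemma char_sum_eps_pm lam t :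
  (char_sum lam * eps) (pm t) = sg t * \sum_(u in ninvU F t) lam u.
Proof.
rewrite char_sumM mulr_sumr [RHS]big_mkcond [LHS]big_mkcond /=; apply: eq_bigr => u _.
case: (boolP (u \in U)) => uU; last first.
  by case: ifP => // uN; rewrite (subsetP (pat_sub_unitri F (ninvr t))) in uU.
have uV : (u^-1)%g \in U by apply: (gl_groupV (P := unitri_group F m)).
rewrite epsE (sum_natr_pred1 (t0 := t)) // => [|s _ st].
  rewrite mulgA (ninvU_conj _ uV).
  have -> : ((u^-1)%g \in ninvU F t) = (u \in ninvU F t).
    by apply/idP/idP => /(gl_groupV (P := ninvU_group F t)); rewrite ?invgK.
  by case: ifP => _; rewrite ?mulr1 ?mulr0 // mulrC.
rewrite mulgA; case: (boolP (_ \in B)) => [/(bruhat_disjoint uV) E|_]; last exact: mulr0.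
by rewrite E eqxx in st.
Qed.

Lemma ninvU_w0 : ninvU F w0 = 1%g.
Proof.
apply/setP => g; apply/idP/set1P => [/patP h|->]; last first.
  by apply/patP => i j _; apply: ent1.
apply: entP => i j; rewrite ent1; apply: h; rewrite /ninvr ltn_w0.
by apply/negP => /andP[ij]; rewrite ltnNge (ltnW ij).
Qed.

(** Multiplicity one: both sides transform under U by the same character and
    agree at the longest permutation, hence on the big cell, and [st_big]
    applies. *)
Lemma char_sum_line lam y : unitri_char lam -> steinberg_like y ->
  char_sum lam * y = (sg w0 * (char_sum lam * y) (pm w0)) *: (char_sum lam * eps).
Proof.
move=> lamP sty; apply/eqP; rewrite -subr_eq0; apply/eqP; apply: st_big.
  by apply: st_sub; [exact: st_mul|apply: st_scale; apply: st_mul; apply: st_eps].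
move=> u uU; rewrite galg_subE galg_scaleE !char_sum_shift // char_sum_eps_pm ninvU_w0.
rewrite big_set1 unitri_char1 // mulr1.
move: (sg w0) (sg_sq R w0) => a a2; move: ((_ * y) _ : R) (lam u) => b c.
have -> : a * b * (c * a) = a * a * (c * b) by ring.
by rewrite a2 mul1r subrr.
Qed.

Lemma dot_adj a x y : fm (a * x) y = fm x (galg_star a * y).
Proof. exact: galg_dot_adj. Qed.

Lemma dot_scaler a x y : fm x (a *: y) = a * fm x y.
Proof.
rewrite /galg_dot mulr_sumr; apply: eq_bigr => g _; rewrite galg_scaleE; ring.
Qed.

Lemma dot_addl x y z : fm (x + y) z = fm x z + fm y z.
Proof.
by rewrite /galg_dot -big_split; apply: eq_bigr => g _; rewrite /= ffunE mulrDl.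
Qed.

Definition inv_char (lam : G -> R) : G -> R := fun u => lam (u^-1)%g.

Lemma star_char_sum lam : galg_star (char_sum lam) = char_sum (inv_char lam).
Proof.
apply/ffunP => g; rewrite ffunE !char_sumE /inv_char.
by congr (if _ then _ else _); apply/idP/idP => /(gl_groupV (P := unitri_group F m));
  rewrite ?invgK.
Qed.

Lemma dot_eps y : steinberg_like y -> fm eps y = #|B|%:R * \sum_s sg s * y (pm s).
Proof.
move=> sty; rewrite /galg_dot; under eq_bigr do rewrite epsE mulr_suml.
rewrite exchange_big mulr_sumr; apply: eq_bigr => s _ /=.
rewrite (reindex_inj (mulgI (pm s))) /=.
rewrite (eq_bigr (fun g => if g \in B then sg s * y (pm s) else 0)) => [|g _].
  by rewrite -big_mkcond sumr_const; apply/esym/mulr_natl.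
by rewrite mulKg; case: ifP => gB; rewrite ?mulr1 ?mulr0 ?mul0r // st_borel.
Qed.

Definition char_norm (lam : G -> R) : R := \sum_s \sum_(u in ninvU F s) lam u.

(** By adjointness the product equals one with [eps] itself, which only
    involves values at permutation matrices. *)
Lemma dot_char_sum_eps lam y (a : R) : steinberg_like y ->
  char_sum (inv_char lam) * y = a *: (char_sum (inv_char lam) * eps) ->
  fm (char_sum lam * eps) y = #|B|%:R * char_norm (inv_char lam) * a.
Proof.
move=> sty E; rewrite dot_adj star_char_sum E dot_scaler dot_eps; last exact: st_mul st_eps.
rewrite mulrC; congr (_ * _ * _); apply: eq_bigr => s _.
by rewrite char_sum_eps_pm mulrA sg_sq mul1r.
Qed.

End SteinbergLattice.

(** * Linear characters of the unitriangular group *)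

Section LinearCharacters.
Variables (F : finFieldType) (m : nat) (R : idomainType).
Hypothesis R_char0 : [pchar R] =i pred0.
Variable psi : F -> R.
Hypotheses (psiD : forall a b, psi (a + b) = psi a * psi b) (psi0 : psi 0 = 1).
Hypothesis psi_nontriv : exists a, psi a != 1.
Local Notation G := {'GL_m.+1[F]}.
Local Notation I := 'I_m.+1.
Local Notation RG := (galg R G).
Local Notation U := (unitri F m.+1).
Local Notation pm := (pm F).
Local Notation xs := (@xs F m).
Local Notation q := #|F|.
Local Notation w0 := (w0 m).
Local Notation eps := (steinberg_elt F m.+1 R).
Local Notation sg := (sg R).
Implicit Types (g h u v : G) (i j : I) (k : 'I_m) (s t : {perm I}) (x y : RG).
Implicit Types (D : pred nat).

(** With [D] the boundaries of a composition, this character is psi on the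
    simple root subgroups inside the blocks and trivial on the others, so that
    its parabolic subgroup is the one with these blocks. *)
Definition linchar D g : R := psi (\sum_(k < m | ~~ D k.+1) ent g (lo k) (hi k)).

Lemma superdiagM k u v : u \in U -> v \in U ->
  ent (u * v)%g (lo k) (hi k) = ent u (lo k) (hi k) + ent v (lo k) (hi k).
Proof.
move=> /unitriP uU /unitriP vU; rewrite entM.
rewrite (bigD1 (lo k)) //= (bigD1 (hi k)) /= ?[hi k == _]eq_sym ?lo_neq_hi //.
rewrite (uU (lo k) (lo k)) // (vU (hi k) (hi k)) // !eqxx mul1r mulr1 addrC.
rewrite big1 ?addr0 // => r /andP[r1 r2].
case: (leqP r (lo k)) => rk; first by rewrite uU // eq_sym (negbTE r1) mul0r.
by rewrite (vU r (hi k)) ?(negbTE r2) ?mulr0.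
Qed.

Lemma linchar_mul D u v : u \in U -> v \in U -> linchar D (u * v)%g = linchar D u * linchar D v.
Proof.
move=> uU vU; rewrite /linchar -psiD -big_split; congr psi; apply: eq_bigr => k _.
exact: superdiagM.
Qed.

Lemma psi_unit a : psi a \is a GRing.unit.
Proof. by apply/unitrP; exists (psi (- a)); rewrite -!psiD addNr addrN psi0. Qed.

Lemma linchar_char D : @unitri_char F m.+1 R (linchar D).
Proof. by split=> [u _|u v uU vU]; [exact: psi_unit|exact: linchar_mul]. Qed.

Lemma linchar_xs D k a : linchar D (xs k a) = if D k.+1 then 1 else psi a.
Proof.
rewrite /linchar big_mkcond (bigD1 k) //= big1 ?addr0 => [|k' k'k].
  rewrite ent_xs (negbTE (lo_neq_hi k)) !eqxx add0r mulr1.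
  by case: (D k.+1); rewrite /= ?psi0.
case: ifP => // _; rewrite ent_xs (negbTE (lo_neq_hi _)) add0r.
case: eqP => [/(congr1 val) /= E|_]; last by rewrite mulr0.
by rewrite -val_eqE /= E eqxx in k'k.
Qed.

Lemma sum_char_eq0 (H : {group G}) (chi : G -> R) v : v \in H ->
  (forall u, u \in H -> chi (v * u)%g = chi v * chi u) -> chi v != 1 ->
  \sum_(u in H) chi u = 0.
Proof.
move=> vH chiM v1; set S := \sum_(u in H) chi u.
have : S = chi v * S.
  rewrite {1}/S (reindex_inj (mulgI v)) mulr_sumr /=.
  by apply: eq_big => [u|u]; rewrite gl_groupMl // => uH; apply: chiM.
move/eqP; rewrite -[X in X == _]mul1r -subr_eq0 -mulrBl mulf_eq0 subr_eq0 eq_sym.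
by rewrite (negbTE v1) => /eqP.
Qed.

(** The sum over [ninvU s] vanishes unless the character is trivial there,
    which means that s is decreasing inside the blocks. *)
Lemma char_norm_linchar D :
  char_norm (inv_char (linchar D)) = (dec_sum q D m.+1)%:R :> R.
Proof.
rewrite /char_norm /dec_sum natr_sum big_mkcond [RHS]big_mkcond /=.
apply: eq_bigr => s _.
have -> : \sum_(u in ninvU F s) inv_char (linchar D) u = \sum_(u in ninvU F s) linchar D u.
  rewrite (reindex_inj invg_inj) /=; apply: eq_big => [u|u _]; last by rewrite /inv_char invgK.
  by apply/idP/idP => /(gl_groupV (P := ninvU_group F s)); rewrite ?invgK.
case: (boolP (dec_in D s)) => [/dec_inP sD|nd].
  rewrite (eq_bigr (fun=> 1)) => [|u /patP uN].
    by rewrite sumr_const card_ninvU.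
  rewrite /linchar big1 // => k Dk; rewrite uN ?(negbTE (lo_neq_hi k)) //.
  have sk : (s (hi k) < s (lo k))%N by apply: sD; rewrite val_hi.
  by rewrite negb_and /ninvr -[X in _ || X]leqNgt (ltnW sk) orbT.
have [k [Dk sk]] : exists k : 'I_m, ~~ D k.+1 /\ (s (lo k) < s (hi k))%N.
  move: nd; rewrite negb_forall => /existsP[i]; rewrite negb_forall => /existsP[j].
  rewrite !negb_imply => /and3P[/eqP ji Dj]; rewrite -leqNgt => sij.
  have [k iE jE] := lo_hiP ji; exists k; rewrite -iE -jE; split.
    by move: Dj; rewrite jE val_hi.
  rewrite ltn_neqAle sij andbT; apply: contraTneq (lt_lo_hi k).
  by move=> /val_inj/perm_inj; rewrite -iE -jE => ->; rewrite ltnn.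
have [a psia] := psi_nontriv.
have xN : xs k a \in ninvU F s by apply: xs_pat.
apply: (sum_char_eq0 (H := ninvU_group F s) xN) => [u uN|].
  by apply: linchar_mul; [exact: xs_unitri|apply: subsetP uN; apply: pat_sub_unitri].
by rewrite linchar_xs (negbTE Dk).
Qed.

(** Let [s] map new places to old ones. The first condition says that the
    simple roots inside the blocks of D' become such roots for D; the second
    one says that all such roots for D arise in this way, except for some that
    come from negative roots. Under these conditions conjugation by [pm s]
    matches the two characters on [ninvU s], while the character of D' is
    trivial on [invU s]. *)
Section Move.
Variables (D D' : pred nat) (s : {perm I}).
Hypothesis moveA : forall i j : I, j = i.+1 :> nat -> ~~ D' j ->
  (s j = (s i).+1 :> nat) /\ ~~ D (s j).
Hypothesis moveB : forall i j : I, s j = (s i).+1 :> nat -> ~~ D (s j) ->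
  (j < i)%N \/ (j = i.+1 :> nat) /\ ~~ D' j.

Lemma move_simple k : ~~ D' k.+1 ->
  (s (hi k) = (s (lo k)).+1 :> nat) /\ ~~ D (s (hi k)).
Proof. by move=> Dk; apply: moveA; rewrite val_hi. Qed.

Lemma move_unitri h : h \in ninvU F s -> ((pm s)^-1 * h * pm s)%g \in U.
Proof.
move=> /patP hN; rewrite pmV -{2}[s]invgK; apply/unitriP => i j ji.
rewrite ent_conj hN ?(inj_eq perm_inj) // /ninvr !permKV.
by rewrite [(i < j)%N]ltnNge ji andbF.
Qed.

Lemma move_char h : h \in ninvU F s -> linchar D ((pm s)^-1 * h * pm s)%g = linchar D' h.
Proof.
move=> hN; have /unitriP hU := subsetP (pat_sub_unitri F (ninvr s)) _ hN.
rewrite /linchar; congr psi.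
transitivity (\sum_(k < m | ~~ D k.+1) \sum_(k' < m | ~~ D' k'.+1)
    (s (lo k') == lo k)%:R * ent h (lo k') (hi k')).
  apply: eq_bigr => k Dk; rewrite pmV -{2}[s]invgK ent_conj.
  set i := (s^-1)%g (lo k); set j := (s^-1)%g (hi k).
  have si : s i = lo k by rewrite /i permKV.
  have sj : s j = hi k by rewrite /j permKV.
  have ij : s j = (s i).+1 :> nat by rewrite si sj val_hi.
  have Dj : ~~ D (s j) by rewrite sj val_hi.
  case: (moveB ij Dj) => [ji|[ji Dj']].
    rewrite hU ?(ltnW ji) // -val_eqE /= (gtn_eqF ji) big1 // => k' Dk'.
    case: eqP => [E|_]; last by rewrite mul0r.
    have iE : i = lo k' by apply: (@perm_inj _ s); rewrite si E.
    have := move_simple Dk'; rewrite E => -[E2 _].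
    have jE : j = hi k' by apply: (@perm_inj _ s); apply: val_inj; rewrite /= E2 ij si.
    by move: ji; rewrite iE jE ltnNge (ltnW (lt_lo_hi k')).
  have [k' iE jE] := lo_hiP ji.
  rewrite (sum_natr_pred1 (t0 := k')) => [||k2 _ k2k].
  - by rewrite -iE si eqxx mul1r -jE.
  - by rewrite -val_hi -jE.
  - case: eqP => [E|_]; last by rewrite mul0r.
    have : lo k2 = lo k' by apply: (@perm_inj _ s); rewrite E -iE si.
    by move=> /(congr1 val) /= E2; rewrite -val_eqE /= E2 eqxx in k2k.
rewrite exchange_big /=; apply: eq_bigr => k' Dk'; rewrite -mulr_suml.
have [E Ds] := move_simple Dk'; have [k sk sk'] := lo_hiP E.
rewrite (sum_natr_pred1 (t0 := k)) => [||k2 _ k2k].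
- by rewrite sk eqxx mul1r.
- by rewrite -val_hi -sk'.
- rewrite sk; case: eqP => // /(congr1 val) /= E2.
  by rewrite -val_eqE /= E2 eqxx in k2k.
Qed.

Lemma move_trivial u : u \in invU F s -> linchar D' u = 1.
Proof.
move=> /patP uN; rewrite /linchar big1 // => k Dk.
rewrite uN ?(negbTE (lo_neq_hi k)) // /invr.
have [-> _] := move_simple Dk.
by rewrite negb_and -[X in _ || X]leqNgt leqnSn orbT.
Qed.

(** In the sum over U = ninvU s * invU s the first factor contributes its
    order, by [move_char], and the second one a sign, by [st_key]. *)
Lemma move_char_sum : exists b : bool,
  char_sum (linchar D') * (galg_of R (pm s) * (char_sum (linchar D) * eps)) =
  ((-1) ^+ b * #|ninvU F s|%:R) *: (char_sum (linchar D') * eps).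
Proof.
set y := char_sum (linchar D) * eps.
have sty : steinberg_like y by apply/st_mul/st_eps.
have [b keyb] := st_key s sty; exists b.
rewrite char_sum_line //; last 2 first; first exact: linchar_char.
  exact: st_mul.
congr (_ *: _); rewrite char_sumM (reindex_inj invg_inj) /=.
rewrite (eq_bigl [in U]) => [|u]; last first.
  by apply/idP/idP => /(gl_groupV (P := unitri_group F m)); rewrite ?invgK.
rewrite (sum_unitri_factor s).
transitivity (sg w0 * \sum_(h in ninvU F s) \sum_(x in invU F s)
    y ((pm s)^-1 * x * pm w0)%g).
  congr (_ * _); apply: eq_bigr => h hN; apply: eq_bigr => x xN.
  have hU : h \in U := subsetP (pat_sub_unitri F (ninvr s)) _ hN.
  have xU : x \in U := subsetP (pat_sub_unitri F (invr s)) _ xN.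
  have hV : (h^-1)%g \in U by apply: (gl_groupV (P := unitri_group F m)).
  have xV : (x^-1)%g \in U by apply: (gl_groupV (P := unitri_group F m)).
  have xVN : (x^-1)%g \in invU F s by apply: (gl_groupV (P := invU_group F s)).
  rewrite invgK invMg linchar_mul // (move_trivial xVN) mul1r galg_ofM.
  have -> : ((pm s)^-1 * (h * x * pm w0) =
     ((pm s)^-1 * h * pm s) * ((pm s)^-1 * x * pm w0))%g.
    by rewrite !mulgA mulgK.
  rewrite /y char_sum_shift ?move_unitri //; last exact: linchar_char.
  rewrite move_char // mulrA -linchar_mul // mulVg.
  by rewrite (unitri_char1 (linchar_char D')) mul1r.
under eq_bigr do rewrite keyb.
rewrite mulVg mul1g sumr_const -[in LHS](mulg1 (pm w0)).
have -> : y (pm w0 * 1)%g = sg w0.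
  rewrite mulg1 /y char_sum_eps_pm ninvU_w0 big_set1 (unitri_char1 (linchar_char D)).
  by rewrite mulr1.
have gen (a c : R) n : a * a = 1 -> a * (c * a *+ n) = c * n%:R.
  by move=> a2; rewrite -[_ *+ n]mulr_natr !mulrA [a * c]mulrC -[c * a * a]mulrA a2 mulr1.
by apply: gen; apply: sg_sq.
Qed.

End Move.
End LinearCharacters.

(** * The ideal generated by character sums *)

Section Separation.
Variables (F : finFieldType) (m : nat) (R : idomainType).
Variable psi : F -> R.
Hypotheses (psiD : forall a b, psi (a + b) = psi a * psi b) (psi0 : psi 0 = 1).
Hypothesis psi_nontriv : exists a, psi a != 1.
Local Notation G := {'GL_m.+1[F]}.
Local Notation I := 'I_m.+1.
Local Notation RG := (galg R G).
Local Notation B := (borel F m.+1).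
Local Notation U := (unitri F m.+1).
Local Notation pm := (pm F).
Local Notation q := #|F|.
Local Notation eps := (steinberg_elt F m.+1 R).
Local Notation linchar := (@linchar F m R psi).
Implicit Types (g h u v : G) (i j r c : I) (k : 'I_m) (s t : {perm I}) (x y : RG).
Implicit Types (D : pred nat).

Lemma sdiag_unit : (diag_mx (\row_(i < m.+1) (-1) ^+ i) : 'M[F]_m.+1) \is a GRing.unit.
Proof.
rewrite unitmxE det_diag unitfE; apply/prodf_neq0 => i _.
by rewrite mxE signr_eq0.
Qed.

(** Conjugation by this matrix negates the entries next to the diagonal, hence
    inverts the characters [linchar D]. *)
Definition sdiag : G := FinRing.unit _ sdiag_unit.

Lemma ent_sdiag i j : ent sdiag i j = (-1) ^+ i *+ (i == j).
Proof. by rewrite /ent /= !mxE. Qed.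

Lemma ent_sdiagL g i j : ent (sdiag * g)%g i j = (-1) ^+ i * ent g i j.
Proof.
rewrite entM (sum_natr_pred1 (t0 := i)) // => [|r _ ri]; rewrite ent_sdiag ?eqxx //.
by rewrite eq_sym (negbTE ri) mulr0n mul0r.
Qed.

Lemma ent_sdiagR g i j : ent (g * sdiag)%g i j = ent g i j * (-1) ^+ j.
Proof.
rewrite entM (sum_natr_pred1 (t0 := j)) // => [|r _ rj]; rewrite ent_sdiag ?eqxx //.
by rewrite (negbTE rj) mulr0n mulr0.
Qed.

Lemma sdiag_invol : (sdiag * sdiag = 1)%g.
Proof.
apply: entP => i j; rewrite ent_sdiagL ent_sdiag ent1.
by case: (i == j); rewrite ?mulr1n ?mulr0n ?mulr0 // -expr2 sqrr_sign.
Qed.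

Lemma sdiag_unitri u : u \in U -> (sdiag * u * sdiag)%g \in U.
Proof.
move=> /unitriP uU; apply/unitriP => i j ji; rewrite ent_sdiagR ent_sdiagL uU //.
case: eqP => [->|_]; last by rewrite mulr0 mul0r.
by rewrite mulr1 -expr2 sqrr_sign.
Qed.

Lemma sdiag_conjK g : (sdiag * (sdiag * g * sdiag) * sdiag = g)%g.
Proof. exact: mulg_involK sdiag_invol. Qed.

Lemma linchar_sdiag D u : u \in U ->
  linchar D (sdiag * u * sdiag)%g = linchar D (u^-1)%g.
Proof.
move=> uU; have uV : (u^-1)%g \in U by apply: (gl_groupV (P := unitri_group F m)).
have E v : linchar D (sdiag * v * sdiag)%g * linchar D v = 1.
  rewrite /linchar -psiD -big_split big1 //= => k _.
  rewrite ent_sdiagR ent_sdiagL val_hi val_lo exprS.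
  have : (-1) ^+ k * (-1) ^+ k = 1 :> F by rewrite -expr2 sqrr_sign.
  move: ((-1) ^+ k) (ent v _ _) => c a c2.
  have -> : c * a * (-1 * c) + a = a - c * c * a by ring.
  by rewrite c2 mul1r subrr.
have E2 : linchar D (u^-1)%g * linchar D u = 1.
  rewrite -(linchar_mul psiD D uV uU) mulVg.
  exact: unitri_char1 (linchar_char m psiD psi0 D).
have l0 : linchar D u != 0.
  by apply: contraNneq (oner_neq0 R) => l0; rewrite -E2 l0 mulr0.
by apply: (mulIf l0); rewrite E E2.
Qed.

Lemma sdiag_eps : galg_of R sdiag * eps = eps.
Proof.
apply/ffunP => g; rewrite galg_ofM !epsE; apply: eq_bigr => s _; congr (_ * _%:R).
have sdiagV : (sdiag^-1 = sdiag)%g by apply: (mulgI sdiag); rewrite mulgV sdiag_invol.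
have tB : ((pm s)^-1 * sdiag * pm s)%g \in B.
  rewrite pmV -{2}[s]invgK; apply/borelP => i j ji; rewrite ent_conj ent_sdiag.
  by rewrite (inj_eq perm_inj) -val_eqE /= (gtn_eqF ji).
have -> : ((pm s)^-1 * (sdiag^-1 * g) = ((pm s)^-1 * sdiag * pm s) * ((pm s)^-1 * g))%g.
  by rewrite sdiagV -!mulgA mulKVg.
by rewrite (gl_groupMl (P := borel_group F m)).
Qed.

Lemma galg_of_scaler g (a : R) y : galg_of R g * (a *: y) = a *: (galg_of R g * y).
Proof. by apply/ffunP => h; rewrite galg_scaleE !galg_ofM galg_scaleE. Qed.

Lemma sdiag_char_sum D :
  char_sum (inv_char (linchar D)) * galg_of R sdiag =
  galg_of R sdiag * char_sum (linchar D).
Proof.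
rewrite /char_sum mulr_suml mulr_sumr.
pose J u := (sdiag * u * sdiag)%g.
rewrite (reindex_onto J J) /=; last first.
  by move=> u _; apply: sdiag_conjK.
apply: eq_big => [u|u /andP[uU _]].
  rewrite /J sdiag_conjK eqxx andbT; apply/idP/idP => [/sdiag_unitri|/sdiag_unitri] //.
  by rewrite sdiag_conjK.
rewrite galg_of_scaler -scalerAl !galg_of_mul.
rewrite -[(sdiag * u * sdiag * sdiag)%g]mulgA sdiag_invol mulg1.
by rewrite /J /inv_char -(linchar_sdiag D uU) sdiag_conjK.
Qed.

(** The matrices in U that differ from the identity only in the columns from
    [k0] on. *)
Definition colU (k0 : nat) : {set G} := pat F (fun _ j => k0 <= j)%N.

Lemma colU_group_set (k0 : nat) : group_set (colU k0).
Proof. by apply: pat_group_set. Qed.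
Canonical colU_group (k0 : nat) := Group (colU_group_set k0).

Definition oneCol (k0 : I) : {set G} := pat F (fun _ j => j == k0).

Lemma oneCol_group_set (k0 : I) : group_set (oneCol k0).
Proof. by apply: pat_group_set. Qed.
Canonical oneCol_group (k0 : I) := Group (oneCol_group_set k0).

(** The copy of the general linear group of size [k0] in the upper left
    corner. *)
Definition levi_block (k0 : nat) : {set G} :=
  [set g | [forall i : I, forall j : I,
     ((k0 <= i)%N || (k0 <= j)%N) ==> (ent g i j == (i == j)%:R)]].

Lemma levi_blockP (k0 : nat) g :
  reflect (forall i j, (k0 <= i)%N || (k0 <= j)%N -> ent g i j = (i == j)%:R)
          (g \in levi_block k0).
Proof.
rewrite inE; apply: (iffP forallP) => [h i j ij|h i].
  by have /forallP/(_ j) := h i; rewrite ij => /eqP.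
by apply/forallP => j; apply/implyP => ij; apply/eqP; apply: h.
Qed.

Lemma levi_block_group_set (k0 : nat) : group_set (levi_block k0).
Proof.
apply: group_set_closed => [|g h /levi_blockP gP /levi_blockP hP].
  by apply/levi_blockP => i j _; rewrite ent1.
apply/levi_blockP => i j /orP[ki|kj]; rewrite entM.
  rewrite (sum_natr_pred1 (t0 := i)) // => [|r _ ri]; rewrite gP ?ki //.
    by rewrite eqxx mul1r hP ?ki.
  by rewrite eq_sym (negbTE ri) mul0r.
rewrite (sum_natr_pred1 (t0 := j)) // => [|r _ rj]; rewrite hP ?kj ?orbT //.
  by rewrite eqxx mulr1 gP ?kj ?orbT.
by rewrite (negbTE rj) mulr0.
Qed.
Canonical levi_block_group (k0 : nat) := Group (levi_block_group_set k0).

Lemma levi_blockV (k0 : nat) h : h \in levi_block k0 -> (h^-1)%g \in levi_block k0.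
Proof. by move=> hP; apply: (gl_groupV (P := levi_block_group k0)). Qed.

Lemma ent_levi_conj (k k0 : nat) h u i j : (k <= k0)%N ->
  h \in levi_block k -> u \in colU k0 ->
  ent (h * u * h^-1)%g i j =
    if (j < k0)%N then (i == j)%:R else \sum_r ent h i r * ent u r j.
Proof.
move=> kk0 hP /patP uP; have /levi_blockP hV := levi_blockV hP; rewrite entM.
have col c : (c < k0)%N -> ent (h * u)%g i c = ent h i c.
  move=> ck; rewrite entM (sum_natr_pred1 (t0 := c)) // => [|r _ rc].
    by rewrite uP ?eqxx ?mulr1 // [(k0 <= c)%N]leqNgt ck andbF.
  by rewrite uP ?(negbTE rc) ?mulr0 // [(k0 <= c)%N]leqNgt ck andbF.
case: ltnP => jk.
  transitivity (ent (h * h^-1)%g i j); last by rewrite mulgV ent1.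
  rewrite entM; apply: eq_bigr => c _; case: (ltnP c k0) => ck; first by rewrite col.
  rewrite hV ?(leq_trans kk0 ck) //; case: eqP => [cj|_]; last by rewrite !mulr0.
  by rewrite cj leqNgt jk in ck.
rewrite (sum_natr_pred1 (t0 := j)) // => [|c _ cj].
  by rewrite hV ?eqxx ?mulr1 ?entM // (leq_trans kk0 jk) orbT.
by rewrite hV ?(negbTE cj) ?mulr0 // (leq_trans kk0 jk) orbT.
Qed.

Lemma ent_levi_conj_low (k k0 : nat) h u i j : (k <= k0)%N ->
  h \in levi_block k -> u \in colU k0 -> (k <= i)%N ->
  ent (h * u * h^-1)%g i j = ent u i j.
Proof.
move=> kk0 hP uP ki; rewrite (ent_levi_conj _ _ kk0 hP uP); case: ltnP => jk.
  by move/patP: uP => ->; rewrite // [(k0 <= j)%N]leqNgt jk andbF.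
move/levi_blockP: hP => hP; rewrite (sum_natr_pred1 (t0 := i)) // => [|r _ ri].
  by rewrite hP ?ki // eqxx mul1r.
by rewrite hP ?ki // eq_sym (negbTE ri) mul0r.
Qed.

Lemma colU_conj (k k0 : nat) h u : (k <= k0)%N -> h \in levi_block k ->
  u \in colU k0 -> (h * u * h^-1)%g \in colU k0.
Proof.
move=> kk0 hP uP; apply/patP => i j nij.
case: (ltnP j k0) => jk; first by rewrite (ent_levi_conj _ _ kk0 hP uP) jk.
rewrite jk andbT -leqNgt in nij.
rewrite (ent_levi_conj_low _ kk0 hP uP); last by rewrite (leq_trans kk0) // (leq_trans jk).
by move/patP: uP => -> //; rewrite jk andbT -leqNgt.
Qed.

Lemma oneCol_sub (k0 : I) : oneCol k0 \subset colU k0.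
Proof.
apply/subsetP => u /patP uP; apply/patP => i j nij; apply: uP.
by apply: contra nij => /andP[-> /eqP ->] /=.
Qed.

Lemma oneCol_conj (k0 : I) h u : h \in levi_block k0 ->
  u \in oneCol k0 -> (h * u * h^-1)%g \in oneCol k0.
Proof.
move=> hP uA; have uP := subsetP (oneCol_sub k0) _ uA.
have /patP := colU_conj (leqnn _) hP uP => cP; apply/patP => i j nij.
case: (eqVneq j k0) => [jk|jk]; first by apply: cP; move: nij; rewrite jk eqxx leqnn.
case: (ltnP j k0) => jk0; first by rewrite (ent_levi_conj _ _ (leqnn _) hP uP) jk0.
rewrite (ent_levi_conj _ _ (leqnn _) hP uP) ltnNge jk0 /=.
move/patP: uA => uA; move/levi_blockP: hP => hP.
rewrite (sum_natr_pred1 (t0 := j)) // => [|r _ rj].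
  by rewrite uA ?(negbTE jk) ?andbF // eqxx mulr1 hP ?jk0 ?orbT.
by rewrite uA ?(negbTE jk) ?andbF // (negbTE rj) mulr0.
Qed.

Lemma conj_invE h g u : (h * u * h^-1 = g)%g -> (u = h^-1 * g * h)%g.
Proof. by move=> <-; rewrite !mulgA mulVg mul1g mulgKV. Qed.

Lemma galg_conj_sum (A : {set G}) (f f' : G -> R) h :
  (forall u, (h * u * h^-1)%g \in A = (u \in A)) ->
  (forall u, u \in A -> f' (h * u * h^-1)%g = f u) ->
  galg_of R h * (\sum_(u in A) f u *: galg_of R u) =
  (\sum_(u in A) f' u *: galg_of R u) * galg_of R h.
Proof.
move=> hA hf; rewrite mulr_suml mulr_sumr.
rewrite [RHS](reindex_onto (fun u => h * u * h^-1)%g (fun u => h^-1 * u * h)%g) /=; last first.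
  by move=> u _; rewrite !mulgA mulgV mul1g mulgK.
apply: eq_big => [u|u uA].
  by rewrite hA !mulgA mulVg mul1g mulgKV eqxx andbT.
by rewrite galg_of_scaler -scalerAl !galg_of_mul mulgKV hf.
Qed.

(** Let Z be a two-sided ideal that contains [char_sum (linchar D)] for every
    D. The columns of U are removed one by one from the left. The entries
    above the diagonal in column k0 form an abelian group whose characters,
    under the general linear group of size k0, fall into the orbit of the
    trivial one and that of the characters living on the entry next to the
    diagonal. Both kinds occur among the [linchar D], so Z contains the sum
    for every character of the column, and the sum of all these is a power of
    q, a unit. *)
Section Ideal.
Variable Z : RG -> Prop.
Hypotheses (Z_add : forall x y, Z x -> Z y -> Z (x + y)) (Z_0 : Z 0).
Hypotheses (Z_left : forall a x, Z x -> Z (a * x)).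
Hypothesis Z_right : forall a x, Z x -> Z (x * a).
Hypothesis q_unit : (q%:R : R) \is a GRing.unit.
Hypothesis Z_char_sum : forall D, Z (char_sum (linchar D)).

(** The character sum over [colU k0]: that over U for k0 = 0, and 1 once all
    columns are removed. *)
Definition colE (k0 : nat) D : RG := \sum_(u in colU k0) linchar D u *: galg_of R u.
(** Every character of the group of column [k0] is given by some coefficients
    [f]; this is its character sum. *)
Definition colA (k0 : I) (f : I -> F) : RG :=
  \sum_(a in oneCol k0) psi (\sum_(i < m.+1 | (i < k0)%N) f i * ent a i k0) *: galg_of R a.

Lemma col_TI (k0 : I) : (oneCol k0 :&: colU k0.+1 = 1)%g.
Proof.
apply/trivgP/subsetP => g /setIP[/patP g1 /patP g2]; apply/set1P/entP => i j.
rewrite ent1; case: (eqVneq j k0) => [->|jk]; last by apply: g1; rewrite (negbTE jk) andbF.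
by apply: g2; rewrite ltnn andbF.
Qed.

Lemma colU_factor (k0 : I) : (oneCol k0 * colU k0.+1)%g = colU k0.
Proof.
apply/eqP; rewrite eqEcard; apply/andP; split.
  apply/subsetP => u /mulsgP[a v aA vV ->].
  apply: (gl_groupM (P := colU_group k0)); first exact: (subsetP (oneCol_sub k0)).
  move/patP: vV => vV; apply/patP => i j nij; apply: vV; apply: contra nij.
  by case/andP => -> /ltnW ->.
have := mul_cardG (oneCol_group k0) (colU_group k0.+1).
rewrite /= col_TI cards1 muln1 => <-.
rewrite !card_pat -expnD leq_eqVlt; apply/orP; left; apply/eqP; congr (_ ^ _)%N.
rewrite -big_split /=; apply: eq_bigr => i _; rewrite -big_split /=.
apply: eq_bigr => j _; case: (i < j)%N => //=; rewrite -val_eqE /=.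
by case: (ltngtP j k0).
Qed.

Lemma colU_sub (k0 : nat) : colU k0 \subset U.
Proof. exact: pat_sub_unitri. Qed.

Lemma colA_colE (k0 : I) D D' f :
  (forall a, a \in oneCol k0 ->
     linchar D' a = psi (\sum_(i < m.+1 | (i < k0)%N) f i * ent a i k0)) ->
  (forall c : nat, c != k0 -> D' c = D c) ->
  colA k0 f * colE k0.+1 D = colE k0 D'.
Proof.
move=> fA DD; rewrite /colE -(colU_factor k0) sum_mulg; last exact: col_TI.
rewrite /colA mulr_suml; apply: eq_bigr => a aA; rewrite mulr_sumr.
have aU : a \in U by apply: (subsetP (pat_sub_unitri F _)) aA.
apply: eq_bigr => v vV; have vU := subsetP (colU_sub _) _ vV.
rewrite linchar_mul // -scalerAl galg_of_scaler galg_of_mul scalerA fA //; congr (_ * _ *: _).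
rewrite /linchar; congr psi; rewrite big_mkcond [RHS]big_mkcond; apply: eq_bigr => k _.
case: (eqVneq k.+1 (k0 : nat)) => [kE|kn]; last by rewrite DD.
move/patP: vV => ->; last by rewrite val_hi kE ltnn andbF.
by rewrite (negbTE (lo_neq_hi k)); do 2 case: ifP.
Qed.

Lemma colA_zero (k0 : I) D f : (forall i, (i < k0)%N -> f i = 0) ->
  (forall D', Z (colE k0 D')) -> Z (colA k0 f * colE k0.+1 D).
Proof.
move=> f0 ZE; rewrite (@colA_colE _ _ (fun c : nat => (c == k0) || D c)) => [|a aA|c ck].
- exact: ZE.
- rewrite [in RHS]big1 => [|i ik]; last by rewrite f0 ?mul0r.
  rewrite /linchar big1 // => k /norP[kn _]; move/patP: aA => ->.
    by rewrite (negbTE (lo_neq_hi k)).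
  have : hi k != k0 by apply: contraNneq kn => <-; rewrite val_hi.
  by move/negbTE => ->; rewrite andbF.
by rewrite (negbTE ck).
Qed.

Lemma colA_last (k0 : I) (i0 : I) D : k0 = i0.+1 :> nat ->
  (forall D', Z (colE k0 D')) -> Z (colA k0 (fun i => (i == i0)%:R) * colE k0.+1 D).
Proof.
move=> kE ZE; have [k i0E k0E] := lo_hiP kE.
rewrite (@colA_colE _ _ (fun c : nat => (c != k0) && D c)) => [|a aA|c ck]; first exact: ZE.
  rewrite /linchar; congr psi; rewrite (sum_natr_pred1 (t0 := k)) => [||k' _ k'k].
  - rewrite (sum_natr_pred1 (t0 := i0)) => [||i _ ii0].
    + by rewrite eqxx mul1r i0E k0E.
    + by rewrite kE.
    + by rewrite (negbTE ii0) mul0r.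
  - by rewrite k0E val_hi eqxx.
  move/patP: aA => ->; first by rewrite (negbTE (lo_neq_hi k')).
  have : hi k' != k0.
    rewrite k0E; apply: contraNneq k'k => /(congr1 (@nat_of_ord _)).
    by rewrite !val_hi => -[/val_inj ->].
  by move/negbTE => ->; rewrite andbF.
by rewrite (negbTE ck).
Qed.

Lemma galg_ofV g : galg_of R (g^-1)%g * galg_of R g = 1.
Proof. by rewrite galg_of_mul mulVg. Qed.

Lemma levi_conj_iff (k0 : nat) (P : {set G}) h :
  (forall g u, g \in levi_block k0 -> u \in P -> (g * u * g^-1)%g \in P) ->
  h \in levi_block k0 -> forall u, ((h * u * h^-1)%g \in P) = (u \in P).
Proof.
move=> PJ hP u; apply/idP/idP => [uP|]; last exact: PJ.
have := PJ _ _ (levi_blockV hP) uP.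
by rewrite invgK -(conj_invE (erefl (h * u * h^-1)%g)).
Qed.

Lemma colE_levi (k0 : I) D h : h \in levi_block k0 ->
  galg_of R h * colE k0.+1 D = colE k0.+1 D * galg_of R h.
Proof.
move=> hP; apply: galg_conj_sum.
  by apply: (levi_conj_iff _ hP) => g u; apply: colU_conj.
move=> u uV; rewrite /linchar; congr psi; apply: eq_bigr => k _.
case: (leqP k0 (lo k)) => kk; first exact: (ent_levi_conj_low _ (leqnSn _) hP uV).
have low w : w \in colU k0.+1 -> ent w (lo k) (hi k) = 0.
  move=> /patP ->; first by rewrite (negbTE (lo_neq_hi k)).
  by rewrite val_hi negb_and orbC; move: kk; rewrite val_lo -leqNgt => ->.
by rewrite !low //; apply: colU_conj hP uV.
Qed.

(** Replacing the last row of the identity matrix works if the last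
    coefficient is nonzero, and a transposition of columns reduces to that
    case. *)
Lemma levi_rowP (kp k0 : I) (f : I -> F) : k0 = kp.+1 :> nat ->
  (exists2 j : I, (j < k0)%N & f j != 0) ->
  exists2 h, h \in levi_block k0 & forall i, (i < k0)%N -> ent h kp i = f i.
Proof.
move=> kE.
have base f' : f' kp != 0 ->
    exists2 h, h \in levi_block k0 & forall i, (i < k0)%N -> ent h kp i = f' i.
  move=> fk; pose M : 'M[F]_m.+1 := \matrix_(i, j)
    if i == kp then if (j < k0)%N then f' j else 0 else (i == j)%:R.
  have Mtrig : is_trig_mx M.
    apply/is_trig_mxP => i j ij; rewrite mxE; case: eqP => [ik|_].
      by rewrite ltnNge kE -ik ij.
    by case: eqP => // ij'; rewrite ij' ltnn in ij.
  have Mu : M \is a GRing.unit.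
    rewrite unitmxE det_trig // unitfE; apply/prodf_neq0 => i _; rewrite mxE eqxx.
    by case: (i =P kp) => [->|_]; rewrite ?oner_neq0 // kE ltnSn.
  exists (FinRing.unit _ Mu) => [|i ik]; last by rewrite /ent /= mxE eqxx ik.
  apply/levi_blockP => i j ij; rewrite /ent /= mxE; case: eqP => // ik.
  move: ij; rewrite ik [(k0 <= kp)%N]leqNgt kE ltnSn /= => kj.
  rewrite ltnNge kj /=; case: eqP => // jk; by rewrite -jk ltnn in kj.
case=> j jk fj.
have tlow (i : I) : (k0 <= i)%N -> tperm j kp i = i.
  move=> ki; rewrite tpermD //; apply: contraTneq ki => <-; rewrite -ltnNge //.
  by rewrite kE.
have fk : f (tperm j kp kp) != 0 by rewrite tpermR.
have [h hP hf] := base (fun i => f (tperm j kp i)) fk.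
exists (h * pm (tperm j kp))%g => [|i ik].
  apply: (gl_groupM (P := levi_block_group k0)) => //.
  apply/levi_blockP => i i' /orP[ki|ki]; rewrite ent_pm.
    by rewrite (tlow _ ki).
  by rewrite -{1}(tlow _ ki) (inj_eq perm_inj).
rewrite ent_pmR tpermV hf ?tpermK //.
case: tpermP => [_|_|//]; first by rewrite kE.
by [].
Qed.

(** Conjugation by h moves the character that reads off the last entry of the
    column to the one whose coefficients are the last row of h. *)
Lemma colA_levi (kp k0 : I) f h : k0 = kp.+1 :> nat -> h \in levi_block k0 ->
  (forall i, (i < k0)%N -> ent h kp i = f i) ->
  galg_of R h * colA k0 f = colA k0 (fun i => (i == kp)%:R) * galg_of R h.
Proof.
move=> kE hP hf; apply: galg_conj_sum.
  by apply: (levi_conj_iff _ hP) => g u; apply: oneCol_conj.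
move=> u uA; have uP := subsetP (oneCol_sub k0) _ uA; congr psi.
rewrite (sum_natr_pred1 (t0 := kp)) => [||i _ ik]; last 2 first.
- by rewrite kE.
- by rewrite (negbTE ik) mul0r.
rewrite eqxx mul1r (ent_levi_conj _ _ (leqnn _) hP uP) ltnn.
rewrite [RHS]big_mkcond; apply: eq_bigr => i _; case: ltnP => ik; first by rewrite hf.
have /levi_blockP hP' := hP; rewrite hP' ?ik ?orbT //.
case: eqP => [E|_]; last by rewrite mul0r.
by rewrite -E kE ltnn in ik.
Qed.

Lemma colA_Z (k0 : I) D f : (forall D', Z (colE k0 D')) -> Z (colA k0 f * colE k0.+1 D).
Proof.
move=> ZE; case: (boolP [exists j : I, (j < k0)%N && (f j != 0)]) => [|fz]; last first.
  apply: colA_zero => // i ik; apply/eqP; apply: contraR fz => fi.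
  by apply/existsP; exists i; rewrite ik.
case/existsP => j /andP[jk fj].
have kpP : (k0.-1 < m.+1)%N by apply: leq_ltn_trans (ltn_ord k0); apply: leq_pred.
pose kp : I := Ordinal kpP.
have kE : k0 = kp.+1 :> nat by rewrite /= prednK // (leq_trans _ jk).
have [h hP hf] := levi_rowP kE (ex_intro2 _ _ j jk fj).
have -> : colA k0 f * colE k0.+1 D = galg_of R (h^-1)%g *
    (colA k0 (fun i => (i == kp)%:R) * colE k0.+1 D) * galg_of R h.
  rewrite -!mulrA -(colE_levi D hP) [X in _ = _ * X]mulrA -(colA_levi kE hP hf).
  by rewrite !mulrA galg_ofV mul1r.
by apply/Z_right/Z_left/colA_last.
Qed.

(** The coefficient at a <> 1 is invariant, up to a factor psi c <> 1, under a
    translation of f, and so vanishes. *)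
Lemma sum_colA (k0 : I) :
  \sum_(f : {ffun I -> F}) colA k0 f = (q ^ m.+1)%:R *: 1.
Proof.
rewrite exchange_big /=.
under eq_bigr do rewrite -scaler_suml.
have A1 : 1%g \in oneCol k0 := group1 (oneCol_group k0).
rewrite (bigD1 1%g) //= [X in _ + X]big1 ?addr0 => [|a /andP[aA a1]].
  congr (_ *: _); rewrite (eq_bigr (fun=> 1)) => [|f _].
    by rewrite sumr_const card_ffun card_ord.
  rewrite big1 ?psi0 // => i ik; rewrite ent1; case: eqP => [E|_]; last by rewrite mulr0.
  by rewrite E ltnn in ik.
have [i ik ai] : exists2 i : I, (i < k0)%N & ent a i k0 != 0.
  apply/exists_inP; apply: contraNT a1 => /exists_inPn an; apply/eqP/entP => i j.
  rewrite ent1; move/patP: aA => aA; case: (boolP ((i < j)%N && (j == k0))) => [|n]; last exact: aA.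
  case/andP => ij /eqP jE; have := an i; rewrite -jE => /(_ ij); rewrite negbK => /eqP ->.
  by case: eqP => // E; rewrite E ltnn in ij.
have [c psic] := psi_nontriv.
set S := \sum_(f : _) _; suff -> : S = 0 by rewrite scale0r.
pose f0 : {ffun I -> F} := [ffun r => (r == i)%:R * (c / ent a i k0)].
have : S = psi c * S.
  rewrite {1}/S (reindex_inj (addrI f0)) mulr_sumr /=; apply: eq_bigr => f _.
  rewrite -psiD; congr psi.
  under eq_bigr do rewrite ffunE mulrDl; rewrite big_split /=; congr (_ + _).
  rewrite (sum_natr_pred1 (t0 := i)) // => [|r _ ri]; rewrite ffunE.
    by rewrite eqxx mul1r divfK.
  by rewrite (negbTE ri) !mul0r.
move/eqP; rewrite -[X in X == _]mul1r -subr_eq0 -mulrBl mulf_eq0 subr_eq0 eq_sym.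
by rewrite (negbTE psic) => /eqP.
Qed.

Lemma Z_scale (a : R) x : Z x -> Z (a *: x).
Proof. by move=> Zx; rewrite -[x]mul1r scalerAl; apply: Z_left. Qed.

Lemma colE_Z (k0 : nat) : (k0 <= m.+1)%N -> forall D, Z (colE k0 D).
Proof.
elim: k0 => [_ D|k0 IH k0m D].
  have -> : colE 0 D = char_sum (linchar D); last exact: Z_char_sum.
  by apply: eq_bigl => u; rewrite unitri_pat; apply/patP/patP => uP i j nij; apply: uP;
    move: nij; rewrite ?leq0n ?andbT.
have ZE := IH (ltnW k0m); pose k := Ordinal k0m.
have : Z ((\sum_(f : {ffun I -> F}) colA k f) * colE k0.+1 D).
  rewrite mulr_suml; elim/big_ind: _ => // f _; exact: (@colA_Z k).
rewrite sum_colA -scalerAl mul1r => /(Z_scale (q ^ m.+1)%:R^-1).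
by rewrite scalerA mulVr ?scale1r // natrX unitrX.
Qed.

Lemma char_sums_generate : Z 1.
Proof.
have := colE_Z (leqnn _) predT.
rewrite /colE (_ : colU m.+1 = 1%g); last first.
  apply/setP => g; apply/patP/set1P => [h|-> i j _]; last exact: ent1.
  by apply: entP => i j; rewrite ent1; apply: h; rewrite [(m.+1 <= j)%N]leqNgt ltn_ord andbF.
by rewrite big_set1 (unitri_char1 (linchar_char m psiD psi0 predT)) scale1r.
Qed.

End Ideal.
End Separation.

(** * Permuting and splitting blocks *)

Section Reach.
Variables (F : finFieldType) (m : nat) (R : idomainType).
Hypothesis R_char0 : [pchar R] =i pred0.
Variable psi : F -> R.
Hypotheses (psiD : forall a b, psi (a + b) = psi a * psi b) (psi0 : psi 0 = 1).
Hypothesis q_unit : (#|F|%:R : R) \is a GRing.unit.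
Local Notation G := {'GL_m.+1[F]}.
Local Notation RG := (galg R G).
Local Notation eps := (steinberg_elt F m.+1 R).
Local Notation linchar := (@linchar F m R psi).
Local Notation good := (composition m.+1).

Definition reach_elt (D D' : pred nat) :=
  exists a : RG, char_sum (linchar D') * eps = a * (char_sum (linchar D) * eps).

Lemma eq_char_sum (D D' : pred nat) : (forall k : nat, (0 < k < m.+1)%N -> D k = D' k) ->
  char_sum (linchar D) = char_sum (linchar D').
Proof.
move=> DD; apply: eq_bigr => u _; congr (_ *: _); rewrite /linchar; congr psi.
by apply: eq_bigl => k; rewrite DD //= ltnS ltn_ord.
Qed.

(** The factor in [move_char_sum] is a power of q up to sign. *)
Lemma reach_block_swap b1 b2 (x y : nat) (c : bool) (D D' : pred nat) :
  (0 < x)%N -> (0 < y)%N -> (sumn b1 + (x + y) <= m.+1)%N ->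
  D =1 mid_bdry b1 b2 x y (fun k => (k == sumn b1 + x)%N && c) ->
  D' =1 mid_bdry b1 b2 x y (pred1 (sumn b1 + y)%N) ->
  reach_elt D D'.
Proof.
move=> x0 y0 sn DE DE'.
pose f (i : 'I_m.+1) : 'I_m.+1 := Ordinal (block_swap_lt x0 y0 sn (ltn_ord i)).
have f_inj : injective f.
  by move=> i j /(congr1 val) /= /(block_swap_inj x0 y0)/val_inj.
have [||b Eb] := @move_char_sum F m R R_char0 psi psiD psi0 D D' (perm f_inj).
- move=> i j ij; rewrite !permE DE DE' /= ij.
  exact: block_swap_moveA.
- move=> i j; rewrite !permE DE DE' /=.
  exact: block_swap_moveB.
set u := (_ * _ : R) in Eb.
have uU : u \is a GRing.unit.
  by rewrite /u unitrM unitrX ?unitrN1 // card_ninvU natrX unitrX.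
exists (u^-1 *: (char_sum (linchar D') * galg_of R (pm F (perm f_inj)))).
by rewrite -scalerAl -mulrA Eb scalerA mulVr ?scale1r.
Qed.

Lemma reach_elt_trans D1 D2 D3 : reach_elt D1 D2 -> reach_elt D2 D3 -> reach_elt D1 D3.
Proof. by case=> a E [a' E']; exists (a' * a); rewrite E' E mulrA. Qed.

Lemma reach_elt_swap b1 b2 (x y : nat) : good (b1 ++ x :: y :: b2) ->
  reach_elt (bdry (b1 ++ x :: y :: b2)) (bdry (b1 ++ y :: x :: b2)).
Proof.
rewrite /composition all_cat /= sumn_cat /= => /andP[/and4P[_ x0 y0 _] /eqP bn].
apply: (@reach_block_swap b1 b2 x y true) => // [|k|k]; first by lia.
  rewrite (bdry_pair b1 b2 x0 y0 k (erefl _)) // /mid_bdry.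
  by case: ifP => // _; case: ifP => //= _; rewrite andbT.
exact: (bdry_pair b1 b2 x0 y0 k (addnC _ _)).
Qed.

Lemma reach_elt_split b (x y : nat) : (0 < x)%N -> (0 < y)%N -> good (x + y :: b)%N ->
  reach_elt (bdry (x + y :: b)%N) (bdry (y :: x :: b)).
Proof.
rewrite /composition /= => x0 y0 /andP[_ /eqP bn].
apply: (@reach_block_swap [::] b x y false) => // [|k|k]; first by rewrite /=; lia.
  have /= -> := bdry_merged [::] b x0 y0 k; rewrite /mid_bdry.
  by case: ifP => // _; case: ifP => //= _; rewrite andbF.
exact: (bdry_pair [::] b x0 y0 k (addnC _ _)).
Qed.

(** By exchanges of adjacent blocks the block that is to come first is moved
    to the front. *)
Lemma reach_elt_perm b b' : good b -> perm_eq b b' -> reach_elt (bdry b) (bdry b').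
Proof.
suff gen pre : good (pre ++ b) -> perm_eq b b' ->
    reach_elt (bdry (pre ++ b)) (bdry (pre ++ b')) by exact: (gen [::]).
elim: b' b pre => [|z b' IH] b pre gb bb'.
  by rewrite (perm_nilP bb'); exists 1; rewrite mul1r.
have zb : z \in b by rewrite (perm_mem bb') mem_head.
case/splitPr: zb gb bb' => u v gb bb'.
have step : reach_elt (bdry (pre ++ u ++ z :: v)) (bdry (pre ++ z :: u ++ v)).
  elim/last_ind: u v gb {bb'} => [|u t IHu] v gb; first by exists 1; rewrite mul1r.
  rewrite !cat_rcons in gb *; rewrite !catA in gb *.
  apply: reach_elt_trans (reach_elt_swap gb) _.
  rewrite -!catA; apply: IHu; rewrite catA -(@perm_composition m.+1 ((pre ++ u) ++ t :: z :: v)) //.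
  by rewrite perm_cat2l; apply/permPl/(perm_catCA [:: t] [:: z] v).
apply: reach_elt_trans step _; rewrite -!cat_rcons; apply: IH.
  rewrite cat_rcons -(@perm_composition m.+1 (pre ++ u ++ z :: v)) //.
  by rewrite perm_cat2l; apply/permPl/(perm_catCA u [:: z] v).
by move: bb'; rewrite (perm_catCA u [:: z] v (z :: b')) perm_cons.
Qed.

End Reach.

Import boolp classical_sets.
Local Open Scope classical_set_scope.
Local Open Scope ring_scope.

(** * Socles in a filtered module *)

Section SubmoduleFacts.
Variables (A : nzRingType) (V : lmodType A).
Implicit Types (M N S : submodule V) (x y : V).

Lemma submodule_eq M N : (M : set V) = N -> M = N.
Proof.
case: M N => [M cM] [N cN] /= MN; rewrite MN in cM *.
by rewrite (Prop_irrelevance cM cN).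
Qed.

Lemma submD M x y : subm_set M x -> subm_set M y -> subm_set M (x + y).
Proof. by move=> Mx My; rewrite -[x]scale1r; apply: submL. Qed.

Lemma submB M x y : subm_set M x -> subm_set M y -> subm_set M (x - y).
Proof.
by move=> Mx My; apply: submD => //; rewrite -scaleN1r; apply: submZ.
Qed.

Lemma subm_sum M (s : seq V) :
  (forall v, v \in s -> subm_set M v) -> subm_set M (\sum_(v <- s) v).
Proof.
move=> Ms; rewrite big_seq; apply: big_ind => //; first exact: subm0.
by move=> u v; apply: submD.
Qed.

Lemma cyclic_mem x : subm_set (cyclic_subm x) x.
Proof. by exists 1; rewrite scale1r. Qed.

Lemma cyclic_sub M x : subm_set M x -> cyclic_subm x `<=` M.
Proof. by move=> Mx _ [a ->]; apply: submZ. Qed.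

Lemma quotmod_pi_eq0 S x : quotmod_pi S x = 0 <-> subm_set S x.
Proof.
rewrite -(raddf0 (quotmod_pi S)); split=> [/eqP|Sx].
  by rewrite quotmod_piE subr0 inE.
by apply/eqP; rewrite quotmod_piE subr0 inE.
Qed.

Lemma subm_piP S M x :
  subm_set (subm_pi S M) (quotmod_pi S x) <-> subm_set (add_subm M S) x.
Proof.
split=> [[y My /eqP]|Mx]; last by exists x.
rewrite quotmod_piE inE => Sxy; case: My => [u [v [Mu Sv yE]]].
exists u, (v - (y - x)); split=> //; first exact: submB.
by rewrite opprB addrA -yE addrC subrK.
Qed.

Lemma subm_pi_sub S M x : S `<=` M ->
  (subm_set (subm_pi S M) (quotmod_pi S x) <-> subm_set M x).
Proof.
move=> SM; rewrite subm_piP; split=> [[u [v [Mu Sv ->]]]|Mx].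
  by apply: submD => //; apply: SM.
by exists x, 0; rewrite addr0; split=> //; apply: subm0.
Qed.

Lemma add_subm_l M N x : subm_set M x -> subm_set (add_subm M N) x.
Proof. by move=> Mx; exists x, 0; rewrite addr0; split=> //; apply: subm0. Qed.

Lemma irreducible_socle M x :
  irreducible M -> subm_set M x -> subm_set (socle V) x.
Proof.
move=> irrM Mx; exists [:: x]; split; last by rewrite big_seq1.
by move=> v; rewrite inE => /eqP ->; exists M.
Qed.

Lemma socle_sub M :
  (forall N, irreducible N -> N `<=` M) -> socle V `<=` M.
Proof.
move=> NM _ [s [sN ->]]; apply: subm_sum => v /sN[N irrN Nv].
exact: NM irrN _ Nv.
Qed.

End SubmoduleFacts.

Section Filtration.
Variables (A : nzRingType) (V : lmodType A).
Variables (d l e n Phi : nat) (Fb : seq nat -> V) (L : nat -> submodule V).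
Local Notation phi := (blocks_val d l e).
Local Notation wt := (blocks_e e).
Local Notation good := (composition n).
Local Notation cyc := (@cyclic_subm A V).

Hypotheses (l_prime : prime l) (e_gt1 : (1 < e)%N) (d_gt0 : (0 < d)%N).
Hypothesis sep : forall (M : submodule V) x, ~ subm_set M x ->
  exists b, [/\ good b, subm_set (cyc x) (Fb b) & ~ subm_set M (Fb b)].
Hypothesis filt : forall b c, good b ->
  (subm_set (L c) (Fb b) <-> (c + phi b <= Phi)%N).
Hypothesis sym : forall b b' c, good b -> good b' -> phi b' = phi b ->
  (c + phi b = Phi)%N ->
  subm_set (add_subm (cyc (Fb b)) (L c.+1)) (Fb b') ->
  subm_set (cyc (Fb b')) (Fb b).
Local Notation reach := (fun b b' => subm_set (cyc (Fb b)) (Fb b')).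
Hypothesis reach_perm : forall b b', good b -> perm_eq b b' -> reach b b'.
Hypothesis reach_split : forall x y b, good (x + y :: b)%N ->
  (0 < x)%N -> (0 < y)%N -> reach (x + y :: b)%N (y :: x :: b).

Lemma filt_reach_trans b c b' : reach b c -> reach c b' -> reach b b'.
Proof. by move=> bc; apply: cyclic_sub. Qed.

Lemma filt_mono c c' : (c <= c')%N -> L c' `<=` L c.
Proof.
move=> cc' x Lx; apply: contrapT => /sep[b [gb xb]]; apply.
by apply/filt => //; have /(filt _ gb) := cyclic_sub Lx xb; lia.
Qed.

Hypothesis phi_le : forall b, good b -> (phi b <= Phi)%N.

Lemma filt0 : (L 0 : set V) = [set: V].
Proof.
apply/seteqP; split=> // x _; apply: contrapT => /sep[b [gb _]]; apply.
by apply/filt => //; rewrite add0n phi_le.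
Qed.

Lemma filt_top c : (Phi < c)%N -> (L c : set V) = [set 0].
Proof.
move=> Phic; apply/seteqP; split=> [x Lx|_ ->]; last exact: subm0.
apply: contrapT => nx; have /sep[b [gb xb _]] : ~ subm_set (zero_subm V) x by [].
by have /(filt _ gb) := cyclic_sub Lx xb; lia.
Qed.

(** A submodule of this quotient that is not 0 contains some F_b' outside L
    c.+1. As F_b' lies in L c, the compositions b and b' have the same value,
    and symmetry gives F_b back. *)
Lemma filt_cyclic_irreducible b c : good b -> (c + phi b = Phi)%N ->
  irreducible (subm_pi (L c.+1) (cyc (Fb b))).
Proof.
move=> gb cb; set S := L c.+1.
have nS : ~ subm_set S (Fb b) by move/(filt _ gb); lia.
split=> [/seteqP[/(_ (quotmod_pi S (Fb b))) h _]|N NM].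
  apply/nS/quotmod_pi_eq0/h/subm_piP/add_subm_l; exact: cyclic_mem.
case: (pselect (subm_set N (quotmod_pi S (Fb b)))) => [Nb|nNb].
  right; apply/seteqP; split=> // x [y [u [v [[a ->] Sv ->]]] <-].
  rewrite linearD /=; have /quotmod_pi_eq0 -> := Sv.
  by rewrite addr0 linearZ; apply: submZ.
left; apply/seteqP; split=> [x|_ ->]; last exact: subm0.
rewrite -(quotmod_reprK x); set y := quotmod_repr x => Ny /=.
apply/quotmod_pi_eq0; apply: contrapT => /sep[b' [gb' yb' nSb']].
apply: nNb; have Nb' : subm_set N (quotmod_pi S (Fb b')).
  by case: yb' => a ->; rewrite linearZ; apply: submZ.
have Ab' : subm_set (add_subm (cyc (Fb b)) S) (Fb b') by apply/subm_piP/NM.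
have Lb' : subm_set (L c) (Fb b').
  case: Ab' => [u [v [[a ->] Sv ->]]]; apply: submD.
    by apply: submZ; apply/filt => //; lia.
  exact: (filt_mono (leqnSn c)).
have phib' : phi b' = phi b.
  have n2 : ~ (c.+1 + phi b' <= Phi)%N by move=> h; apply: nSb'; apply/filt.
  by move/(filt _ gb'): Lb'; lia.
have [a ->] := sym gb gb' phib' cb Ab'.
by rewrite linearZ; apply: submZ.
Qed.

(** Let M be an irreducible submodule of the quotient by L c.+1 that is not
    contained in L c, and v = Phi - c. It contains some F_b with v < phi b,
    and then it is generated by each F_b' reached from F_b with v <= phi b'.
    Such b' satisfy phi b <= phi b', since otherwise F_b would lie in a term
    of the filtration that is too small. So phi cannot take the value v on the
    way from b down to the composition into blocks 1 and e with a = wt b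
    blocks e, where it is d * a; hence v < d * a. That composition generates M
    as well. Breaking up one more block e makes phi equal to d * (a - 1), less
    than phi b, so d * (a - 1) < v. *)
Theorem socle_filt c : (c <= Phi)%N ->
  (socle (quotmod (L c.+1)) : set _) = subm_pi (L c.+1) (L c) \/
  exists a, [/\ (0 < a)%N, (e * a <= n)%N, (d * (a - 1) < Phi - c < d * a)%N &
    irreducible (subm_pi (L c.+1) (cyc (Fb (e_blocks n e a))))].
Proof.
move=> cPhi; set S := L c.+1.
have SLc : S `<=` L c by apply: filt_mono.
have LcSoc : subm_pi S (L c) `<=` socle (quotmod S).
  move=> x; rewrite -(quotmod_reprK x) => /subm_pi_sub-/(_ SLc).
  set y := quotmod_repr x => Ly.
  suff: subm_set (subm_pi_preim (socle (quotmod S))) y by [].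
  apply: contrapT => /sep[b [gb yb]]; apply.
  suff: subm_set (socle (quotmod S)) (quotmod_pi S (Fb b)) by [].
  have /(filt _ gb) := cyclic_sub Ly yb.
  rewrite leq_eqVlt => /orP[/eqP cb|cb].
    apply: irreducible_socle (filt_cyclic_irreducible gb cb) _.
    by apply/subm_piP/add_subm_l/cyclic_mem.
  have /quotmod_pi_eq0 -> : subm_set S (Fb b) by apply/filt.
  exact: subm0.
case: (pselect (socle (quotmod S) `<=` subm_pi S (L c))) => [?|nsoc].
  by left; apply/seteqP.
right.
have [M irrM nM] : exists2 M : submodule (quotmod S), irreducible M &
    ~ M `<=` subm_pi S (L c).
  apply: contrapT => h; apply: nsoc; apply: socle_sub => N irrN.
  by apply: contrapT => nN; apply: h; exists N.
have [y My nLy] : exists2 y, subm_set M (quotmod_pi S y) & ~ subm_set (L c) y.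
  apply: contrapT => h; apply: nM => x Mx; rewrite -(quotmod_reprK x).
  apply/subm_pi_sub => //; apply: contrapT => nL; apply: h.
  by exists (quotmod_repr x) => //; rewrite quotmod_reprK.
have [b [gb yb nLb]] := sep nLy.
have Mb : subm_set M (quotmod_pi S (Fb b)).
  by case: yb => a ->; rewrite linearZ; apply: submZ.
set v := (Phi - c)%N.
have vb : (v < phi b)%N.
  rewrite ltnNge; apply/negP => h; apply: nLb; apply/filt => //.
  by rewrite /v in h; lia.
have piM b' : reach b b' -> good b' -> (v <= phi b')%N ->
    (subm_pi S (cyc (Fb b')) : set _) = M.
  move=> bb' gb' vb'.
  have sub : subm_pi S (cyc (Fb b')) `<=` M.
    move=> x [z [u [w [[a ->] Sw ->]]] <-]; rewrite linearD /=.
    have /quotmod_pi_eq0 -> := Sw; rewrite addr0 linearZ; apply: submZ.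
    by case: bb' => a' ->; rewrite linearZ; apply: submZ.
  have [_ /(_ _ sub) [h|//]] := irrM.
  have : subm_set (subm_pi S (cyc (Fb b'))) (quotmod_pi S (Fb b')).
    by apply/subm_piP/add_subm_l/cyclic_mem.
  rewrite h => /quotmod_pi_eq0 /(filt _ gb'); rewrite /v in vb'.
  by lia.
have same b' : reach b b' -> good b' -> (v <= phi b')%N -> (phi b <= phi b')%N.
  move=> bb' gb' vb'; rewrite leqNgt; apply/negP => lt.
  have Lb : subm_set (L (Phi - phi b')) (Fb b).
    have : subm_set (add_subm (cyc (Fb b')) S) (Fb b).
      by apply/subm_piP; rewrite piM.
    case=> [u [w [[a ->] Sw ->]]]; apply: submD.
      by apply: submZ; apply/filt => //; have := phi_le gb'; lia.
    by apply: (@filt_mono _ c.+1) => //; rewrite /v in vb'; lia.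
  by move/(filt _ gb): Lb; have := phi_le gb'; lia.
have [bw vals] := @canon_chain e n _ e_gt1 filt_reach_trans
  reach_perm reach_split d l l_prime b gb.
have vw : (v < d * wt b)%N.
  rewrite ltnNge; apply/negP => h.
  have [|b' [gb' bb' phib']] := vals v; first by rewrite h ltnW.
  by have := same _ bb' gb'; rewrite phib'; lia.
have ew : (e * wt b <= n)%N.
  have /andP[_ /eqP <-] := gb; rewrite sumnE /blocks_e big_distrr /=.
  by apply: leq_sum => x _; rewrite mulnC leq_trunc_div.
have gw := composition_canon e_gt1 ew.
have pw : phi (e_blocks n e (wt b)) = (d * wt b)%N.
  exact: blocks_val_canon.
exists (wt b); split=> //; last first.
- have [irr0 irrM'] := irrM; have E := piM _ bw gw; rewrite pw in E.
  by have -> := submodule_eq (E (ltnW vw)).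
- rewrite vw andbT ltnNge; apply/negP => h.
  case wE: (wt b) => [|a]; first by rewrite wE muln0 in vw.
  rewrite wE in ew gw pw h bw.
  have gP : good (e_blocks n e a) by apply: composition_canon => //; lia.
  have bP := filt_reach_trans bw (@reach_canon_pred e n _ e_gt1
    filt_reach_trans reach_perm reach_split a ew).
  rewrite subn1 /= -/v in h.
  have dw : (d * wt b <= phi b)%N.
    by rewrite /blocks_val big_split /= -big_distrr /= leq_addr.
  have := same _ bP gP; rewrite blocks_val_canon // => /(_ h).
  apply/negP; rewrite -ltnNge; apply: leq_trans dw.
  by rewrite wE mulnS -[X in (X < _)%N]add0n ltn_add2r.
- by case: (wt b) vw => //; rewrite muln0.
Qed.

Hypotheses (d_eq1 : d = 1%N) (good_n : good [:: n]) (phi_n : phi [:: n] = Phi).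

(** The values from d * wt [:: n] on occur by [canon_chain], and the smaller
    ones, for d = 1, as values of compositions into blocks 1 and e. *)
Lemma blocks_val_onto v : (v <= Phi)%N -> exists2 b, good b & phi b = v.
Proof.
move=> vPhi; case: (leqP (d * wt [:: n]) v) => vn.
  have [_ vals] := @canon_chain e n _ e_gt1 filt_reach_trans
    reach_perm reach_split d l l_prime [:: n] good_n.
  by have [|b [gb _ <-]] := vals v; [rewrite vn phi_n|exists b].
exists (e_blocks n e v); last by rewrite blocks_val_canon // d_eq1 mul1n.
apply: composition_canon => //.
rewrite d_eq1 mul1n /blocks_e big_seq1 in vn.
by have := leq_trunc_div n e; nia.
Qed.

Lemma filt_neq c c' : (c < c')%N -> (c <= Phi)%N -> (L c : set V) <> L c'.
Proof.
move=> cc' cPhi LL; have [b gb pb] := @blocks_val_onto (Phi - c) (leq_subr _ _).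
have : subm_set (L c) (Fb b) by apply/filt => //; rewrite pb; lia.
by rewrite LL => /(filt _ gb); rewrite pb; lia.
Qed.

Lemma socle_filt1 c : (c <= Phi)%N ->
  (socle (quotmod (L c.+1)) : set _) = subm_pi (L c.+1) (L c).
Proof. by move=> /socle_filt[//|[a [a0 _ + _]]]; rewrite d_eq1 !mul1n; lia. Qed.

Lemma socle_iter_filt i : (i <= Phi.+1)%N -> socle_iter V i = L (Phi.+1 - i).
Proof.
elim: i => [|i IH] iP; apply: submodule_eq; first by rewrite subn0 filt_top.
rewrite /= IH ?(ltnW iP) // subSS subSn //.
have socE := socle_filt1 (leq_subr i Phi).
have sub : L (Phi - i).+1 `<=` L (Phi - i) by apply: filt_mono.
apply/seteqP; split=> x Hx.
  have : subm_set (socle (quotmod (L (Phi - i).+1))) (quotmod_pi _ x) by exact: Hx.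
  by rewrite socE => /(subm_pi_sub _ sub).
have : subm_set (subm_pi (L (Phi - i).+1) (L (Phi - i))) (quotmod_pi _ x).
  by apply/subm_pi_sub.
by rewrite -socE.
Qed.

Theorem socle_series_filt : exists N : nat,
  (forall c : nat, (N <= c)%N -> (L c : set V) = [set 0]) /\
  socle_series (rev
    [seq X <- undup (mkseq (fun c : nat => L c : set V) N) | X != [set 0]]).
Proof.
exists Phi.+1; split=> [c|]; first exact: filt_top.
have uL : uniq (mkseq (fun c : nat => L c : set V) Phi.+1).
  apply/mkseq_uniqP => c c' /=; rewrite !inE !ltnS => cP cP' LL.
  case: (ltngtP c c') => // cc'; [case: (filt_neq cc' cP)|case: (filt_neq cc' cP')] => //.
have nz c : (c <= Phi)%N -> (L c : set V) != [set 0].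
  by move=> cP; apply/eqP; rewrite -(filt_top (ltnSn Phi)); apply: filt_neq.
rewrite undup_id // (all_filterP _); last first.
  by apply/allP => X /mapP[c]; rewrite mem_iota => /andP[_ cP] ->; apply: nz.
split.
- apply: (@eq_from_nth _ [set 0]); rewrite ?size_mkseq // size_rev size_mkseq => i iP.
  rewrite nth_rev ?size_mkseq // !nth_mkseq ?size_mkseq ?subSS ?ltnS ?leq_subr //.
  by rewrite socle_iter_filt // subSS.
- rewrite /mkseq /= rev_cons last_rcons; exact: filt0.
rewrite /= rev_uniq uL andbT mem_rev.
apply/negP => /mapP[c]; rewrite mem_iota => /andP[_ cP] Lc.
by move: (nz c cP); rewrite -Lc eqxx.
Qed.

End Filtration.

(** * The coefficient ring *)

Section LocalDomain.
Variables (R : idomainType) (l : nat).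
Hypotheses (l_prime : prime l) (R_char0 : [pchar R] =i pred0).
Hypothesis R_local : local_with_maximal_ideal (mult_subm R^o l).

Lemma natr_eq0 n : ((n%:R : R) == 0) = (n == 0)%N.
Proof. by move/pcharf0P: R_char0 => ->. Qed.

(** Zorn's lemma for the proper ideals containing x, with the empty set added
    so that the empty chain has an upper bound. *)
Lemma maximal_ideal_exists (x : R) : x \isn't a GRing.unit ->
  exists2 J : submodule R^o, maximal J & subm_set J x.
Proof.
move=> xU; pose lin (A : set R) := forall a u v, A u -> A v -> A (a * u + v).
pose P (A : set R) := A = set0 \/ [/\ A x, lin A & ~ A 1].
have xR : P [set u | exists a : R, u = a * x].
  right; split; first by exists 1; rewrite mul1r.
    by move=> a _ _ [b ->] [c ->]; exists (a * b + c); rewrite mulrDl mulrA.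
  by case=> a a1; case/negP: xU; apply/unitrP; exists a; rewrite [x * a]mulrC -a1.
have [A [PA Amax]] : exists A, P A /\ forall B, A `<` B -> ~ P B.
  apply: Zorn_bigcup => C CP Ctot.
  case: (pselect (exists2 A, C A & A <> set0)) => [[A0 CA0 A0n]|C0]; last first.
    left; apply/seteqP; split=> // u [A CA Au].
    by case: C0; exists A => // AE; rewrite AE in Au.
  have CE A : C A -> A <> set0 -> [/\ A x, lin A & ~ A 1] by move=> /CP[].
  have nz (A : set R) u : A u -> A <> set0 by move=> Au AE; rewrite AE in Au.
  right; split; first by exists A0 => //; case: (CE _ CA0 A0n).
    move=> a u v [A1 C1 A1u] [A2 C2 A2v].
    case: (Ctot _ _ C1 C2) => sub; [exists A2 | exists A1] => //.
      by have [_ linA _] := CE _ C2 (nz _ _ A2v); apply: linA => //; apply: sub.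
    by have [_ linA _] := CE _ C1 (nz _ _ A1u); apply: linA => //; apply: sub.
  by case=> A CA A1; have [_ _] := CE _ CA (nz _ _ A1); apply.
have {PA}[Ax Alin A1] : [/\ A x, lin A & ~ A 1].
  case: PA => // A0; case: (Amax _ _ xR); rewrite A0; split=> // h.
  by case: (h x) => //; exists 1; rewrite mul1r.
have A0 : A 0 by have := Alin (-1) _ _ Ax Ax; rewrite mulN1r addNr.
exists (Submodule (@submP R R^o A A0 Alin)) => //.
split=> [/= AT|N AN]; first by apply: A1; rewrite AT.
case: (pselect (N `<=` A)) => [NA|nNA]; first by left; apply/seteqP.
right; apply/seteqP; split=> // u _.
have N1 : subm_set N (1 : R^o).
  apply: contrapT => nN1; apply: (Amax N); first by split.
  right; split=> //; first exact: AN.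
  by move=> a v w; apply: submL.
by have := submZ (u : R) N1; rewrite /GRing.scale /= mulr1.
Qed.

Lemma unit_or_dvd (x : R) : x \is a GRing.unit \/ exists y, x = y *+ l.
Proof.
case: (boolP (x \is a GRing.unit)) => [xU|xU]; [by left|right].
have [J Jmax Jx] := maximal_ideal_exists xU.
by have /R_local JE := Jmax; rewrite JE in Jx.
Qed.

Lemma l_nonunit (x : R) : x *+ l \isn't a GRing.unit.
Proof.
have [nT _] : maximal (mult_subm R^o l) by apply/R_local.
apply/negP => xU; apply: nT; apply/seteqP; split=> // u _.
exists (u * (x *+ l)^-1 * x); apply/eqP.
by rewrite -mulrnAr divrK.
Qed.

Lemma unitr_natP n : ~~ (l %| n)%N -> (n%:R : R) \is a GRing.unit.
Proof.
move=> ln; case: (unit_or_dvd n%:R) => // -[y yE].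
have n0 : (0 < n)%N by case: n ln {yE} => //; rewrite dvdn0.
have [u v uvE _] := egcdnP n (prime_gt0 l_prime).
have gcd1 : gcdn l n = 1%N by apply/eqP; rewrite -/(coprime l n) prime_coprime.
rewrite gcd1 in uvE.
have : (u%:R * l%:R : R) = v%:R * n%:R + 1 by rewrite -!natrM uvE natrD.
rewrite yE => E; have : (1 : R) = (u%:R - v%:R * y) *+ l.
  by rewrite -mulr_natr mulrBl E -[y *+ l]mulr_natr mulrA addrC addKr.
by move=> E1; have := l_nonunit (u%:R - v%:R * y); rewrite -E1 unitr1.
Qed.

Lemma dvd_expP c n : (0 < n)%N ->
  (exists r : R, n%:R = l%:R ^+ c * r) <-> (c <= logn l n)%N.
Proof.
move=> n0; split=> [[r nE]|cn]; last first.
  have /dvdnP[k kE] : (l ^ c %| n)%N by rewrite pfactor_dvdn.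
  by exists k%:R; rewrite kE natrM natrX mulrC.
rewrite leqNgt; apply/negP => nc.
have [k lk kE] := pfactor_coprime l_prime n0; set v := logn l n in kE nc *.
have kU : (k%:R : R) \is a GRing.unit by rewrite unitr_natP -?prime_coprime.
have lv0 : (l%:R ^+ v : R) != 0.
  by rewrite -natrX natr_eq0 -lt0n expn_gt0 prime_gt0.
have : (k%:R : R) = (l%:R ^+ (c - v.+1) * r) *+ l.
  apply: (mulfI lv0); rewrite -natrX -natrM [(l ^ v * k)%N]mulnC -kE nE natrX.
  have cE : c = (v + (c - v.+1).+1)%N by lia.
  by rewrite {1}cE exprD exprS -[_ *+ l]mulr_natr; ring.
by move=> E; have := l_nonunit (l%:R ^+ (c - v.+1) * r); rewrite -E kU.
Qed.

End LocalDomain.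

(** A coordinate of F over its prime field, used as exponent of the root of
    unity. *)
Lemma additive_char_exists (F : finFieldType) (R : idomainType) p (z : R) :
  p \in [pchar F] -> p.-primitive_root z ->
  exists psi : F -> R, [/\ forall a b, psi (a + b) = psi a * psi b,
    psi 0 = 1 & exists a, psi a != 1].
Proof.
move=> pF zp; have p_pr := pcharf_prime pF.
pose V := pPrimeCharType pF.
have dV : (0 < \dim {:V})%N.
  rewrite lt0n dimv_eq0; apply/eqP => V0; have := memvf (1 : V).
  by rewrite V0 memv0 oner_eq0.
pose f (x : V) : 'F_p := coord (vbasis {:V}) (Ordinal dV) x.
have fD x y : f (x + y) = f x + f y by rewrite /f linearD.
exists (fun a : F => z ^+ (f (a : V))); split=> [a b||].
  have -> : f ((a + b : F) : V) = ((f (a : V) + f (b : V))%N)%:R :> 'F_p.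
    by rewrite natrD !natr_Zp -fD.
  by rewrite val_Fp_nat // (prim_expr_mod zp) exprD.
  by have -> : f ((0 : F) : V) = 0 by rewrite /f linear0.
pose v := (vbasis {:V})`_(Ordinal dV); exists (v : F).
have -> : f v = 1.
  by rewrite /f coord_free ?eqxx // (basis_free (vbasisP _)).
have -> : nat_of_ord (1 : 'F_p) = 1%N by rewrite -[1]/(1%:R) val_Fp_nat // modn_small ?prime_gt1.
rewrite expr1; apply/eqP => z1; have := prim_order_dvd zp 1.
by rewrite expr1 z1 eqxx dvdn1 => /eqP p1; rewrite p1 in p_pr.
Qed.

Lemma invol_twist (A : pzRingType) (t x y z : A) :
  t * t = 1 -> x * t = t * y -> t * (x * z) = y * (t * z).
Proof.
move=> tt xt; suff tx : t * x = y * t by rewrite !mulrA tx.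
by rewrite -[LHS]mulr1 -tt mulrA -[t * x * t]mulrA xt !mulrA tt mul1r.
Qed.

Lemma pairing_factor (A : comPzRingType) (b k n s l r1 r2 : A) :
  b * (k * n * s) + b * (l * k * r1) + b * (k * r2) * l =
  b * (k * (n * s + (r1 + r2) * l)).
Proof. by ring. Qed.

(** * The filtration of the Steinberg lattice *)

Section Lattice.
Variables (F : finFieldType) (m l : nat) (R : idomainType).
Hypotheses (l_prime : prime l) (R_char0 : [pchar R] =i pred0).
Hypothesis R_local : local_with_maximal_ideal (mult_subm R^o l).
Variable psi : F -> R.
Hypotheses (psiD : forall a b, psi (a + b) = psi a * psi b) (psi0 : psi 0 = 1).
Hypothesis psi_nontriv : exists a, psi a != 1.
Hypothesis q_unit : (#|F|%:R : R) \is a GRing.unit.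
Local Notation G := {'GL_m.+1[F]}.
Local Notation RG := (galg R G).
Local Notation B := (borel F m.+1).
Local Notation U := (unitri F m.+1).
Local Notation q := #|F|.
Local Notation eps := (steinberg_elt F m.+1 R).
Local Notation gen := (steinberg_gen F m.+1 R).
Local Notation linchar := (@linchar F m R psi).
Local Notation E D := (char_sum (linchar D)).
Local Notation E' D := (char_sum (inv_char (linchar D))).
Local Notation lat := (subm_type (steinberg F m.+1 R)).
Local Notation V := (Lmod F m.+1 R l).
Local Notation pi := (quotmod_pi (mult_subm lat l)).
Local Notation L c := (L_filt F m.+1 R l c).
Local Notation Fb D := (@F_elt F m.+1 R l (linchar D)).
Local Notation norm D := (dec_sum q D m.+1).
Local Notation dot := (@galg_dot R G).
Implicit Types (D : pred nat) (u w y : lat).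

Lemma lat_gen (a : RG) : subm_val (a *: gen) = a * eps.
Proof. by []. Qed.

Lemma lat_val y : exists a : RG, subm_val y = a * eps.
Proof. by have := subm_valP y; rewrite inE. Qed.

Lemma lat_st y : steinberg_like (subm_val y : RG).
Proof. by have [a ->] := lat_val y; apply/st_mul/st_eps. Qed.

Lemma lat_inj u w : subm_val u = subm_val w -> u = w.
Proof. exact: val_inj. Qed.

Lemma lat_valD u w : subm_val (u + w) = (subm_val u : RG) + subm_val w.
Proof. by []. Qed.

Lemma lat_valMn u n : subm_val (u *+ n) = (subm_val u : RG) *+ n.
Proof. by elim: n => [|n IH] //; rewrite !mulrS lat_valD IH. Qed.

Lemma inv_linchar_char D : @unitri_char F m.+1 R (inv_char (linchar D)).
Proof.
split=> [u _|u v uU vU]; first exact: psi_unit.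
rewrite /inv_char invMg mulrC linchar_mul //.
all: apply: (gl_groupV (P := unitri_group F m)) => //.
Qed.

Lemma char_sum_idem lam : @unitri_char F m.+1 R lam ->
  char_sum lam * (char_sum lam * eps) = #|U|%:R *: (char_sum lam * eps).
Proof. by move=> lamP; apply: char_sum_scale => // u g; apply: char_sum_shift. Qed.

Lemma card_U_unit : (#|U|%:R : R) \is a GRing.unit.
Proof. by rewrite unitri_pat card_pat natrX unitrX. Qed.

Lemma char_sum_coord lam y : @unitri_char F m.+1 R lam ->
  exists r : R, char_sum lam * subm_val y = r *: (char_sum lam * eps).
Proof.
move=> lamP; exists (sg R (w0 m) * (char_sum lam * (subm_val y : RG)) (pm F (w0 m))).
by apply: char_sum_line => //; apply: lat_st.
Qed.

Lemma reach_cyclic D D' : @reach_elt F m R psi D D' -> subm_set (cyclic_subm (Fb D)) (Fb D').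
Proof.
case=> a Ea; exists a; rewrite /F_elt -linearZ /=; congr pi.
by apply: lat_inj; exact: Ea.
Qed.

Lemma l_scale0 (r : R) (v : V) : ((r *+ l) *: 1 : RG) *: v = 0.
Proof.
rewrite -(quotmod_reprK v) -linearZ /=; apply/quotmod_pi_eq0.
exists ((r *: 1 : RG) *: quotmod_repr v).
by rewrite -scalerMnl -scalerMnl.
Qed.

Lemma char_sum_pi D (v : V) : exists r : R, E D *: v = (r *: 1 : RG) *: Fb D.
Proof.
rewrite -(quotmod_reprK v); set y := quotmod_repr v.
have [r Er] := char_sum_coord y (linchar_char m psiD psi0 D); exists r.
rewrite /F_elt -!linearZ /=; congr pi; apply: lat_inj.
rewrite !subm_valZ; transitivity (E D * subm_val y) => //.
by rewrite Er; transitivity ((r *: 1 : RG) * (E D * eps)) => //; rewrite -scalerAl mul1r.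
Qed.

(** The y with (y * a) *: x in M for all a form a two-sided ideal, which is
    proper if x is not in M. Hence some [char_sum (linchar D)] is not in it
    and maps some multiple of x outside M. The value is a multiple of F_D by
    multiplicity one, and the scalar is a unit because l kills the module. *)
Lemma separation (M : submodule V) (x : V) : ~ subm_set M x ->
  exists D, subm_set (cyclic_subm x) (Fb D) /\ ~ subm_set M (Fb D).
Proof.
move=> nMx; apply: contrapT => nD.
pose Z (y : RG) := forall a : RG, subm_set M ((y * a) *: x).
suff Z1 : Z 1 by apply: nMx; have := Z1 1; rewrite mul1r scale1r.
apply: (char_sums_generate psiD psi0 psi_nontriv) => //.
- by move=> y z Zy Zz a; rewrite mulrDl scalerDl; apply: submD.
- by move=> a; rewrite mul0r scale0r; apply: subm0.
- by move=> a y Zy c; rewrite -mulrA -scalerA; apply/submZ/Zy.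
- by move=> a y Zy c; rewrite -mulrA; apply: Zy.
move=> D a; apply: contrapT => nM; apply: nD; exists D.
have [r Er] := char_sum_pi D (a *: x).
case: (unit_or_dvd R_local r) => [rU|[r' rE]]; last first.
  by case: nM; rewrite -scalerA Er rE l_scale0; apply: subm0.
have FE : Fb D = ((r^-1 *: 1 : RG) * E D * a) *: x.
  by rewrite -!scalerA Er scalerA -scalerAl mul1r scalerA mulVr // !scale1r.
split; first by exists ((r^-1 *: 1 : RG) * E D * a).
by move=> MF; apply: nM; rewrite -scalerA Er; apply: submZ.
Qed.

Lemma dot_scale (t : R) (x y : RG) : dot (t *: x) y = t * dot x y.
Proof.
by rewrite /galg_dot mulr_sumr; apply: eq_bigr => g _; rewrite galg_scaleE mulrA.
Qed.

Lemma dot_muln (x y : RG) n : dot (x *+ n) y = dot x y *+ n.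
Proof. by rewrite -[RHS]mulr_natl -dot_scale scaler_nat. Qed.

Lemma B_neq0 : #|B|%:R != 0 :> R.
Proof.
rewrite natr_eq0 // -lt0n; apply/card_gt0P; exists 1%g.
exact: group1 (borel_group F m).
Qed.

Lemma lat_filtP c u : subm_set (steinberg_filt F m.+1 R l c) u <->
  forall y, exists r : R, dot (subm_val u) (subm_val y) = #|B|%:R * (l%:R ^+ c * r).
Proof.
have B0 : (#|B|%:R : {fraction R}) != 0.
  by rewrite -(rmorph_nat (@tofrac R)) tofrac_eq0 B_neq0.
have formE y : galg_form (subm_val u) (subm_val y) =
  #|B|%:R^-1 * tofrac (dot (subm_val u) (subm_val y)) by [].
split=> h y; have [r Er] := h y; exists r.
  apply/eqP; rewrite -tofrac_eq rmorphM /= rmorph_nat -Er formE.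
  by rewrite mulrA mulfV ?mul1r.
by rewrite formE Er rmorphM /= rmorph_nat mulrA mulVf ?mul1r.
Qed.

Lemma dot_char_sum D y : exists r : R, E' D * subm_val y = r *: (E' D * eps) /\
  dot (E D * eps) (subm_val y) = #|B|%:R * ((norm D)%:R * r).
Proof.
have [r Er] := char_sum_coord y (inv_linchar_char D); exists r; split => //.
rewrite (dot_char_sum_eps R_char0 (lat_st y) Er) (char_norm_linchar m psiD psi0 psi_nontriv).
by rewrite mulrA.
Qed.

Lemma dot_char_sum_self D :
  dot (E D * eps) (E' D * eps) = #|B|%:R * ((norm D)%:R * #|U|%:R).
Proof.
rewrite (dot_char_sum_eps R_char0 _ (char_sum_idem (inv_linchar_char D))); last exact/st_mul/st_eps.
by rewrite (char_norm_linchar m psiD psi0 psi_nontriv) mulrA.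
Qed.

(** If E D * eps lies in I(c) up to l I, then so does, exactly, a unit
    multiple of it: apply E D, which maps the error term to a multiple by l of
    E D * eps, and whose square is |U| times itself. The norm can then be read
    off from the product with E' D * eps. *)
Lemma L_filtP c D : subm_set (L c) (Fb D) <-> (exists r : R, (norm D)%:R = l%:R ^+ c * r).
Proof.
rewrite /L_filt subm_piP; split=> [[u [v [Iu [w ->] Euv]]]|[r Er]].
  have [s Es] := char_sum_coord w (linchar_char m psiD psi0 D).
  have EE : (#|U|%:R - s *+ l) *: (E D * eps) = E D * subm_val u.
    rewrite scalerBl -(char_sum_idem (linchar_char m psiD psi0 D)).
    have H : E D * eps = subm_val u + subm_val w *+ l.
      by rewrite -lat_valMn -lat_valD -Euv.
    by rewrite {1}H mulrDr mulrnAr Es -scalerMnl addrK.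
  set t := _ - _ in EE; have tU : t \is a GRing.unit.
    case: (unit_or_dvd R_local t) => // -[t' tE]; case/negP: (l_nonunit R_local (t' + s)).
    by rewrite mulrnDl -tE subrK card_U_unit.
  have /lat_filtP/(_ (E' D *: gen))[r] := submZ (E D) Iu.
  rewrite subm_valZ lat_gen; rewrite -[E D *: _]/(E D * (subm_val u : RG)) -EE.
  have -> : dot (t *: (E D * eps)) (E' D * eps) = t * dot (E D * eps) (E' D * eps).
    exact: dot_scale.
  rewrite dot_char_sum_self mulrCA => /(mulfI B_neq0) H.
  have uU : t * #|U|%:R \is a GRing.unit by rewrite unitrM tU card_U_unit.
  by exists (r / (t * #|U|%:R)); rewrite mulrA -H mulrCA mulrK.
exists (E D *: gen), 0; rewrite addr0; split=> //; last exact: subm0.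
apply/lat_filtP => y; have [s [_ ->]] := dot_char_sum D y.
by exists (r * s); rewrite Er -mulrA.
Qed.

Lemma sdiag_galg_invol : galg_of R (sdiag F m) * galg_of R (sdiag F m) = 1.
Proof. by rewrite galg_of_mul sdiag_invol. Qed.

Lemma sdiag_char_sum2 D (x : RG) :
  galg_of R (sdiag F m) * (E' D * x) = E D * (galg_of R (sdiag F m) * x).
Proof.
exact: (invol_twist _ sdiag_galg_invol (sdiag_char_sum m psiD psi0 D)).
Qed.

Lemma natr_val n : (0 < n)%N ->
  exists2 r : R, r \is a GRing.unit & n%:R = l%:R ^+ logn l n * r.
Proof.
move=> n0; have [k lk nE] := pfactor_coprime l_prime n0.
exists k%:R; first by apply: (unitr_natP l_prime R_local); rewrite -prime_coprime.
by rewrite {1}nE natrM natrX mulrC.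
Qed.

(** Lift the hypothesis to E D' * eps = a * (E D * eps) + u + l w' with u in
    I(c + 1), and pair it with E' D' * eps. The two last terms give multiples
    of l ^ c.+1, and the left-hand side does not; so the scalar s in E' D *
    (a^* * (E' D' * eps)) = s (E' D * eps) is a unit. Conjugation by
    [sdiag] turns this into an expression of E D * eps as a multiple of E
    D' * eps. *)
Lemma filt_sym D D' c : (0 < norm D)%N -> (0 < norm D')%N ->
  logn l (norm D) = c -> logn l (norm D') = c ->
  subm_set (add_subm (cyclic_subm (Fb D)) (L c.+1)) (Fb D') ->
  subm_set (cyclic_subm (Fb D')) (Fb D).
Proof.
move=> D0 D0' vD vD' [_ [v [[a ->] Lv FE]]].
have l0 : (l%:R : R) ^+ c != 0 by rewrite expf_neq0 // natr_eq0 // -lt0n prime_gt0.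
case: Lv FE => v0 [u [_ [Iu [w ->] ->]]] <- FE.
have [w' Ew] : exists w', E D' *: gen = a *: (E D *: gen) + u + w' *+ l.
  move: FE; rewrite /F_elt -linearZ -raddfD /= => /eqP; rewrite quotmod_piE inE => -[w' Ew'].
  exists (w' + w); rewrite mulrnDl -Ew' [_ - _ + _]addrC addrA -[_ + u + _]addrA.
  by rewrite addrC subrK.
have val_eq : E D' * eps = a * (E D * eps) + subm_val u + subm_val w' *+ l.
  by have := congr1 (@subm_val _ _ _) Ew; rewrite !lat_valD lat_valMn.
pose y' := E' D' * eps.
have [r1 Er1] : exists r : R, dot (subm_val u) y' = #|B|%:R * (l%:R ^+ c.+1 * r).
  by move/lat_filtP: Iu => /(_ (E' D' *: gen)).
have [n nU nE] := natr_val D0; have [n' nU' nE'] := natr_val D0'.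
have [r2 Er2] : exists r : R, dot (subm_val w') y' = #|B|%:R * (l%:R ^+ c * r).
  have iK : inv_char (inv_char (linchar D')) = linchar D'.
    by apply: funext => g; rewrite /inv_char invgK.
  have [r Er] := char_sum_coord w' (linchar_char m psiD psi0 D').
  have := @dot_char_sum_eps F m R R_char0 (inv_char (linchar D')) (subm_val w') r (lat_st w').
  rewrite iK => /(_ Er) H.
  have dotC x z : dot x z = dot z x by apply: eq_bigr => g _; rewrite mulrC.
  have nI : char_norm (linchar D') = (norm D')%:R :> R.
    rewrite -(char_norm_linchar m psiD psi0 psi_nontriv); apply: eq_bigr => s _.
    rewrite (reindex_inj invg_inj) /=; apply: eq_bigl => g.
    by apply/idP/idP => /(gl_groupV (P := ninvU_group F s)); rewrite ?invgK.
  by exists (n' * r); rewrite dotC H nI nE' vD' !mulrA.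
have [s [Es dots]] := dot_char_sum D (galg_star a *: (E' D' *: gen)).
rewrite subm_valZ lat_gen -[galg_star a *: _]/(galg_star a * y') in Es dots.
have key : n' * #|U|%:R = n * s + (r1 + r2) *+ l.
  have := dot_char_sum_self D'; rewrite {1}val_eq -/y' !dot_addl.
  rewrite dot_adj dots Er1 nE nE' vD vD'.
  have -> : dot (subm_val w' *+ l) y' = dot (subm_val w') y' *+ l.
    by rewrite -dot_muln.
  rewrite Er2 => H; apply: (mulfI l0); apply: (mulfI B_neq0).
  rewrite [_ ^+ c * (n' * _)]mulrA -{}H exprS -[X in _ + X = _]mulr_natr -[(r1 + r2) *+ l]mulr_natr.
  exact: pairing_factor.
have sU : s \is a GRing.unit.
  case: (unit_or_dvd R_local s) => // -[s' sE].
  case/negP: (l_nonunit R_local (n * s' + (r1 + r2))).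
  by rewrite mulrnDl -mulrnAr -sE -key unitrM nU' card_U_unit.
apply: reach_cyclic.
have sdiagD' : galg_of R (sdiag F m) * y' = E D' * eps by rewrite sdiag_char_sum2 sdiag_eps.
have tt := sdiag_galg_invol.
exists (s^-1 *: (E D * (galg_of R (sdiag F m) * (galg_star a * galg_of R (sdiag F m))))).
rewrite -sdiagD' -scalerAl -!mulrA [galg_of R (sdiag F m) * (galg_of _ _ * y')]mulrA tt mul1r.
rewrite -sdiag_char_sum2 Es galg_of_scaler sdiag_char_sum2 sdiag_eps scalerA mulVr ?scale1r //.
Qed.

End Lattice.

(** * The socle of the Steinberg lattice modulo l *)

(** Cauchy's theorem for the additive group. *)
Lemma prime_dvd_card_field (F : finFieldType) (p l : nat) :
  p \in [pchar F] -> prime l -> (l %| #|F|)%N -> l = p.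
Proof.
move=> pF l_prime; rewrite -cardsT => /(Cauchy l_prime)[x _ ox].
have x0 : x != 0 by apply: contraTneq l_prime => x0; rewrite -ox x0 order1.
have lF : l \in [pchar F].
  rewrite inE l_prime -(inj_eq (mulIf x0)) mul0r mulr_natl.
  by apply/eqP; rewrite -FinRing.zmodXgE -{1}ox; apply: expg_order.
by apply/eqP; have := GRing.pcharf_eq pF l; rewrite lF => /esym.
Qed.

Lemma between_muln d a t v : (d * (a - 1) < v < d * a)%N -> v = (d * t)%N -> False.
Proof.
move=> /andP[v1 v2] vE; rewrite vE in v1 v2.
have d0 : (0 < d)%N by case: d v2 {v1 vE} => //; rewrite !mul0n.
by rewrite !ltn_pmul2l // in v1 v2; lia.
Qed.

Section SocleOfSteinberg.
Variables (F : finFieldType) (l m e : nat) (R : idomainType).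
Hypotheses (l_prime : prime l) (R_char0 : [pchar R] =i pred0).
Hypothesis R_local : local_with_maximal_ideal (mult_subm R^o l).
Variable psi : F -> R.
Hypotheses (psiD : forall a b, psi (a + b) = psi a * psi b) (psi0 : psi 0 = 1).
Hypothesis psi_nontriv : exists a, psi a != 1.
Local Notation q := #|F|.
Local Notation n := m.+1.
Hypothesis l_q : ~~ (l %| q)%N.
Hypotheses (e_gt1 : (1 < e)%N) (l_e : (l %| qint q e)%N).
Hypothesis e_min : forall i, (1 < i)%N -> (l %| qint q i)%N -> (e <= i)%N.
Local Notation d := (logn l (qint q e)).
Local Notation G := {'GL_n[F]}.
Local Notation B := (borel F n).
Local Notation linchar := (@linchar F m R psi).
Local Notation V := (Lmod F n R l).
Local Notation L := (L_filt F n R l).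
Local Notation Fb := (fun b : seq nat => @F_elt F n R l (linchar (bdry b))).
Local Notation Phi := (logn l (qfact q n)).
Local Notation phi := (blocks_val d l e).
Local Notation good := (composition n).
Local Notation norm b := (dec_sum q (bdry b) n).

Lemma q_gt1 : (1 < q)%N.
Proof. exact: card_finNzRing_gt1. Qed.

Lemma q_unit : (q%:R : R) \is a GRing.unit.
Proof. by have := unitr_natP l_prime R_local l_q. Qed.

Lemma phiE b : phi b = logn l (\prod_(x <- b) qfact q x).
Proof.
rewrite /blocks_val; elim: b => [|x b IH]; first by rewrite !big_nil logn1.
rewrite !big_cons IH lognM ?qfact_gt0 //; last first.
  by rewrite big_seq prodn_cond_gt0 // => y _; apply: qfact_gt0.
by rewrite (logn_qfact q_gt1 l_prime l_q e_gt1 l_e e_min).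
Qed.

Lemma norm_phi b : good b -> (0 < norm b)%N /\ (logn l (norm b) + phi b = Phi)%N.
Proof.
move=> /andP[_ /eqP bn]; have := dec_sum_block q b; rewrite bn => E.
have := qfact_gt0 q n; rewrite -{1}E muln_gt0 => /andP[N0 Q0]; split=> //.
by rewrite phiE -lognM // E.
Qed.

Lemma steinberg_separation (M : submodule V) x : ~ subm_set M x ->
  exists b, [/\ good b, subm_set (cyclic_subm x) (Fb b) & ~ subm_set M (Fb b)].
Proof.
move=> /(separation R_char0 R_local psiD psi0 psi_nontriv q_unit)[D [xD MD]].
have [b gb bD] := composition_of_bdry D n; exists b.
suff -> : Fb b = @F_elt F n R l (linchar D) by [].
by rewrite /F_elt; congr (quotmod_pi _ (_ *: _)); apply: eq_char_sum.
Qed.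

Lemma steinberg_filtration b c : good b -> (subm_set (L c) (Fb b) <-> (c + phi b <= Phi)%N).
Proof.
move=> gb; have [N0 NE] := norm_phi gb.
have H := L_filtP m R_char0 R_local psiD psi0 psi_nontriv q_unit c (bdry b).
have H2 := dvd_expP l_prime R_char0 R_local c N0.
by rewrite -NE leq_add2r; split=> [/H/H2|/H2/H].
Qed.

Lemma steinberg_symmetry b b' c : good b -> good b' -> phi b' = phi b ->
  (c + phi b = Phi)%N ->
  subm_set (add_subm (cyclic_subm (Fb b)) (L c.+1)) (Fb b') ->
  subm_set (cyclic_subm (Fb b')) (Fb b).
Proof.
move=> gb gb' bb' cb; have [N0 NE] := norm_phi gb; have [N0' NE'] := norm_phi gb'.
apply: (filt_sym l_prime R_char0 R_local psiD psi0 psi_nontriv q_unit N0 N0'); lia.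
Qed.

Lemma steinberg_reach_perm b b' : good b -> perm_eq b b' -> subm_set (cyclic_subm (Fb b)) (Fb b').
Proof. by move=> gb bb'; apply/reach_cyclic/reach_elt_perm => //; apply: q_unit. Qed.

Lemma steinberg_reach_split (x y : nat) b : good (x + y :: b)%N -> (0 < x)%N -> (0 < y)%N ->
  subm_set (cyclic_subm (Fb (x + y :: b)%N)) (Fb (y :: x :: b)).
Proof. by move=> gb x0 y0; apply/reach_cyclic/reach_elt_split => //; apply: q_unit. Qed.

Lemma steinberg_val_le b : good b -> (phi b <= Phi)%N.
Proof. by move=> /norm_phi[_ <-]; apply: leq_addl. Qed.

Lemma val_e_gt0 : (0 < d)%N.
Proof. exact: d_gt0 l_prime e_gt1 l_e. Qed.

Lemma root_subgroupP (k : 'I_m) (g : G) :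
  (g \in @root_subgroup F n (lo k) (hi k)) <-> exists a, g = xs k a.
Proof.
have xsE a : val (xs k a) = 1%:M + a *: delta_mx (lo k) (hi k) :> 'M[F]_n.
  by apply/matrixP => i j; have := ent_xs k a i j; rewrite /ent => ->; rewrite !mxE.
rewrite inE; split=> [/existsP[a /eqP gE]|[a ->]].
  by exists a; apply: val_inj; rewrite gE xsE.
by apply/existsP; exists a; rewrite xsE.
Qed.

Lemma char_parabolic_e_blocks a : (e * a <= n)%N ->
  char_parabolic (linchar (bdry (e_blocks n e a))) = block_parabolic F n e a.
Proof.
move=> ea; apply: (block_parabolic_gen e_gt1 ea) => [g|k nk]; rewrite inE.
  case/existsP=> i /existsP[j /and3P[/eqP ji /exists_inP[x xr lx] /eqP gE]].
  have [k iE jE] := lo_hiP ji; exists k; last by rewrite gE iE jE.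
  move: xr lx; rewrite iE jE => /root_subgroupP[c ->].
  by rewrite (linchar_xs psi0); case: ifP; rewrite ?eqxx.
have [c psic] := psi_nontriv.
apply/existsP; exists (lo k); apply/existsP; exists (hi k).
rewrite val_hi eqxx /=; apply/andP; split=> //.
apply/exists_inP; exists (xs k c); first by apply/root_subgroupP; exists c.
by rewrite (linchar_xs psi0) (negbTE nk).
Qed.

Lemma index_val (P : {group G}) : B \subset P ->
  (logn l #|'GL_n[F] : P|%g + logn l #|P : B|%g = Phi)%N.
Proof.
move=> BP; rewrite -lognM ?indexg_gt0 //; congr logn.
rewrite -(index_borel F m); apply: (@Lagrange_index _ _ P (borel_group F m)) => //.
exact: finset.subsetT.
Qed.

(** If all the quotients x / e were less than l, then no factorial would
    contribute and the valuation would be a multiple of d. So l <= x / e for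
    some x, and d * (x / e) is at most the valuation. *)
Lemma exceptional_bound (P : {group G}) a : B \subset P ->
  (d * (a - 1) < logn l #|P : B|%g < d * a)%N -> (l <= a - 1)%N.
Proof.
move=> BP; have [b _ ->] := parabolic_composition BP; rewrite -phiE => bd.
case: (boolP (has (fun x => l <= x %/ e)%N b)) => [/hasP[x xb lx]|nh].
  apply: leq_trans lx _; have d0 := val_e_gt0.
  have : (d * (x %/ e) < d * a)%N.
    case/andP: bd => _; apply: leq_ltn_trans.
    by rewrite /blocks_val (big_rem x) //= -addnA leq_addr.
  by rewrite ltn_pmul2l //; lia.
case: (between_muln bd (t := (\sum_(x <- b) x %/ e)%N)).
rewrite big_distrr /= /blocks_val; apply: eq_big_seq => x xb.
have := hasPn nh x xb; rewrite -ltnNge => xl.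
rewrite [logn l (_`!)](_ : _ = 0)%N ?addn0 //.
apply: logn_coprime; rewrite prime_coprime //.
elim: (x %/ e)%N xl => [|t IH] tl; first by rewrite fact0 dvdn1; case: eqP l_prime => // ->.
rewrite factS Euclid_dvdM // negb_or IH ?(ltnW tl) // andbT.
by apply/negP => /dvdn_leq; lia.
Qed.

Lemma socle_parabolic (P : {group G}) : B \subset P ->
  ((socle (quotmod (L_par_sharp R l P)) : set (quotmod (L_par_sharp R l P))) =
     subm_pi (L_par_sharp R l P) (L_par R l P)
   \/
   exists (a : nat) (lam : G -> R),
     [/\ (l <= a - 1 < n %/ e)%N,
         (d * (a - 1) < logn l #|P : B|%g < d * a)%N,
         unitri_char lam,
         char_parabolic lam = block_parabolic F n e a
       & irreducible (subm_pi (L_par_sharp R l P) (L_prime l lam))]).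
Proof.
move=> BP; have PE := index_val BP.
have [|H|[a [a0 ea bd irr]]] := socle_filt l_prime e_gt1 val_e_gt0
  steinberg_separation steinberg_filtration steinberg_symmetry
  steinberg_reach_perm steinberg_reach_split steinberg_val_le (c := logn l #|'GL_n[F] : P|%g).
- by rewrite -PE leq_addr.
- by left.
right; exists a, (linchar (bdry (e_blocks n e a))).
have bd' : (d * (a - 1) < logn l #|P : B|%g < d * a)%N by rewrite -PE addKn in bd.
split=> //; last 1 first.
- exact: char_parabolic_e_blocks.
- rewrite (exceptional_bound BP bd') /= leq_divRL ?(ltnW e_gt1) //.
  by rewrite subn1 mulnC; case: a a0 ea {bd irr bd'}.
- exact: linchar_char.
Qed.

Theorem socle_series_one : d = 1%N -> exists N : nat,
  (forall c : nat, (N <= c)%N -> (L c : set V) = [set 0]) /\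
  socle_series (rev
    [seq X <- undup (mkseq (fun c : nat => L c : set V) N) | X != [set 0]]).
Proof.
move=> d1; apply: (socle_series_filt l_prime e_gt1 val_e_gt0
  steinberg_separation steinberg_filtration steinberg_symmetry
  steinberg_reach_perm steinberg_reach_split steinberg_val_le d1).
- by rewrite /composition /= addn0 eqxx.
- by rewrite phiE big_seq1.
Qed.

End SocleOfSteinberg.

Theorem theorem6p5
  (F : finFieldType) (p l n : nat) (R : idomainType) (z : R) (e d : nat)
  (hn : (2 <= n)%N)
  (hp : p \in [pchar F])
  (hl : prime l) (hlp : l != p)
  (hpid : principal_ideal_domain R)
  (hloc : local_with_maximal_ideal (mult_subm R^o l))
  (hchar : [pchar R] =i pred0)
  (hz : p.-primitive_root z)
  (he2 : (2 <= e)%N)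
  (hel : (l %| (#|F| ^ e - 1) %/ (#|F| - 1))%N)
  (hemin : forall i : nat,
     (2 <= i)%N -> (l %| (#|F| ^ i - 1) %/ (#|F| - 1))%N -> (e <= i)%N)
  (hd : d = logn l ((#|F| ^ e - 1) %/ (#|F| - 1))%N) :
  (d = 1%N ->
     exists N : nat,
       (forall c : nat, (N <= c)%N ->
          (L_filt F n R l c : set (Lmod F n R l)) = [set 0]) /\
       socle_series (rev
         [seq X <- undup (mkseq (fun c : nat =>
                            L_filt F n R l c : set (Lmod F n R l)) N)
            | X != [set 0]]))
  /\
  (forall P : {group {'GL_n[F]}}, borel F n \subset P ->
     ((socle (quotmod (L_par_sharp R l P)) : set (quotmod (L_par_sharp R l P))) =
        subm_pi (L_par_sharp R l P) (L_par R l P)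
      \/
      exists (a : nat) (lam : {'GL_n[F]} -> R),
        [/\ (l <= a - 1 < n %/ e)%N,
            (d * (a - 1) < logn l #|P : borel F n|%g < d * a)%N,
            unitri_char lam,
            char_parabolic lam = block_parabolic F n e a
          & irreducible (subm_pi (L_par_sharp R l P) (L_prime l lam))])
     /\
     ((d * (n %/ e) <= logn l #|P : borel F n|%g)%N ->
      (socle (quotmod (L_par_sharp R l P)) : set (quotmod (L_par_sharp R l P))) =
        subm_pi (L_par_sharp R l P) (L_par R l P))).
Proof.
case: n hn => [//|m] _; have q1 := q_gt1 F.
rewrite qintE // in hel hd; have e_min i : (1 < i)%N -> (l %| qint #|F| i)%N -> (e <= i)%N.
  by move=> i1; rewrite -qintE //; apply: hemin.
have l_q : ~~ (l %| #|F|)%N by apply: contra hlp => /(prime_dvd_card_field hp hl) ->.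
have [psi [psiD psi0 psiN]] := additive_char_exists hp hz.
rewrite {}hd; split; first exact: socle_series_one psiD psi0 psiN l_q he2 hel e_min.
move=> P BP.
have H := socle_parabolic hl hchar hloc psiD psi0 psiN l_q he2 hel e_min BP.
split=> // big; case: H => [//|[a [lam [/andP[_ a1] /andP[_ lt] _ _ _]]]].
have := leq_ltn_trans big lt; rewrite ltnNge leq_mul2l; case/negP; apply/orP; right.
by move: a1; clear; lia.
Qed.
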